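(* Let $X$ be a complex Banach space and let $-A$ be the generator of a bounded $C_0$-semigroup $(T(t))_{t\ge 0}$ on $X$ such that $\overline{\mathrm{ran}}(A)=X$. Let $g$ be a Stieltjes function with representation $(0,0,\mu)$ and $g(0+)=\infty$. If $x\in X$ is such that $$\int_1^\infty \frac{|g'(1/t)|\,\|C_t(A)x\|}{t^2}\,dt<\infty,$$ then $x\in \mathrm{dom}(g(A))$.
   Context: Cesàro means: $C_t(A)x:=\frac1t\int_0^t T(s)x\,ds$ for $t>0$, $x\in X$. Stieltjes functions: a Stieltjes function with representation $(0,0,\mu)$ is a function $g(z)=\int_{(0,\infty)}\frac{\mu(ds)}{z+s}$, $z>0$, where $\mu$ is a positive Radon measure on $(0,\infty)$ with $\int_{(0,\infty)}\frac{\mu(ds)}{1+s}<\infty$; the same formula extends $g$ holomorphically to $\mathbb C_+=\{z:\mathrm{Re}\, z>0\}$. Here $g(0+)=\lim_{s\to0+}g(s)$. Extended Hille–Phillips calculus: let $\mathcal A$ be the set of Laplace transforms $e(z)=\int_{[0,\infty)}e^{-sz}\,\nu(ds)$ of bounded Radon measures $\nu$ on $[0,\infty)$, and for such $e$ put $e(A)=\int_{[0,\infty)}T(s)\,\nu(ds)$ (strongly convergent integral). A holomorphic $h:\mathbb C_+\to\mathbb C$ is regularizable if there is $e\in\mathcal A$ with $eh\in\mathcal A$ and $e(A)$ injective; then $h(A):=e(A)^{-1}(eh)(A)$ with domain $\mathrm{dom}(h(A))=\{x\in X:(eh)(A)x\in\mathrm{ran}(e(A))\}$, and this does not depend on the choice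 of $e$. When $\overline{\mathrm{ran}}(A)=X$ (so that $\ker A=\{0\}$), every Stieltjes function is regularizable by $e(z)=z/(z+1)$, and $g(A)$ is the closed operator so obtained. *)

(* Defs.v *)
From HB Require Import structures.
From mathcomp Require Import all_boot all_order all_algebra.
From mathcomp Require Import complex.
From mathcomp Require Import all_classical all_reals all_analysis.

Set Implicit Arguments.
Unset Strict Implicit.
Unset Printing Implicit Defensive.

Import Order.TTheory GRing.Theory Num.Theory.
Import numFieldNormedType.Exports.

Local Open Scope classical_set_scope.
Local Open Scope ring_scope.
Local Open Scope complex_scope.

(* The norm of a normed module over R[i] takes its values in R[i]. *)
Definition rnorm (R : realType) (X : normedModType R[i]) (x : X) : R :=
  complex.Re `|x|.

Section bochner.
Context (R : realType) (X : normedModType R[i]).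
Context d (T : measurableType d) (mu : {measure set T -> \bar R}).

(* A list [:: (B_1, x_1); ...; (B_k, x_k)] stands for the X-valued simple
   function \sum_i 1_(B_i) x_i; the B_i need not be disjoint. *)
Definition simple_eval (s : seq (set T * X)) (t : T) : X :=
  \sum_(p <- s) (\1_(p.1) t : R)%:C *: p.2.

Definition simple_int (D : set T) (s : seq (set T * X)) : X :=
  \sum_(p <- s) (fine (mu (p.1 `&` D)))%:C *: p.2.

Definition simple_integrable (D : set T) (s : seq (set T * X)) : Prop :=
  forall B x, (B, x) \in s -> measurable B /\ (mu (B `&` D) < +oo)%E.

Definition is_bochner (D : set T) (f : T -> X) (y : X) : Prop :=
  exists s : nat -> seq (set T * X),
    [/\ forall n, simple_integrable D (s n),
        {ae mu, forall t, D t -> simple_eval (s n) t @[n --> \oo] --> f t},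
        (\int[mu]_(t in D) (rnorm (f t - simple_eval (s n) t))%:E)%E
          @[n --> \oo] --> 0%E
      & simple_int D (s n) @[n --> \oo] --> y].

(* The value is 0 when f is not Bochner integrable on D. *)
Definition bochner (D : set T) (f : T -> X) : X := xget 0 (is_bochner D f).

End bochner.

Section complex_integral.
Context (R : realType).

Definition cintegral d (T : measurableType d) (mu : {measure set T -> \bar R})
    (D : set T) (f : T -> R[i]) : R[i] :=
  Complex (Rintegral mu D (fun t => complex.Re (f t)))
          (Rintegral mu D (fun t => complex.Im (f t))).

Definition cexp (z : R[i]) : R[i] :=
  (expR (complex.Re z))%:C * Complex (cos (complex.Im z)) (sin (complex.Im z)).

(* A bounded complex Radon measure nu on [0, +oo[, given by a decomposition
   nu = nu_1 - nu_2 + i (nu_3 - nu_4) into finite positive Borel measures (it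
   exists by the Jordan decomposition of the real and imaginary parts, and
   integrals do not depend on it). The four measures live on the whole line,
   but only their restrictions to [0, +oo[ are ever used. *)
Record cmeasure := CMeasure {
  re_pos : {finite_measure set (measurableTypeR R) -> \bar R} ;
  re_neg : {finite_measure set (measurableTypeR R) -> \bar R} ;
  im_pos : {finite_measure set (measurableTypeR R) -> \bar R} ;
  im_neg : {finite_measure set (measurableTypeR R) -> \bar R} }.

Definition laplace (nu : cmeasure) (z : R[i]) : R[i] :=
  let I (m : {finite_measure set (measurableTypeR R) -> \bar R}) :=
    cintegral m `[0, +oo[ (fun s => cexp (- (s : R)%:C * z)) in
  I (re_pos nu) - I (re_neg nu) + Complex 0 1 * (I (im_pos nu) - I (im_neg nu)).

End complex_integral.

(* A (possibly unbounded) operator is represented by its graph. *)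
Section operators.
Context (R : realType) (X : normedModType R[i]).

Definition dom (A : set (X * X)) : set X := [set x | exists y, A (x, y)].

Definition ran (A : set (X * X)) : set X := [set y | exists x, A (x, y)].

Definition opp_op (A : set (X * X)) : set (X * X) :=
  [set p | A (p.1, - p.2)].

(* Only the values T t with 0 <= t matter, here and below. *)
Definition bounded_C0_semigroup (T : R -> {linear X -> X}) : Prop :=
  [/\ forall x, T 0 x = x,
      forall s t x, 0 <= s -> 0 <= t -> T (s + t) x = T s (T t x),
      forall x, T t x @[t --> 0^'+] --> x
    & exists M : R, forall t x, 0 <= t -> rnorm (T t x) <= M * rnorm x].

Definition generator (T : R -> {linear X -> X}) : set (X * X) :=
  [set p | (h^-1)%:C *: (T h p.1 - p.1) @[h --> (0 : R)^'+] --> p.2].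

Definition cesaro_mean (T : R -> {linear X -> X}) (t : R) (x : X) : X :=
  (t^-1)%:C *: bochner (@lebesgue_measure R) `[0, t] (fun s => T s x).

(* The bounded operator e(A) for e = laplace nu, -A being the generator
   of T. *)
Definition hp_bounded (T : R -> {linear X -> X}) (nu : cmeasure R) (x : X)
    : X :=
  let I (m : {finite_measure set (measurableTypeR R) -> \bar R}) :=
    bochner m `[0, +oo[ (fun s => T s x) in
  I (re_pos nu) - I (re_neg nu) + Complex 0 1 *: (I (im_pos nu) - I (im_neg nu)).

(* The graph of h(A) = e(A)^-1 (e h)(A), where e = laplace nu is a regularizer
   of h and e h = laplace rho on the open right half-plane. It does not depend
   on the regularizer, and it is empty if h is not regularizable. *)
Definition hp_calculus (T : R -> {linear X -> X}) (h : R[i] -> R[i])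
    : set (X * X) :=
  [set p | exists nu rho : cmeasure R,
    [/\ forall z, 0 < complex.Re z -> laplace rho z = laplace nu z * h z,
        injective (hp_bounded T nu)
      & hp_bounded T rho p.1 = hp_bounded T nu p.2]].

End operators.

Section stieltjes.
Context (R : realType) (mu : {measure set (measurableTypeR R) -> \bar R}).

(* Only the restriction of mu to ]0, +oo[ matters. The condition makes it
   finite on compact subsets of ]0, +oo[, hence Radon. *)
Definition stieltjes_measure : Prop :=
  (\int[mu]_(s in `]0%R, +oo[) ((1 + s)^-1)%:E < +oo)%E.

Definition stieltjes (x : R) : R := Rintegral mu `]0, +oo[ (fun s => (x + s)^-1).

Definition stieltjesC (z : R[i]) : R[i] :=
  cintegral mu `]0, +oo[ (fun s => (z + (s : R)%:C)^-1).

End stieltjes.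

(* Main.v *)
From HB Require Import structures.
Require Import Defs.
From mathcomp Require Import all_boot all_order all_algebra.
From mathcomp Require Import complex.
From mathcomp Require Import all_classical all_reals all_analysis.
From mathcomp Require Import measurable_realfun.
From mathcomp Require Import ring lra.

(* Let E be the exponential law of parameter 1. The regularizer z / (z + 1) is
   the Laplace transform of delta_0 - E, and s (s + A)^-1 x = E[T (v / s) x].
   Hence the contribution y_n of the part s > 1 / (n + 1) of mu to
   g(A) x = \int mu(ds) (s + A)^-1 x is a Bochner integral of the orbit of x
   against a finite measure. An integration by parts gives
   (s + A)^-1 x = \int_0^oo s r e^(- s r) C_r(A) x dr; since
   s r e^(- s r) <= 27 / (1 + s r)^2 and
   |g'(1 / r)| / r^2 = \int mu(ds) / (1 + s r)^2, the hypothesis makes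
   (s + A)^-1 x integrable in norm over 0 < s <= 1, so y_n is Cauchy. Its limit
   y satisfies e(A) y = (e g)(A) x, because e(A) (s + A)^-1 x is absolutely
   integrable over all s > 0. For the injectivity of e(A) = 1 - (1 + A)^-1, a
   fixed point w of (1 + A)^-1 satisfies s (s + A)^-1 w = w for all 0 < s <= 1,
   whereas s (s + A)^-1 A u tends to 0 with s and the vectors A u are dense.
   Identities between vectors are tested on bounded real-linear functionals,
   which reduces all of them to Fubini arguments for scalar integrals. *)

Set Implicit Arguments.
Unset Strict Implicit.
Unset Printing Implicit Defensive.

Import Order.TTheory GRing.Theory Num.Theory.
Import numFieldNormedType.Exports.

Local Open Scope classical_set_scope.
Local Open Scope ring_scope.

(** * Real-linear functionals *)

(** Functionals may be merely real-linear because the measures representing e and e g are real: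
    their imaginary components are zero, and z survives only in the real pair e^(- a t) cos (b t),
    e^(- a t) sin (b t). What shapes the proof is that Fubini is needed for mu, while 1 / s need not
    be mu-integrable near 0 and nothing is known about mu off ]0, +oo[. So mu is always first
    multiplied by a weight of order at most 1 / (1 + s), which turns it into a finite measure: 1 / s
    cut off below eps for the approximants, 1 / max 1 s for e g, and again 1 / max 1 s for the
    estimate near 0, where this weight equals 1. Identities for these measures are proved for
    nonnegative functions by Tonelli in the extended reals, then carried over to bounded functions
    by adding a constant. The factor 27 comes from cubing 1 + y <= 3 e^(y / 3). *)

Section real_norm.
Context (R : realType) (X : normedModType R[i]).
Implicit Types (v w : X) (r : R).

Lemma rnormC v : (rnorm v)%:C%C = `|v|.
Proof. by rewrite /rnorm RRe_real // ger0_real. Qed.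

Lemma rnorm_ge0 v : 0 <= rnorm v.
Proof. by rewrite -lecR rnormC; exact: normr_ge0. Qed.

Lemma rnormZ (c : R[i]) v : rnorm (c *: v) = complex.Re `|c| * rnorm v.
Proof.
by rewrite {1}/rnorm normrZ -rnormC -(RRe_real (ger0_real (normr_ge0 c))) /= mulr0 subr0.
Qed.

Lemma rnormZr r v : rnorm (r%:C%C *: v) = `|r| * rnorm v.
Proof. by rewrite rnormZ normc_def /= expr0n addr0 sqrtr_sqr. Qed.

Lemma rnormD v w : rnorm (v + w) <= rnorm v + rnorm w.
Proof. by rewrite -lecR rmorphD /= !rnormC ler_normD. Qed.

Lemma rnormN v : rnorm (- v) = rnorm v.
Proof. by rewrite /rnorm normrN. Qed.

Lemma rnormB v w : rnorm (v - w) = rnorm (w - v).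
Proof. by rewrite -rnormN opprB. Qed.

Lemma ler_dist_rnorm v w : `|rnorm v - rnorm w| <= rnorm (v - w).
Proof.
have H1 := rnormD (v - w) w; have H2 := rnormD (w - v) v.
rewrite !subrK in H1 H2; rewrite (rnormB w) in H2.
by rewrite ler_norml; lra.
Qed.

Lemma rnorm0 : rnorm (0 : X) = 0.
Proof. by rewrite /rnorm normr0. Qed.

Lemma rnorm_eq0 v : rnorm v = 0 -> v = 0.
Proof. by move=> v0; apply/normr0_eq0; rewrite -rnormC v0. Qed.

(** A positive element of [R[i]] has zero imaginary part, so the epsilons of the complex-valued norm
    are exactly the real ones. *)
Lemma cvg_rnormP (I : Type) (F : set_system I) {FF : Filter F} (f : I -> X) v :
  f i @[i --> F] --> v <-> rnorm (v - f i) @[i --> F] --> (0 : R).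
Proof.
split=> [/cvgrPdist_lt fv|/cvgrPdist_lt fv]; apply/cvgrPdist_lt => e e0.
  have e0' : (0 : R[i]) < e%:C%C by rewrite ltcR.
  near=> i; rewrite sub0r normrN ger0_norm ?rnorm_ge0 // -ltcR rnormC.
  by near: i; exact: fv.
move: e0; rewrite ltcE /= => /andP[/eqP eI e0].
have := fv _ e0; apply: filterS => i.
rewrite sub0r normrN ger0_norm ?rnorm_ge0 // -ltcR rnormC.
by case: e eI {e0} => a b /= ->.
Unshelve. all: by end_near. Qed.

Lemma cvg_rnorm (I : Type) (F : set_system I) {FF : Filter F} (f : I -> X) v :
  f i @[i --> F] --> v -> rnorm (f i) @[i --> F] --> rnorm v.
Proof.
move=> /cvg_rnormP /cvgrPdist_lt fv; apply/cvgrPdist_lt => e e0.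
have := fv _ e0; apply: filterS => i.
rewrite sub0r normrN ger0_norm ?rnorm_ge0 //; apply: le_lt_trans.
exact: ler_dist_rnorm.
Qed.

End real_norm.

(** The bound is split into [b n + b m] because [b n] stands for the distance of [u n] to a limit
    that is known at first only through functionals. *)
Lemma rnorm_cauchy_cvg (R : realType) (X : completeNormedModType R[i])
    (u : nat -> X) (b : nat -> R) :
  (forall m n, rnorm (u n - u m) <= b n + b m) ->
  b n @[n --> \oo] --> (0 : R) -> cvgn u.
Proof.
move=> ub b0; apply: cauchy_cvg; apply: cauchy_exP => e; rewrite ltcE /= => /andP[/eqP eI e0].
have e20 : 0 < complex.Re e / 2 by rewrite divr_gt0.
move/cvgrPdist_lt: b0 => /(_ _ e20) [N _ bN].
exists (u N); exists N => // n /= Nn; rewrite -ball_normE /=.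
have -> : e = (complex.Re e)%:C%C by case: e eI {e0 e20 bN} => c d /= ->.
rewrite -rnormC ltcR; apply: (le_lt_trans (ub _ _)).
have := bN N (leqnn _); have := bN n Nn; rewrite !sub0r !normrN.
by move=> /ltr_normlW ? /ltr_normlW ?; rewrite [ltRHS]splitr ltrD.
Qed.

Section real_functionals.
Context (R : realType) (X : normedModType R[i]).

(** With real scalars only, the Hahn-Banach argument needs no complexification and every tested
    integral is an integral of real functions. *)
Definition rlinear (phi : X -> R) : Prop :=
  (forall v w, phi (v + w) = phi v + phi w) /\
  (forall r v, phi (r%:C%C *: v) = r * phi v).

Definition rbounded (C : R) (phi : X -> R) : Prop :=
  forall v, `|phi v| <= C * rnorm v.

Section rlinear_theory.
Context (phi : X -> R) (phil : rlinear phi).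

Lemma rlinearD v w : phi (v + w) = phi v + phi w. Proof. exact: phil.1. Qed.

Lemma rlinearZ r v : phi (r%:C%C *: v) = r * phi v. Proof. exact: phil.2. Qed.

Lemma rlinear0 : phi 0 = 0.
Proof. by rewrite -(scale0r 0) (rlinearZ 0) mul0r. Qed.

Lemma rlinearN v : phi (- v) = - phi v.
Proof. by apply/eqP; rewrite -addr_eq0 -rlinearD addNr rlinear0. Qed.

Lemma rlinearB v w : phi (v - w) = phi v - phi w.
Proof. by rewrite rlinearD rlinearN. Qed.

Lemma rbounded_cvg C (I : Type) (F : set_system I) {FF : Filter F} (f : I -> X) v :
  rbounded C phi -> f i @[i --> F] --> v -> phi (f i) @[i --> F] --> phi v.
Proof.
move=> phiC /cvg_rnormP fv.
have {}fv : C * rnorm (v - f i) @[i --> F] --> (0 : R).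
  by rewrite -(mulr0 C); apply: cvgM => //; exact: cvg_cst.
apply/cvgrPdist_lt => e e0; move/cvgrPdist_lt : fv => /(_ _ e0).
apply: filterS => i; rewrite sub0r normrN => /ltr_normlW; apply: le_lt_trans.
by rewrite -rlinearB phiC.
Qed.

End rlinear_theory.

(** * A norming functional by the Hahn-Banach argument *)

Section hahn_banach.
Variable v0 : X.

(* The graph of a real-linear functional, dominated by the norm, on a subspace
   containing [v0]: the bound forces single-valuedness. *)
Definition hb_graph (G : set (X * R)) : Prop :=
  [/\ G (v0, rnorm v0),
     (forall v w a b, G (v, a) -> G (w, b) -> G (v + w, a + b)),
     (forall r v a, G (v, a) -> G (r%:C%C *: v, r * a)) &
     (forall v a, G (v, a) -> a <= rnorm v)].

(** The value c at u has to satisfy a - |v - u| <= c <= |w + u| - b for all (v, a) and (w, b) in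
    [G]. The triangle inequality puts every left side below every right side, and c is the supremum
    of the left sides. *)
Lemma hb_graph_extend (G : set (X * R)) u : hb_graph G ->
  (forall a, ~ G (u, a)) -> exists G', G `<` G' /\ hb_graph G'.
Proof.
move=> [G0 GD GZ Gle] Gu.
have GN v a : G (v, a) -> G (- v, - a).
  by move=> /(GZ (-1)); rewrite rmorphN1 scaleN1r mulN1r.
have G00 : G (0, 0) by rewrite -(mul0r (rnorm v0)) -(scale0r v0); exact: GZ G0.
pose S := [set p.2 - rnorm (p.1 - u) | p in G].
have Sub v a w b : G (v, a) -> G (w, b) -> a - rnorm (v - u) <= rnorm (w + u) - b.
  move=> va wb; have := Gle _ _ (GD _ _ _ _ va wb).
  have := rnormD (v - u) (w + u).
  by rewrite addrACA addNr addr0; lra.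
have supS : has_sup S.
  split; first by exists (0 - rnorm (0 - u)); exists (0, 0).
  by exists (rnorm (v0 + u) - rnorm v0) => _ [[v a] /= va <-]; exact: Sub.
pose c := sup S.
have c1 v a : G (v, a) -> a - rnorm (v - u) <= c.
  by move=> va; apply: ub_le_sup; [case: supS|exists (v, a)].
have c2 v a : G (v, a) -> c <= rnorm (v + u) - a.
  move=> va; apply: ge_sup; first by case: supS.
  by move=> _ [[w b] /= wb <-]; exact: Sub.
exists [set p | exists r v a, [/\ G (v, a), p.1 = v + r%:C%C *: u & p.2 = a + r * c]].
split.
  split.
    move=> [v a] va; exists 0, v, a; split => //=; first by rewrite scale0r addr0.
    by rewrite mul0r addr0.
  move=> /(_ (u, c)) ext; apply: (Gu c); apply: ext.
  by exists 1, 0, 0; split => //=; rewrite ?scale1r ?mul1r add0r.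
split.
- by exists 0, v0, (rnorm v0); split => //=; rewrite ?scale0r ?mul0r addr0.
- move=> v w a b [r [v' [a' /= [va -> ->]]]] [s [w' [b' /= [wb -> ->]]]].
  exists (r + s), (v' + w'), (a' + b'); split => /=; first exact: GD.
    by rewrite rmorphD scalerDl addrACA.
  by rewrite mulrDl addrACA.
- move=> r v a [s [v' [a' /= [va -> ->]]]].
  exists (r * s), (r%:C%C *: v'), (r * a'); split => /=; first exact: GZ.
    by rewrite scalerDr scalerA rmorphM.
  by rewrite mulrDr mulrA.
- move=> _ _ [r [v [a /= [va -> ->]]]].
  (* Dividing by |r| reduces the bound at v + r u to one of the two inequalities for c, taken at v /
     |r|; the sign of r decides which. *)
  have [r0|r0|->] := ltrgtP r 0; last by rewrite scale0r mul0r !addr0; exact: Gle.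
    have r1 : 0 < - r by rewrite oppr_gt0.
    have := c1 _ _ (GZ ((- r)^-1) _ _ va).
    rewrite -(ler_pM2l r1) mulrBr mulrA mulfV ?gt_eqF // mul1r.
    have -> : - r * rnorm (((- r)^-1)%:C%C *: v - u) = rnorm (v + r%:C%C *: u).
      rewrite -{1}(gtr0_norm r1) -rnormZr scalerBr scalerA -rmorphM mulfV ?gt_eqF //.
      by rewrite scale1r rmorphN scaleNr opprK.
    lra.
  have := c2 _ _ (GZ (r^-1) _ _ va).
  rewrite -(ler_pM2l r0) mulrBr mulrA mulfV ?gt_eqF // mul1r.
  have -> : r * rnorm ((r^-1)%:C%C *: v + u) = rnorm (v + r%:C%C *: u).
    rewrite -{1}(gtr0_norm r0) -rnormZr scalerDr scalerA -rmorphM mulfV ?gt_eqF //.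
    by rewrite scale1r.
  lra.
Qed.

Lemma norming_functional :
  exists phi : X -> R, [/\ rlinear phi, rbounded 1 phi & phi v0 = rnorm v0].
Proof.
pose P G := G = set0 \/ hb_graph G.
have [F FP totF|G [PG Gmax]] := @Zorn_bigcup _ P.
  have [[G FG hG]|noG] := pselect (exists2 G, F G & hb_graph G); last first.
    left; apply/seteqP; split => // p [G FG Gp].
    by case: (FP _ FG) => [G0|hG]; [rewrite G0 in Gp|case: noG; exists G].
  have FP' H p : F H -> H p -> hb_graph H.
    by move=> /FP[->|].
  right; split.
  - by exists G => //; case: hG.
  - move=> v w a b [H1 FH1 Hv] [H2 FH2 Hw].
    have [H12|H21] := totF _ _ FH1 FH2.
      by exists H2 => //; case: (FP' _ _ FH2 Hw) => _ + _ _; apply => //; exact: H12.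
    by exists H1 => //; case: (FP' _ _ FH1 Hv) => _ + _ _; apply => //; exact: H21.
  - by move=> r v a [H FH Hv]; exists H => //; case: (FP' _ _ FH Hv) => _ _ + _; apply.
  - by move=> v a [H FH Hv]; case: (FP' _ _ FH Hv) => _ _ _; apply.
have hG : hb_graph G.
  (* The empty graph is not maximal: it lies strictly below the graph of the functional on the line
     spanned by [v0]. *)
  case: PG => // G0; exfalso.
  have hG1 : hb_graph [set p | exists r, p = (r%:C%C *: v0, r * rnorm v0)].
    split.
    - by exists 1; rewrite scale1r mul1r.
    - by move=> v w a b [r [-> ->]] [s [-> ->]]; exists (r + s); rewrite rmorphD scalerDl mulrDl.
    - by move=> r v a [s [-> ->]]; exists (r * s); rewrite rmorphM scalerA mulrA.
    - by move=> v a [r [-> ->]]; rewrite rnormZr ler_wpM2r ?rnorm_ge0 ?ler_norm.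
  apply: (Gmax _ _ (or_intror hG1)); rewrite G0; split => //.
  by move=> /(_ (v0, rnorm v0)); apply; case: hG1.
have Gtot v : exists a, G (v, a).
  apply: contrapT => nGv.
  have [|G' [GG' hG']] := hb_graph_extend hG (u := v).
    by move=> a Ga; apply: nGv; exists a.
  exact: (Gmax _ GG' (or_intror hG')).
case: hG => G0 GD GZ Gle.
have GN v a : G (v, a) -> G (- v, - a).
  by move=> /(GZ (-1)); rewrite rmorphN1 scaleN1r mulN1r.
have Guniq v a b : G (v, a) -> G (v, b) -> a = b.
  move=> va vb; apply/eqP; rewrite eq_le.
  have := Gle _ _ (GD _ _ _ _ va (GN _ _ vb)).
  have := Gle _ _ (GD _ _ _ _ vb (GN _ _ va)).
  by rewrite subrr rnorm0 !subr_le0 => -> ->.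
have [phi phiG] := choice Gtot.
exists phi; split.
- split => [v w|r v].
    by apply: (Guniq (v + w)) => //; exact: GD.
  by apply: (Guniq (r%:C%C *: v)) => //; exact: GZ.
- move=> v; rewrite mul1r ler_norml Gle // andbT.
  by rewrite lerNl -(rnormN v) Gle //; exact: GN.
- exact: Guniq G0.
Qed.

End hahn_banach.

Lemma rfunctional_separates (v w : X) :
  (forall phi, rlinear phi -> rbounded 1 phi -> phi v = phi w) -> v = w.
Proof.
move=> vw; have [phi [phil phib phivw]] := norming_functional (v - w).
by apply/eqP; rewrite -subr_eq0; apply/eqP/rnorm_eq0; rewrite -phivw rlinearB // vw // subrr.
Qed.

End real_functionals.

(** * Bochner integrals of orbits *)

Section real_integrable.
Context (R : realType) d (T : measurableType d) (m : {measure set T -> \bar R}).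
Context (D : set T) (mD : measurable D).
Implicit Types f g : T -> R.

Lemma rintegrableD f g : m.-integrable D (EFin \o f) -> m.-integrable D (EFin \o g) ->
  m.-integrable D (EFin \o (fun t => f t + g t)).
Proof. by move=> fi gi; exact: (integrableD mD fi gi). Qed.

Lemma rintegrableB f g : m.-integrable D (EFin \o f) -> m.-integrable D (EFin \o g) ->
  m.-integrable D (EFin \o (fun t => f t - g t)).
Proof. by move=> fi gi; exact: (integrableB mD fi gi). Qed.

Lemma rintegrableZ k f : m.-integrable D (EFin \o f) ->
  m.-integrable D (EFin \o (fun t => k * f t)).
Proof. by move=> fi; exact: (integrableZl mD k fi). Qed.

Lemma rintegrableZr k f : m.-integrable D (EFin \o f) ->
  m.-integrable D (EFin \o (fun t => f t * k)).
Proof.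
by move=> fi; have := rintegrableZ k fi; apply: eq_integrable => // t _ /=; rewrite mulrC.
Qed.

Lemma bounded_rintegrable f K : (m D < +oo)%E -> measurable_fun D f ->
  (forall t, D t -> `|f t| <= K) -> m.-integrable D (EFin \o f).
Proof.
move=> Doo mf fK; apply: measurable_bounded_integrable => //.
exists K; split; rewrite ?num_real // => M KM t Dt /=.
by rewrite (le_trans (fK _ Dt)) // ltW.
Qed.

End real_integrable.

Section weak_integral.
Context (R : realType) (X : normedModType R[i]).
Context d (T : measurableType d) (m : {measure set T -> \bar R}).
Context (D : set T) (mD : measurable D).

(** Subtracting a simple function amounts, piece by piece, to subtracting a fixed vector, so
    measurability of the distances to fixed vectors is enough to integrate approximation errors. *)
Definition norm_measurable (f : T -> X) : Prop :=
  forall v, measurable_fun D (fun t => rnorm (f t - v)).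

Lemma simple_eval_cons (p : set T * X) s t :
  simple_eval (p :: s) t = ((\1_(p.1) t : R)%:C)%C *: p.2 + simple_eval s t.
Proof. by rewrite /simple_eval big_cons. Qed.

(** Induction with [f] generalized: the head of the list is absorbed into [f], and f - 1_B x has
    distance to v equal to that of f to x + v on B and to v off B. *)
Lemma norm_measurable_simple f s : norm_measurable f -> simple_integrable m D s ->
  measurable_fun D (fun t => rnorm (f t - simple_eval s t)).
Proof.
move=> + + ; elim: s f => [|[B x] s IH] f nf si.
  have := nf 0; apply: eq_measurable_fun => t _.
  by rewrite /simple_eval big_nil.
have mB : measurable B by case: (si B x) => //; rewrite mem_head.
have := IH (fun t => f t - ((\1_B t : R)%:C)%C *: x) _ _.
rewrite (_ : (fun t => rnorm (f t - ((\1_B t : R)%:C)%C *: x - simple_eval s t)) =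
  (fun t => rnorm (f t - simple_eval ((B, x) :: s) t))); last first.
  by apply/funext => t; rewrite simple_eval_cons /= opprD addrA.
apply=> [v|B' x' h]; last by apply: (si B' x'); rewrite in_cons h orbT.
rewrite (_ : (fun t => _) = (fun t => if t \in B then rnorm (f t - (x + v))
                                    else rnorm (f t - v))); last first.
  apply/funext => t; rewrite indicE; case: (t \in B) => /=.
    by rewrite scale1r opprD addrA.
  by rewrite scale0r subr0.
apply: measurable_fun_if => //.
- apply: (measurable_fun_bool true).
  rewrite (_ : _ @^-1` _ = B); first exact: measurableI.
  by apply/seteqP; split => t /=; [exact: set_mem|exact: mem_set].
- apply: measurable_funS (nf (x + v)) => //; exact: subIsetl.
- apply: measurable_funS (nf v) => //; exact: subIsetl.
Qed.

Lemma integrable_indicI B : measurable B -> (m (B `&` D) < +oo)%E ->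
  m.-integrable D (EFin \o (\1_B : T -> R)).
Proof.
move=> mB BD; apply/integrableP; split.
  by apply/measurable_EFinP; exact: measurable_indic.
rewrite (_ : integral _ _ _ = m (B `&` D)) // -integral_indic //.
by apply: eq_integral => t _ /=; rewrite ger0_norm // indicE.
Qed.

Lemma rlinear_simple_int (phi : X -> R) s : rlinear phi -> simple_integrable m D s ->
  m.-integrable D (EFin \o (phi \o simple_eval s)) /\
  phi (simple_int m D s) = \int[m]_(t in D) phi (simple_eval s t).
Proof.
move=> phil; elim: s => [|[B x] s IH] si.
  rewrite (_ : phi \o _ = cst 0); last first.
    by apply/funext => t /=; rewrite /simple_eval big_nil rlinear0.
  split; first exact: integrable0.
  rewrite /simple_int big_nil rlinear0 //.
  under eq_Rintegral do rewrite /simple_eval big_nil rlinear0 //.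
  by rewrite Rintegral_cst // mul0r.
have [mB Boo] : measurable B /\ (m (B `&` D) < +oo)%E.
  by apply: (si B x); rewrite mem_head.
have [|iss IHs] := IH; first by move=> B' x' h; apply: (si B' x'); rewrite in_cons h orbT.
have iB := integrable_indicI mB Boo.
have E t : phi (simple_eval ((B, x) :: s) t) =
    phi x * (\1_B t : R) + phi (simple_eval s t).
  by rewrite simple_eval_cons rlinearD // rlinearZ // mulrC.
have iBx : m.-integrable D (EFin \o (fun t => phi x * \1_B t)) by exact: rintegrableZ.
split.
  have := rintegrableD mD iBx iss; apply: eq_integrable => // t _.
  by rewrite /= E.
under eq_Rintegral do rewrite E.
rewrite RintegralD // -IHs RintegralZl //.
rewrite /simple_int big_cons rlinearD // rlinearZ // mulrC; congr (_ * _ + _).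
by rewrite /Rintegral integral_indic.
Qed.

Lemma simple_int_approx (phi : X -> R) C f s : 0 <= C -> rlinear phi -> rbounded C phi ->
  norm_measurable f -> m.-integrable D (EFin \o (phi \o f)) ->
  simple_integrable m D s ->
  ((`|\int[m]_(t in D) phi (f t) - phi (simple_int m D s)|)%:E <=
   C%:E * \int[m]_(t in D) (rnorm (f t - simple_eval s t))%:E)%E.
Proof.
move=> C0 phil phib nf phif si; have [iss ->] := rlinear_simple_int phil si.
rewrite -RintegralB //.
have iB : m.-integrable D (EFin \o (fun t => phi (f t) - phi (simple_eval s t))).
  exact: rintegrableB.
have nm := norm_measurable_simple nf si.
rewrite EFin_normr_Rintegral //; apply: (le_trans (le_abse_integral _ _ _)) => //.
  exact: measurable_int iB.
rewrite -ge0_integralZl_EFin //; last 2 first.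
- by move=> t _; rewrite lee_fin rnorm_ge0.
- exact/measurable_EFinP.
apply: ge0_le_integral => //.
- by apply: measurableT_comp => //; exact: measurable_int iB.
- by apply: measurable_funeM; exact/measurable_EFinP.
- by move=> t _ /=; rewrite -EFinM lee_fin -rlinearB.
Qed.

Lemma simple_int_cvg (phi : X -> R) C f (s : nat -> seq (set T * X)) :
  0 <= C -> rlinear phi -> rbounded C phi ->
  norm_measurable f -> m.-integrable D (EFin \o (phi \o f)) ->
  (forall n, simple_integrable m D (s n)) ->
  (\int[m]_(t in D) (rnorm (f t - simple_eval (s n) t))%:E)%E @[n --> \oo] --> 0%E ->
  phi (simple_int m D (s n)) @[n --> \oo] --> \int[m]_(t in D) phi (f t).
Proof.
move=> C0 phil phib nf phif si /fine_cvgP[sfin s0].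
apply/cvgrPdist_le => e e0.
have {}s0 : C * fine (\int[m]_(t in D) (rnorm (f t - simple_eval (s n) t))%:E)%E
    @[n --> \oo] --> (0 : R).
  by rewrite -(mulr0 C); apply: cvgM => //; exact: cvg_cst.
move/cvgrPdist_le : s0 => /(_ _ e0); move: sfin; apply: filterS2 => n nfin.
rewrite sub0r normrN => /(le_trans (ler_norm _)); apply: le_trans.
rewrite -lee_fin EFinM fineK //; exact: simple_int_approx.
Qed.

(** It holds for every vector that some approximating sequence produces, so the arbitrary choice
    made by [bochner] is harmless once functionals separate points. *)
Lemma is_bochner_rlinear (phi : X -> R) C f y : 0 <= C -> rlinear phi -> rbounded C phi ->
  norm_measurable f -> m.-integrable D (EFin \o (phi \o f)) ->
  is_bochner m D f y -> phi y = \int[m]_(t in D) phi (f t).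
Proof.
move=> C0 phil phib nf phif [s [si _ s0 sy]].
have H1 : phi (simple_int m D (s n)) @[n --> \oo] --> phi y.
  exact: (rbounded_cvg phil phib).
have H2 := simple_int_cvg C0 phil phib nf phif si s0.
by rewrite -(cvg_lim (@Rhausdorff R) H1) (cvg_lim (@Rhausdorff R) H2).
Qed.

Lemma is_bochner_eq (f g : T -> X) y : {in D, f =1 g} -> is_bochner m D f y -> is_bochner m D g y.
Proof.
move=> fg [s [si sae s0 sy]]; exists s; split => //.
  by move: sae; apply: filterS => t + Dt; rewrite -fg ?inE //; exact.
rewrite (_ : (fun n => _) = (fun n => \int[m]_(t in D) (rnorm (f t - simple_eval (s n) t))%:E)%E) //.
by apply/funext => n; apply: eq_integral => t Dt; rewrite fg.
Qed.
End weak_integral.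

(** * Bochner integrals of bounded continuous functions *)

Section bochner_existence.
Context (R : realType) (X : completeNormedModType R[i]).
Context (m : {measure set (measurableTypeR R) -> \bar R}).
Context (D : set (measurableTypeR R)) (mD : measurable D) (Doo : (m D < +oo)%E).
Context (f : R -> X) (K : R).
Hypothesis D0 : D `<=` [set t | 0 <= t].
Hypothesis fc : continuous f.
Hypothesis fK : forall t, 0 <= t -> rnorm (f t) <= K.

Let node (n k : nat) : R := k%:R / n.+1%:R.

(** The cells have length 1 / (n + 1) and cover [0, n + 1[, hence (n + 1)^2 of them: the mesh
    shrinks while the cells exhaust the half-line. *)
Definition steps (n : nat) : seq (set (measurableTypeR R) * X) :=
  [seq (`[node n k, node n k.+1[%classic, f (node n k)) | k <- iota 0 (n.+1 * n.+1)].

Lemma steps_integrable n : simple_integrable m D (steps n).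
Proof.
move=> B x /mapP[k _ [-> _]]; split; first exact: measurable_itv.
apply: le_lt_trans Doo; apply: le_measure; rewrite ?inE //.
exact: measurableI.
Qed.

Lemma steps_evalE n k t : (k < n.+1 * n.+1)%N -> node n k <= t -> t < node n k.+1 ->
  simple_eval (steps n) t = f (node n k).
Proof.
move=> + kt tk; rewrite /simple_eval big_map; move: (n.+1 * n.+1)%N => N kn.
rewrite (bigD1_seq k) ?iota_uniq ?mem_iota ?add0n //=.
rewrite indicE mem_set /= ?in_itv /= ?kt ?tk // scale1r big1 ?addr0 // => j jk.
rewrite indicE memNset ?scale0r //= in_itv /= => /andP[jt tj].
have n0 : (0 : R) < n.+1%:R by rewrite ltr0n.
have := le_lt_trans kt tj; have := le_lt_trans jt tk.
rewrite /node !ltr_pM2r ?invr_gt0 // !ltr_nat !ltnS => jk' kj.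
by move: jk; rewrite eqn_leq jk' kj.
Qed.

Lemma steps_eval0 n t : n.+1%:R <= t -> simple_eval (steps n) t = 0.
Proof.
move=> nt; rewrite /simple_eval big_map big_seq big1 // => k.
rewrite mem_iota add0n => /andP[_ kn].
rewrite indicE /= memNset ?scale0r //= in_itv /= => /andP[_ tk].
have := le_lt_trans nt tk; rewrite /node ltr_pdivlMr ?ltr0n // -natrM ltr_nat.
by rewrite ltnS leqNgt kn.
Qed.

Lemma node_exists n t : 0 <= t -> t < n.+1%:R ->
  exists2 k, (k < n.+1 * n.+1)%N & node n k <= t < node n k.+1.
Proof.
move=> t0 tn; have n0 : (0 : R) < n.+1%:R by rewrite ltr0n.
have tn0 : 0 <= t * n.+1%:R by rewrite mulr_ge0 // ltW.
have /andP[h1 h2] := Num.Theory.truncn_itv tn0.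
exists (Num.truncn (t * n.+1%:R)).
  rewrite -(ltr_nat R) (le_lt_trans h1) // natrM ltr_pM2r //.
by rewrite /node ler_pdivrMr // h1 ltr_pdivlMr // h2.
Qed.

Lemma steps_le n t : 0 <= t -> rnorm (simple_eval (steps n) t) <= K.
Proof.
move=> t0; have K0 : 0 <= K by apply: le_trans (fK t0); exact: rnorm_ge0.
have [nt|tn] := leP n.+1%:R t; first by rewrite steps_eval0 ?rnorm0.
have [k kn /andP[kt tk]] := node_exists t0 tn.
by rewrite (steps_evalE kn) // fK // divr_ge0.
Qed.

Lemma steps_cvg t : 0 <= t -> simple_eval (steps n) t @[n --> \oo] --> f t.
Proof.
move=> t0; apply/cvg_rnormP/cvgrPdist_lt => e e0.
have /cvg_rnormP /cvgrPdist_lt /(_ _ e0) := @fc t.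
move=> [d /= d0 fd]; near=> n.
have [|k kn /andP[kt tk]] := @node_exists n t t0.
  near: n; exists (Num.truncn t) => // n /= tn.
  by rewrite (lt_le_trans (Num.Theory.truncnS_gt t)) // ler_nat ltnS.
rewrite (steps_evalE kn) //; apply: fd => /=.
rewrite ger0_norm ?subr_ge0 // ltrBlDr (lt_le_trans tk) //.
rewrite /node -natr1 mulrDl addrC lerD2r mul1r ltW //.
near: n; exact: (near_infty_natSinv_lt (PosNum d0)).
Unshelve. all: by end_near. Qed.



Lemma continuous_norm_measurable : norm_measurable D f.
Proof.
move=> v; apply: measurable_funTS; apply: continuous_measurable_fun => t.
by apply: cvg_rnorm; apply: cvgB; [exact: fc|exact: cvg_cst].
Qed.

Lemma cst_integrable (k : R) : m.-integrable D (EFin \o cst k).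
Proof. exact: (bounded_rintegrable mD (K := `|k|)). Qed.

Lemma steps_diff_le n t : 0 <= t -> rnorm (f t - simple_eval (steps n) t) <= K + K.
Proof.
by move=> t0; rewrite (le_trans (rnormD _ _)) // rnormN lerD ?fK ?steps_le.
Qed.

Lemma steps_diff_measurable n :
  measurable_fun D (fun t => rnorm (f t - simple_eval (steps n) t)).
Proof.
apply: norm_measurable_simple => //; first exact: continuous_norm_measurable.
exact: steps_integrable.
Qed.

Lemma steps_L1_fin n :
  (\int[m]_(t in D) (rnorm (f t - simple_eval (steps n) t))%:E)%E \is a fin_num.
Proof.
rewrite ge0_fin_numE; last first.
  by apply: integral_ge0 => t _; rewrite lee_fin rnorm_ge0.
apply: (@le_lt_trans _ _ (\int[m]_(t in D) (K + K)%:E)%E).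
  apply: ge0_le_integral => //.
  - by move=> t _; rewrite lee_fin rnorm_ge0.
  - by apply/measurable_EFinP; exact: steps_diff_measurable.
  - by move=> t /D0 t0; rewrite lee_fin steps_diff_le.
have /integrableP[_] := cst_integrable (K + K).
by apply: le_lt_trans; apply: (le_trans (lee_abs _)); exact: le_abse_integral.
Qed.

(** Dominated convergence with the constant K + K, which is integrable because [D] has finite
    measure. *)
Lemma steps_L1 :
  (\int[m]_(t in D) (rnorm (f t - simple_eval (steps n) t))%:E)%E @[n --> \oo] --> 0%E.
Proof.
have -> : (0%E : \bar R) = (\int[m]_(t in D) (cst 0%E t))%E by rewrite integral0.
apply: (@dominated_cvg _ _ _ m D mD _ _ (cst (K + K)%:E)) => //.
- by move=> n; apply/measurable_EFinP; exact: steps_diff_measurable.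
- move=> t /D0 t0; apply: cvg_EFin; first exact: nearW.
  by have /cvg_rnormP := steps_cvg t0.
- exact: cst_integrable.
- move=> n t /D0 t0 /=; rewrite lee_fin ger0_norm ?rnorm_ge0 //.
  exact: steps_diff_le.
Qed.

Lemma rlinear_integrable (phi : X -> R) C : 0 <= C -> rlinear phi -> rbounded C phi ->
  m.-integrable D (EFin \o (phi \o f)).
Proof.
move=> C0 phil phib.
have mf : m.-integrable D (EFin \o (fun t => C * rnorm (f t))).
  apply: rintegrableZ => //.
  apply: (le_integrable mD _ _ (_ : m.-integrable D (EFin \o cst K))).
  - apply/measurable_EFinP; have := continuous_norm_measurable 0.
    by apply: eq_measurable_fun => t _; rewrite subr0.
  - move=> t /D0 t0 /=; rewrite lee_fin !ger0_norm ?fK ?rnorm_ge0 //.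
    by apply: le_trans (fK t0); exact: rnorm_ge0.
  - exact: cst_integrable.
apply: (le_integrable mD _ _ mf).
  apply/measurable_EFinP; apply: measurable_funTS.
  apply: continuous_measurable_fun => t.
  exact: (rbounded_cvg phil phib (@fc t)).
by move=> t _ /=; rewrite lee_fin (le_trans (phib _)) // ler_norm.
Qed.

(** The integrals of the step functions are Cauchy: a norming functional of a difference of two of
    them compares both with the scalar integral of phi o f, so no inequality for vector-valued
    integrals is needed. *)
Lemma is_bochner_exists : exists y, is_bochner m D f y.
Proof.
have /fine_cvgP[_ J0] := steps_L1.
have /cvg_ex[y sy] : cvgn (fun n => simple_int m D (steps n)).
  apply: (rnorm_cauchy_cvg _ J0) => i j; set u := fun n => simple_int m D (steps n).
  have [phi [phil phib <-]] := norming_functional (u j - u i).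
  have phif := rlinear_integrable ler01 phil phib.
  have J n : `|\int[m]_(t in D) phi (f t) - phi (u n)| <=
      fine (\int[m]_(t in D) (rnorm (f t - simple_eval (steps n) t))%:E)%E.
    rewrite -lee_fin fineK ?steps_L1_fin // -[leRHS]mul1e.
    apply: simple_int_approx => //; first exact: continuous_norm_measurable.
    exact: steps_integrable.
  rewrite rlinearB //; have := J j; have := J i; rewrite !ler_norml /=.
  by move=> /andP[? ?] /andP[? ?]; lra.
exists y, steps; split => //; last exact: steps_L1.
- exact: steps_integrable.
- by apply: aeW => t /D0 t0; exact: steps_cvg.
Qed.

End bochner_existence.

Section bochner_value.
Context (R : realType) (X : completeNormedModType R[i]).
Context (m : {measure set (measurableTypeR R) -> \bar R}).
Context (D : set (measurableTypeR R)) (mD : measurable D) (Doo : (m D < +oo)%E).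
Context (f g : R -> X) (K : R).
Hypothesis D0 : D `<=` [set t | 0 <= t].
Hypothesis gc : continuous g.
Hypothesis gK : forall t, 0 <= t -> rnorm (g t) <= K.
Hypothesis fg : {in D, f =1 g}.

(** Only agreement of [f] with a continuous [g] on [D] is asked, since an orbit is unconstrained at
    negative times; there [g] will be its even extension. *)
Lemma bochner_rlinear (phi : X -> R) C : 0 <= C -> rlinear phi -> rbounded C phi ->
  phi (bochner m D f) = \int[m]_(t in D) phi (g t).
Proof.
move=> C0 phil phib.
have [y gy] := is_bochner_exists mD Doo D0 gc gK.
have gf : {in D, g =1 f} by move=> t Dt; rewrite fg.
have fy : is_bochner m D f (bochner m D f).
  by apply: (xgetPex 0); exists y; exact: is_bochner_eq gf gy.
apply: (is_bochner_rlinear mD C0 phil phib _ _ (is_bochner_eq fg fy)).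
- exact: continuous_norm_measurable.
- exact: (rlinear_integrable mD Doo D0 gc gK C0).
Qed.

End bochner_value.

(** * Bounded measurable functions and finite measures *)

Section bounded_measurable.
Context (R : realType).

(** These functions are integrable against every finite measure and stable under slices and partial
    integrals, so Fubini applies to them without side conditions. *)
Definition bounded_measurable d (T : measurableType d) (f : T -> R) : Prop :=
  measurable_fun setT f /\ exists K, forall t, `|f t| <= K.

Section closure.
Context d (T : measurableType d).
Implicit Types f g : T -> R.

Lemma bounded_measurable_cst k : bounded_measurable (fun _ : T => k).
Proof. by split; [exact: measurable_cst|exists `|k|]. Qed.

Lemma bounded_measurableD f g : bounded_measurable f -> bounded_measurable g ->
  bounded_measurable (fun t => f t + g t).
Proof.
move=> [mf [K fK]] [mg [L gL]]; split; first exact: measurable_funD.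
by exists (K + L) => t; rewrite (le_trans (ler_normD _ _)) // lerD.
Qed.

Lemma bounded_measurableM f g : bounded_measurable f -> bounded_measurable g ->
  bounded_measurable (fun t => f t * g t).
Proof.
move=> [mf [K fK]] [mg [L gL]]; split; first exact: measurable_funM.
by exists (K * L) => t; rewrite normrM ler_pM.
Qed.

Lemma bounded_measurableZ k f : bounded_measurable f -> bounded_measurable (fun t => k * f t).
Proof. by apply: bounded_measurableM; exact: bounded_measurable_cst. Qed.

Lemma bounded_measurableB f g : bounded_measurable f -> bounded_measurable g ->
  bounded_measurable (fun t => f t - g t).
Proof.
move=> bf bg; have := bounded_measurableD bf (bounded_measurableZ (-1) bg).
by congr bounded_measurable; apply/funext => t; rewrite mulN1r.
Qed.

Lemma bounded_measurable_comp d' (T' : measurableType d') (p : T' -> T) f :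
  measurable_fun setT p -> bounded_measurable f -> bounded_measurable (fun t => f (p t)).
Proof.
by move=> mp [mf [K fK]]; split; [exact: measurableT_comp|exists K].
Qed.

Lemma bounded_measurable_integrable (m : {finite_measure set T -> \bar R}) f D :
  measurable D -> bounded_measurable f -> m.-integrable D (EFin \o f).
Proof.
move=> mD [mf [K fK]]; apply: (bounded_rintegrable mD (K := K)) => //.
  by rewrite ltey_eq fin_num_measure.
exact: measurable_funTS.
Qed.

Lemma bounded_measurable_patch D f : measurable D -> bounded_measurable f ->
  bounded_measurable (f \_ D).
Proof.
move=> mD [mf [K fK]]; split; first exact: ((measurable_restrictT f mD).1 (measurable_funTS mf)).
exists (Num.max K 0) => t; rewrite patchE; case: ifP => _; rewrite le_max ?fK //.
by rewrite normr0 lexx orbT.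
Qed.

End closure.

Section fubini.
Context d1 d2 (T1 : measurableType d1) (T2 : measurableType d2).
Context (m1 : {finite_measure set T1 -> \bar R}) (m2 : {finite_measure set T2 -> \bar R}).
Context (f : T1 * T2 -> R) (bf : bounded_measurable f).

Lemma bounded_measurable_slice1 x : bounded_measurable (fun y => f (x, y)).
Proof. exact: (bounded_measurable_comp (pair1_measurable x) bf). Qed.

Lemma bounded_measurable_slice2 y : bounded_measurable (fun x => f (x, y)).
Proof. exact: (bounded_measurable_comp (pair2_measurable y) bf). Qed.

Lemma bounded_measurable_integrable2 : (m1 \x m2)%E.-integrable setT (EFin \o f).
Proof.
case: (bf) => mf [K fK]; apply: (bounded_rintegrable measurableT (K := K)) => //.
have := product_measure1E m1 m2 measurableT measurableT; rewrite setXTT => E.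
apply: (@le_lt_trans _ _ (m1 setT * m2 setT)%E); first by rewrite -E.
by rewrite ltey_eq fin_numM // fin_num_measure.
Qed.

Lemma Rintegral_slice1 x :
  (\int[m2]_y f (x, y))%:E = (\int[m2]_y (f (x, y))%:E)%E.
Proof.
rewrite /Rintegral fineK //; apply: integrable_fin_num => //.
apply: bounded_measurable_integrable => //; exact: bounded_measurable_slice1.
Qed.

Lemma Rintegral_slice2 y :
  (\int[m1]_x f (x, y))%:E = (\int[m1]_x (f (x, y))%:E)%E.
Proof.
rewrite /Rintegral fineK //; apply: integrable_fin_num => //.
apply: bounded_measurable_integrable => //; exact: bounded_measurable_slice2.
Qed.

Lemma bounded_measurable_int2 : bounded_measurable (fun x => \int[m2]_y f (x, y)).
Proof.
split.
  apply/measurable_EFinP.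
  rewrite (_ : EFin \o _ = fubini_F m2 (EFin \o f)); last first.
    by apply/funext => x /=; rewrite Rintegral_slice1.
  by apply: (measurable_fubini_F (m1 := m1)); exact: bounded_measurable_integrable2.
case: (bf) => mf [K fK]; exists (K * fine (m2 setT)) => x.
have bx := bounded_measurable_slice1 x.
have ix := bounded_measurable_integrable m2 measurableT bx.
apply: (le_trans (le_normr_Rintegral _ ix)) => //.
rewrite -Rintegral_cst //; apply: le_Rintegral => //.
  exact: integrable_norm.
by apply: bounded_measurable_integrable => //; exact: bounded_measurable_cst.
Qed.

Lemma RFubini1 : \int[(m1 \x m2)%E]_z f z = \int[m1]_x \int[m2]_y f (x, y).
Proof.
rewrite {1}/Rintegral -integral12_prod_meas1 //; last exact: bounded_measurable_integrable2.
by congr fine; apply: eq_integral => x _; rewrite Rintegral_slice1.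
Qed.

Lemma RFubini : \int[m1]_x \int[m2]_y f (x, y) = \int[m2]_y \int[m1]_x f (x, y).
Proof.
rewrite {1}/Rintegral.
under eq_integral do rewrite Rintegral_slice1.
rewrite (Fubini (f := EFin \o f)); last exact: bounded_measurable_integrable2.
by congr fine; apply: eq_integral => x _; rewrite Rintegral_slice2.
Qed.

End fubini.

End bounded_measurable.

(** * Construction of finite measures *)

Section existence.
Context (R : realType).

Lemma exists_finite_measure d (T : measurableType d) (m : {measure set T -> \bar R}) :
  (m setT < +oo)%E ->
  exists nu : {finite_measure set T -> \bar R}, forall B, nu B = m B.
Proof.
move=> moo; pose n (B : set T) := m B.
pose A := isMeasure.Build _ _ _ n (measure0 m) (measure_ge0 m)
  (@measure_semi_sigma_additive _ _ _ m).
pose N : {measure set T -> \bar R} := HB.pack n A.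
pose B := Measure_isFinite.Build _ _ _ N (lty_fin_num_fun moo).
pose N2 : {finite_measure set T -> \bar R} := HB.pack n A B.
by exists N2.
Qed.

Section density.
Context d (T : measurableType d) (m : {measure set T -> \bar R}).
Context (k : T -> R) (mk : measurable_fun setT k) (k0 : forall t, 0 <= k t).

Definition mdensity (B : set T) : \bar R := (\int[m]_(t in B) (k t)%:E)%E.

Let mdensity0 : mdensity set0 = 0%E.
Proof. by rewrite /mdensity integral_set0. Qed.

Let mdensity_ge0 B : (0 <= mdensity B)%E.
Proof. by apply: integral_ge0 => t _; rewrite lee_fin. Qed.

Let mdensity_sigma_additive : semi_sigma_additive mdensity.
Proof.
move=> /= F mF tF mUF; rewrite /mdensity; apply: cvg_toP.
  apply: ereal_nondecreasing_is_cvgn => i j ij.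
  apply: lee_sum_nneg_natr => // n _ _; apply: integral_ge0 => /= x Fkx.
  by rewrite lee_fin.
rewrite ge0_integral_bigcup//=.
- by apply/measurable_EFinP; apply: measurable_funTS.
- by move=> x _; rewrite lee_fin.
Qed.

Import HBNNSimple.

(** On indicators the integral formula is the definition of [mdensity]; it extends to simple
    functions by linearity and to nonnegative functions by monotone convergence. *)
Lemma exists_density : exists nu : {measure set T -> \bar R},
  (forall B, nu B = \int[m]_(t in B) (k t)%:E)%E /\
  (forall f : T -> \bar R, measurable_fun setT f -> (forall t, 0 <= f t)%E ->
    \int[nu]_t f t = \int[m]_t (f t * (k t)%:E))%E.
Proof.
pose A := isMeasure.Build _ _ _ mdensity mdensity0 mdensity_ge0 mdensity_sigma_additive.
pose nu : {measure set T -> \bar R} := HB.pack mdensity A.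
have mEk : measurable_fun setT (EFin \o k) by exact/measurable_EFinP.
exists nu; split => // f mf f0.
pose g := nnsfun_approx measurableT mf.
have g_nd x : {homo (fun i => g i x) : i j / (i <= j)%N >-> i <= j}.
  by move=> i j ij; exact/lefP/nd_nnsfun_approx.
have g_cvg x : (g i x)%:E @[i --> \oo] --> f x by exact: cvg_nnsfun_approx.
transitivity (limn (fun n => \int[nu]_x (g n x)%:E)%E).
  rewrite -monotone_convergence //.
  - by apply: eq_integral => x _; apply/esym/cvg_lim.
  - by move=> n; exact/measurable_EFinP.
  - by move=> n x _; rewrite lee_fin.
  - by move=> x _ i j ij; rewrite lee_fin g_nd.
transitivity (limn (fun n => \int[m]_x ((g n x)%:E * (k x)%:E))%E); last first.
  rewrite -monotone_convergence //.
  - apply: eq_integral => x _; apply/cvg_lim => //.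
    by apply: cvgeZr.
  - by move=> n; apply: emeasurable_funM => //; exact/measurable_EFinP.
  - by move=> n x _; rewrite mule_ge0 ?lee_fin.
  - by move=> x _ i j ij; rewrite lee_wpmul2r ?lee_fin // g_nd.
congr (limn _); apply/funext => n.
have mg r : measurable (g n @^-1` [set r]) by [].
transitivity (\sum_(r \in range (g n)) r%:E * nu (g n @^-1` [set r]))%E.
  under eq_integral do rewrite fimfunE -fsumEFin//.
  rewrite ge0_integral_fsum//; last 2 first.
  - by move=> y; exact/measurable_EFinP/measurable_funM.
  - by move=> y x _; rewrite nnfun_muleindic_ge0.
  apply: eq_fsbigr => r _; rewrite integralZl_indic_nnsfun// integral_indic//=.
  by rewrite setIT.
apply/esym; transitivity (\int[m]_x (\sum_(r \in range (g n))
    ((r * \1_(g n @^-1` [set r]) x)%:E * (k x)%:E)))%E.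
  apply: eq_integral => x _; rewrite -ge0_mule_fsuml; last first.
    by move=> r; rewrite nnfun_muleindic_ge0.
  by rewrite fsumEFin // -fimfunE.
rewrite ge0_integral_fsum//; last 2 first.
- move=> r; apply: emeasurable_funM => //.
  exact/measurable_EFinP/measurable_funM.
- by move=> r x _; rewrite mule_ge0 ?lee_fin // -lee_fin nnfun_muleindic_ge0.
apply: eq_fsbigr => r /set_mem[x _ rx].
have r0 : 0 <= r by rewrite -rx.
rewrite /nu /= /mdensity -ge0_integralZl_EFin //; last 2 first.
- by move=> y _; rewrite lee_fin.
- exact: measurable_funTS.
rewrite [RHS]integral_mkcond; apply: eq_integral => y _.
by rewrite epatch_indic -!EFinM mulrAC.
Qed.

End density.

(** The image of the product measure under [p]. Through it an iterated average of an orbit becomes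
    one integral against one finite measure, as the functional calculus requires. *)
Lemma exists_finite_image d1 d2 d3 (T1 : measurableType d1) (T2 : measurableType d2)
    (T3 : measurableType d3) (m1 : {finite_measure set T1 -> \bar R})
    (m2 : {finite_measure set T2 -> \bar R}) (p : T1 * T2 -> T3) :
  measurable_fun setT p ->
  exists nu : {finite_measure set T3 -> \bar R}, forall f, bounded_measurable f ->
    \int[nu]_z f z = \int[m1]_x \int[m2]_y f (p (x, y)).
Proof.
move=> mp.
pose M' : {measure set T3 -> \bar R} := pushforward (m1 \x m2)%E p.
pose M := M' mp.
have [|nu nuM] := @exists_finite_measure _ _ M.
  have := product_measure1E m1 m2 measurableT measurableT; rewrite setXTT => E.
  apply: (@le_lt_trans _ _ (m1 setT * m2 setT)%E); first by rewrite -E.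
  by rewrite ltey_eq fin_numM // fin_num_measure.
exists nu => f bf.
have bfp := bounded_measurable_comp mp bf.
transitivity (\int[M]_z f z).
  by congr fine; apply: eq_measure_integral => B _ _; exact: nuM.
rewrite -(RFubini1 m1 m2 bfp) /Rintegral; congr fine.
apply: integral_pushforward => //.
  by apply/measurable_EFinP; case: bf.
exact: bounded_measurable_integrable2.
Qed.
End existence.

(** * The exponential law and the resolvent identity *)

Section lebesgue_identities.
Context (R : realType).
Notation lambda := (@lebesgue_measure R).

(** Both sides are the integral of a(t) b(r) over the region 0 <= t <= r. *)
Lemma tonelli_triangle (a b : R -> R) :
  measurable_fun setT a -> measurable_fun setT b ->
  (forall t, 0 <= a t) -> (forall t, 0 <= b t) ->
  (\int[lambda]_(t in `[0%R, +oo[) ((a t)%:E * \int[lambda]_(r in `[t, +oo[) (b r)%:E) =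
   \int[lambda]_(r in `[0%R, +oo[) ((b r)%:E * \int[lambda]_(t in `[0%R, r]) (a t)%:E))%E.
Proof.
move=> ma mb a0 b0.
have mEa : measurable_fun setT (EFin \o a) by exact/measurable_EFinP.
have mEb : measurable_fun setT (EFin \o b) by exact/measurable_EFinP.
pose f (p : R * R) : R := if (0 <= p.1) && (p.1 <= p.2) then a p.1 * b p.2 else 0.
have f0 p : (0 <= (f p)%:E)%E.
  by rewrite lee_fin /f; case: ifP => // _; exact: mulr_ge0.
have mf : measurable_fun setT (EFin \o f).
  apply/measurable_EFinP; apply: measurable_fun_ifT => //.
    apply: measurable_and; exact: measurable_fun_ler.
  by apply: measurable_funM; apply: measurableT_comp.
rewrite [LHS]integral_mkcond [RHS]integral_mkcond.
transitivity (\int[lambda]_x \int[lambda]_y (EFin \o f) (x, y))%E.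
  apply: eq_integral => t _; rewrite patchE.
  have [t0|t0] := leP 0 t; last first.
    rewrite memNset /= ?in_itv /= ?andbT; last by apply/negP; rewrite -ltNge.
    by rewrite integral0_eq // => r _; rewrite /= /f /= leNgt t0.
  rewrite mem_set /= ?in_itv /= ?andbT //.
  rewrite -ge0_integralZl_EFin //; last 2 first.
  - by move=> r _; rewrite lee_fin.
  - exact: measurable_funTS.
  rewrite integral_mkcond; apply: eq_integral => r _.
  rewrite patchE /f /= t0 /=; have [tr|tr] := leP t r.
    by rewrite mem_set /= ?in_itv /= ?andbT.
  by rewrite memNset /= ?in_itv /= ?andbT //; apply/negP; rewrite -ltNge.
rewrite (@fubini_tonelli _ _ _ _ _ lambda lambda (EFin \o f) mf f0).
apply/esym; apply: eq_integral => r _; rewrite patchE.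
have [r0|r0] := leP 0 r; last first.
  rewrite memNset /= ?in_itv /= ?andbT; last by apply/negP; rewrite -ltNge.
  rewrite integral0_eq // => t _; rewrite /= /f /=; case: ifP => // /andP[t0 tr].
  by move: r0; rewrite ltNge (le_trans t0 tr).
rewrite mem_set /= ?in_itv /= ?andbT //.
rewrite -ge0_integralZl_EFin //; last 2 first.
- by move=> t _; rewrite lee_fin.
- exact: measurable_funTS.
rewrite integral_mkcond; apply: eq_integral => t _.
rewrite patchE /f /=; have [h|h] := boolP ((0 <= t) && (t <= r)).
  by rewrite mem_set /= ?in_itv //= EFinM muleC.
by rewrite memNset /= ?in_itv //=; exact/negP.
Qed.

(** The image of Lebesgue measure under the translation agrees with it on half-open intervals, hence
    everywhere. *)
Lemma ge0_integral_shift (h : R -> R) t : measurable_fun setT h -> (forall u, 0 <= h u) ->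
  (\int[lambda]_(u in `[0%R, +oo[) (h (t + u)%R)%:E = \int[lambda]_(u in `[t, +oo[) (h u)%:E)%E.
Proof.
move=> mh h0; pose p := (fun u => t + u) : measurableTypeR R -> measurableTypeR R.
have mp : measurable_fun [set: measurableTypeR R] p by exact: measurable_funD.
have -> : `[0%R, +oo[%classic = p @^-1` `[t, +oo[%classic.
  by apply/seteqP; split => u /=; rewrite !in_itv /= !andbT lerDl.
rewrite -(@ge0_integral_pushforward _ _ _ _ _ _ mp lambda _ (EFin \o h)) //=; last 2 first.
- by apply/measurable_EFinP; exact: measurable_funTS.
- by move=> u _; rewrite lee_fin.
apply: eq_measure_integral => A mA _; apply/esym.
pose M' := pushforward lambda p : {measure set (measurableTypeR R) -> \bar R}.
pose M := M' mp.
apply: (@lebesgue_measure_unique _ M) => // _ [[a b]] _ <-.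
rewrite /M /M' /= /pushforward (_ : p @^-1` _ = `]a - t, b - t]%classic); last first.
  by apply/seteqP; split => u /=; rewrite !in_itv /= ltrBlDl lerBrDl.
by rewrite /= !lebesgue_measure_itv /= !lte_fin ltrD2r -!EFinB opprB addrA subrK.
Qed.

(** As for translations: 1 / s times the image of Lebesgue measure under u / s gives half-open
    intervals their length. *)
Lemma ge0_integral_scale (h : R -> R) s : 0 < s -> measurable_fun setT h -> (forall u, 0 <= h u) ->
  (\int[lambda]_(u in `[0%R, +oo[) (h (u / s)%R)%:E =
   s%:E * \int[lambda]_(u in `[0%R, +oo[) (h u)%:E)%E.
Proof.
move=> s0 mh h0; pose p := (fun u => u / s) : measurableTypeR R -> measurableTypeR R.
have mp : measurable_fun [set: measurableTypeR R] p by exact: measurable_funM.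
have -> : (\int[lambda]_(u in `[0%R, +oo[) (h (u / s)%R)%:E =
    \int[lambda]_(u in p @^-1` `[0%R, +oo[) ((EFin \o h) \o p) u)%E.
  congr integral; apply/seteqP; split => u /=; rewrite !in_itv /= !andbT.
    by move=> u0; rewrite divr_ge0 // ltW.
  by rewrite pmulr_lge0 // invr_gt0.
rewrite -(@ge0_integral_pushforward _ _ _ _ _ _ mp lambda _ (EFin \o h)) //=; last 2 first.
- by apply/measurable_EFinP; exact: measurable_funTS.
- by move=> u _; rewrite lee_fin.
pose M' := pushforward lambda p : {measure set (measurableTypeR R) -> \bar R}.
pose M := M' mp.
have si0 : 0 <= s^-1 by rewrite invr_ge0 ltW.
have E A : measurable A -> lambda A = mscale (NngNum si0) M A.
  apply: lebesgue_measure_unique => // _ [[a b]] _ <-.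
  transitivity ((s^-1)%:E * lambda `](a * s)%R, (b * s)%R]%classic)%E; last first.
    congr (_ * lambda _)%E; apply/seteqP; split => u /=.
      by rewrite !in_itv /= ltr_pdivlMr // ler_pdivrMr.
    by rewrite !in_itv /= ltr_pdivlMr // ler_pdivrMr.
  rewrite /= !lebesgue_measure_itv /= !lte_fin ltr_pM2r //; case: ifP => _; last by rewrite mule0.
  by rewrite -!EFinB -EFinM -mulrBl mulrC mulfK // gt_eqF.
transitivity (s%:E * \int[mscale (NngNum si0) M]_(u in `[0%R, +oo[) (h u)%:E)%E.
  rewrite ge0_integral_mscale //=; last 2 first.
  - by apply/measurable_EFinP; exact: measurable_funTS.
  - by move=> u _; rewrite lee_fin.
  by rewrite muleA -EFinM mulfV ?gt_eqF // mul1e.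
by congr (_ * _)%E; apply: eq_measure_integral => A mA _; exact/esym/E.
Qed.

End lebesgue_identities.

(** * The exponential law and its convolutions *)

Section exponential.
Context (R : realType).
Notation lambda := (@lebesgue_measure R).

(** The law lives on the whole line but is carried by the half-line; integrands are written with |v|
    so that their arguments are nonnegative everywhere. *)
Definition exponential_law (E : {finite_measure set (measurableTypeR R) -> \bar R}) : Prop :=
  E setT = 1%E /\
  forall G : R -> \bar R, measurable_fun setT G -> (forall t, 0 <= G t)%E ->
  (\int[E]_v G v = \int[lambda]_(v in `[0%R, +oo[) ((expR (- v))%:E * G v))%E.

Lemma exists_exponential :
  exists E : {finite_measure set (measurableTypeR R) -> \bar R}, exponential_law E.
Proof.
have k0 (t : R) : 0 <= exponential_pdf 1 t by exact: exponential_pdf_ge0.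
have mk : measurable_fun [set: measurableTypeR R] (exponential_pdf (1 : R)).
  exact: measurable_exponential_pdf.
have [M [MB Mf]] := exists_density lambda mk k0.
have M1 : M setT = 1%E by rewrite MB integral_exponential_pdf.
have [|E EM] := exists_finite_measure (m := M); first by rewrite M1 ltry.
exists E; split=> [|G mG G0]; first by rewrite EM.
transitivity (\int[M]_v G v)%E; first by apply: eq_measure_integral => B _ _; exact: EM.
rewrite Mf // [RHS]integral_mkcond; apply: eq_integral => v _.
rewrite /exponential_pdf !patchE; case: ifP => _; last by rewrite mule0.
by rewrite mul1r mulN1r muleC.
Qed.

Context (E : {finite_measure set (measurableTypeR R) -> \bar R}) (HE : exponential_law E).

Lemma continuous_expRM (c : R) : continuous (fun t => expR (c * t)).
Proof.
move=> t; apply: continuous_comp; last exact: continuous_expR.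
by apply: cvgM; [exact: cvg_cst|exact: cvg_id].
Qed.

Lemma measurable_expRM (c : R) : measurable_fun setT (fun t => expR (c * t)).
Proof. by apply: continuous_measurable_fun; exact: continuous_expRM. Qed.

(** For v of law [E], the variable v / s is exponential of rate s. *)
Lemma exponential_scale (G : R -> R) s : 0 < s -> measurable_fun setT G -> (forall t, 0 <= G t) ->
  (\int[E]_v (G (`|v| / s)%R)%:E =
   \int[lambda]_(u in `[0%R, +oo[) (s * expR (- s * u) * G u)%R%:E)%E.
Proof.
move=> s0 mG G0; rewrite HE.2; last 2 first.
- by apply/measurable_EFinP; apply: measurableT_comp => //; apply: measurable_funM.
- by move=> v; rewrite lee_fin.
pose h u := expR (- s * u) * G u.
have h0 u : 0 <= h u by rewrite mulr_ge0 // expR_ge0.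
have mh : measurable_fun setT h by apply: measurable_funM => //; exact: measurable_expRM.
transitivity (\int[lambda]_(u in `[0%R, +oo[) (h (u / s)%R)%:E)%E.
  apply: eq_integral => v /set_mem /=; rewrite in_itv /= andbT => v0.
  by rewrite /h ger0_norm // mulNr mulrCA mulfV ?mulr1 // gt_eqF.
rewrite ge0_integral_scale // -ge0_integralZl_EFin //; last 3 first.
- by move=> u _; rewrite lee_fin.
- by apply/measurable_EFinP; exact: measurable_funTS.
- exact: ltW.
by apply: eq_integral => u _; rewrite -EFinM mulrA.
Qed.

(** The sum of independent exponential variables of rates 1 and s has density s e^(- s r) \int_0^r
    e^((s - 1) t) dt: translate the inner integral by t, then exchange the order of integration on
    the triangle. *)
Lemma exponential_convolution (G : R -> R) s : 0 < s -> measurable_fun setT G ->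
  (forall t, 0 <= G t) ->
  (\int[E]_t \int[E]_v (G (`|t| + `|v| / s)%R)%:E =
   \int[lambda]_(r in `[0%R, +oo[) ((s * expR (- s * r) * G r)%R%:E *
     \int[lambda]_(t in `[0%R, r]) (expR ((s - 1) * t)%R)%:E))%E.
Proof.
move=> s0 mG G0.
pose b r := s * expR (- s * r) * G r.
have b0 r : 0 <= b r by rewrite !mulr_ge0 ?expR_ge0 // ltW.
have mb : measurable_fun setT b.
  by apply: measurable_funM => //; apply: measurable_funM => //; exact: measurable_expRM.
rewrite -(tonelli_triangle (measurable_expRM (s - 1)) mb _ b0); last first.
  by move=> t; exact: expR_ge0.
rewrite HE.2; last 2 first.
- pose f (p : measurableTypeR R * measurableTypeR R) := (G (`|p.1| + `|p.2| / s))%:E.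
  have mf : measurable_fun setT f.
    apply/measurable_EFinP; apply: measurableT_comp => //; apply: measurable_funD.
      exact: measurableT_comp.
    by apply: measurable_funM => //; exact: measurableT_comp.
  apply: (@measurable_fun_fubini_tonelli_F _ _ _ _ _ E f mf).
  by move=> p; rewrite lee_fin.
- by move=> t; apply: integral_ge0 => v _; rewrite lee_fin.
apply: eq_integral => t /set_mem /=; rewrite in_itv /= andbT => t0.
rewrite ger0_norm // (exponential_scale (G := fun u => G (t + u))) //; last first.
  by apply: measurableT_comp => //; exact: measurable_funD.
have -> : (\int[lambda]_(u in `[0%R, +oo[) (s * expR (- s * u) * G (t + u))%:E =
    \int[lambda]_(u in `[0%R, +oo[) ((expR (s * t) * b (t + u))%R)%:E)%E.
  apply: eq_integral => u _; rewrite /b; congr EFin.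
  have -> : expR (- s * u) = expR (s * t) * expR (- s * (t + u)).
    by rewrite -expRD; congr expR; ring.
  ring.
rewrite (ge0_integral_shift (h := fun r => expR (s * t) * b r)) //; last 2 first.
- exact: measurable_funM.
- by move=> u; rewrite mulr_ge0 ?expR_ge0.
under eq_integral do rewrite EFinM.
rewrite ge0_integralZl_EFin ?expR_ge0 //; last 2 first.
- by move=> u _; rewrite lee_fin.
- by apply/measurable_EFinP; exact: measurable_funTS.
by rewrite muleA -EFinM -expRD mulrBl mul1r addrC.
Qed.

End exponential.

Section ftc.
Context (R : realType).
Notation lambda := (@lebesgue_measure R).

Lemma integral_is_derive (f F : R -> R) (r : R) : 0 <= r -> continuous f ->
  (forall t : R, is_derive t (1 : R) F (f t)) ->
  (\int[lambda]_(t in `[0%R, r]) (f t)%:E = (F r - F 0)%:E)%E.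
Proof.
move=> r0 cf dF.
have [->|rn0] := eqVneq r 0; first by rewrite set_itv1 integral_set1 subrr.
have rp : 0 < r by rewrite lt_def rn0.
have Fc t : {for t, continuous F}.
  by apply: differentiable_continuous; apply/derivable1_diffP; case: (dF t).
rewrite (continuous_FTC2 (F := F)) //.
- exact: continuous_subspaceT.
- split => [t _||].
  + by case: (dF t).
  + by apply: cvg_at_right_filter; exact: Fc.
  + by apply: cvg_at_left_filter; exact: Fc.
- by move=> t _; rewrite derive1E; have [_ ->] := dF t.
Qed.

Lemma is_derive_expRM (c t : R) : is_derive t (1 : R) (fun u : R => expR (c * u)) (c * expR (c * t)).
Proof.
have := @is_derive1_comp R expR (fun u => c * u) t _ _ (is_derive_expR (c * t))
  (@is_deriveZ _ _ _ id c t 1 1 (is_derive_id t 1)).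
by rewrite /GRing.scale /= mulr1 mulrC.
Qed.

Lemma integral_expRM_tail (s t : R) : 0 < s ->
  (\int[lambda]_(r in `[t, +oo[) (s * expR (- s * r))%:E = (expR (- s * t))%:E)%E.
Proof.
move=> s0.
have dF (r : R) : is_derive r (1 : R) (fun u : R => - expR (- s * u)) (s * expR (- s * r)).
  have := @is_deriveN _ _ _ _ r 1 _ (is_derive_expRM (- s) r).
  by rewrite mulNr opprK.
have Fc (r : R) : {for r, continuous (fun u : R => - expR (- s * u))}.
  by apply: differentiable_continuous; apply/derivable1_diffP; case: (dF r).
rewrite (ge0_continuous_FTC2y (F := fun r => - expR (- s * r)) (l := 0)).
- by rewrite sub0e -EFinN opprK.
- by move=> r _; rewrite mulr_ge0 ?expR_ge0 // ltW.
- apply: continuous_subspaceT => r; apply: cvgM; first exact: cvg_cst.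
  exact: continuous_expRM.
- rewrite -oppr0; apply: cvgN.
  rewrite (_ : (fun r => _) = (fun r => expR (- (s * r)))); last by apply/funext => r; rewrite mulNr.
  have sy : s * r @[r --> +oo%R] --> +oo%R by apply: gt0_cvgMry => //; exact: cvg_id.
  exact: (cvg_comp _ (fun r => expR (- r)) sy (@cvgr_expR R)).
- by move=> r _; case: (dF r).
- by apply: cvg_at_right_filter; exact: Fc.
- by move=> r _; rewrite derive1E; have [_ ->] := dF r.
Qed.

End ftc.

(** * The resolvent identity for exponential averages *)

Section resolvent_identity.
Context (R : realType).
Notation lambda := (@lebesgue_measure R).
Context (E : {finite_measure set (measurableTypeR R) -> \bar R}) (HE : exponential_law E).

(** An identity that is linear in F holds for bounded F as soon as it holds for nonnegative
    functions, among them the constants. *)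
Lemma bounded_measurable_shift d (T : measurableType d) (F : T -> R) : bounded_measurable F ->
  exists K G, [/\ bounded_measurable G, forall t, 0 <= G t & F = fun t => G t - K].
Proof.
move=> bF; have [mF [K FK]] := bF; exists K, (fun t => F t + K); split.
- exact: bounded_measurableD (bounded_measurable_cst _ _).
- by move=> t; have := FK t; rewrite ler_norml -subr_ge0 opprK => /andP[].
- by apply/funext => t; rewrite addrK.
Qed.

Lemma measurable_exponential_arg s :
  measurable_fun [set: measurableTypeR R * measurableTypeR R] (fun p => `|p.1| + `|p.2| / s).
Proof.
apply: measurable_funD; first exact: measurableT_comp.
by apply: measurable_funM => //; exact: measurableT_comp.
Qed.

Lemma bounded_measurable_normdiv (F : R -> R) s : bounded_measurable F ->
  bounded_measurable (fun v : measurableTypeR R => F (`|v| / s)).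
Proof.
move=> bF; have mp : measurable_fun [set: measurableTypeR R] (fun v => `|v| / s).
  by apply: measurable_funM.
exact: (bounded_measurable_comp mp bF).
Qed.

Lemma bounded_measurable_norm (F : R -> R) : bounded_measurable F ->
  bounded_measurable (fun v : measurableTypeR R => F `|v|).
Proof. exact: bounded_measurable_comp. Qed.

Lemma bounded_measurable_exponential_arg (F : R -> R) s : bounded_measurable F ->
  bounded_measurable (fun p : measurableTypeR R * measurableTypeR R => F (`|p.1| + `|p.2| / s)).
Proof. by move=> bF; exact: (bounded_measurable_comp (measurable_exponential_arg s) bF). Qed.

Lemma measurable_primitive (a : R -> R) : measurable_fun setT a -> (forall t, 0 <= a t) ->
  measurable_fun setT (fun r : R => \int[lambda]_(t in `[0%R, r]) (a t)%:E)%E.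
Proof.
move=> ma a0.
pose f (p : measurableTypeR R * measurableTypeR R) : \bar R :=
  (if (0 <= p.2) && (p.2 <= p.1) then a p.2 else 0)%:E.
have mf : measurable_fun setT f.
  apply/measurable_EFinP; apply: measurable_fun_ifT => //.
    by apply: measurable_and; exact: measurable_fun_ler.
  exact: measurableT_comp.
suff -> : (fun r : R => \int[lambda]_(t in `[0%R, r]) (a t)%:E)%E = fubini_F lambda f.
  apply: (@measurable_fun_fubini_tonelli_F _ _ _ _ _ lambda f mf).
  by move=> p; rewrite lee_fin; case: ifP.
apply/funext => r; rewrite integral_mkcond; apply: eq_integral => t _.
rewrite patchE /f /=; have [h|h] := boolP ((0 <= t) && (t <= r)).
  by rewrite mem_set /= ?in_itv.
by rewrite memNset /= ?in_itv //=; exact/negP.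
Qed.

(** This is (s + A)^-1 - (1 + A)^-1 = (1 - s) (s + A)^-1 (1 + A)^-1, multiplied by s and read on
    densities, where it says that (1 - s) \int_0^r e^((s - 1) t) dt = 1 - e^((s - 1) r). With s <= 1
    all terms are nonnegative. *)
Lemma resolvent_identity_ge0 (G : R -> R) s : 0 < s <= 1 -> measurable_fun setT G ->
  (forall t, 0 <= G t) ->
  (\int[E]_v (G (`|v| / s)%R)%:E = s%:E * \int[E]_v (G `|v|)%:E +
    (1 - s)%:E * \int[E]_t \int[E]_v (G (`|t| + `|v| / s)%R)%:E)%E.
Proof.
move=> /andP[s0 s1] mG G0; rewrite (exponential_scale HE) // (exponential_convolution HE) //.
have -> : (\int[E]_v (G `|v|)%:E = \int[E]_v (G (`|v| / 1)%R)%:E)%E.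
  by apply: eq_integral => v _; rewrite divr1.
rewrite (exponential_scale HE) //.
have ms c : measurable_fun setT (fun u : R => s * expR (- c * u) * G u).
  by apply: measurable_funM => //; apply: measurable_funM => //; exact: measurable_expRM.
have s0' c u : 0 <= s * expR (- c * u) * G u by rewrite !mulr_ge0 ?expR_ge0 // ltW.
rewrite -ge0_integralZl_EFin //; last 3 first.
- by move=> u _; rewrite lee_fin !mulr_ge0 ?expR_ge0.
- apply/measurable_EFinP; apply: measurable_funTS; apply: measurable_funM => //.
  by apply: measurable_funM => //; exact: measurable_expRM.
- exact: ltW.
rewrite -ge0_integralZl_EFin ?subr_ge0 //; last 2 first.
- by move=> r _; rewrite mule_ge0 ?lee_fin // integral_ge0 // => t _; rewrite lee_fin expR_ge0.
- apply: measurable_funTS; apply: emeasurable_funM; first by apply/measurable_EFinP; exact: ms.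
  by apply: measurable_primitive; [exact: measurable_expRM|move=> t; exact: expR_ge0].
rewrite -ge0_integralD //; last 4 first.
- by move=> u _; rewrite -EFinM lee_fin !mulr_ge0 ?expR_ge0 // ltW.
- apply/measurable_EFinP; apply: measurable_funTS; apply: measurable_funM => //.
  by apply: measurable_funM => //; apply: measurable_funM => //; exact: measurable_expRM.
- move=> r _; rewrite mule_ge0 ?lee_fin ?subr_ge0 // mule_ge0 ?lee_fin //.
  by rewrite integral_ge0 // => t _; rewrite lee_fin expR_ge0.
- apply: measurable_funTS; apply: measurable_funeM.
  apply: emeasurable_funM; first by apply/measurable_EFinP; exact: ms.
  by apply: measurable_primitive; [exact: measurable_expRM|move=> t; exact: expR_ge0].
apply: eq_integral => r /set_mem /=; rewrite in_itv /= andbT => r0.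
rewrite muleCA -ge0_integralZl_EFin ?subr_ge0 //; last first.
- by apply/measurable_EFinP; apply: measurable_funTS; exact: measurable_expRM.
under [X in (_ + _ * X)%E]eq_integral do rewrite -EFinM.
have dE (t : R) : is_derive t (1 : R) (fun u : R => - expR ((s - 1) * u)) ((1 - s) * expR ((s - 1) * t)).
  have := @is_deriveN _ _ _ _ t 1 _ (is_derive_expRM (s - 1) t).
  by rewrite -mulNr opprB.
have cE : continuous (fun t : R => (1 - s) * expR ((s - 1) * t)).
  by move=> t; apply: cvgM; [exact: cvg_cst|exact: continuous_expRM].
rewrite (integral_is_derive r0 cE dE) -!EFinM -EFinD mulr0 expR0 opprK; congr EFin.
have -> : expR (- 1 * r) = expR (- s * r) * expR ((s - 1) * r).
  by rewrite -expRD; congr expR; ring.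
ring.
Qed.


Lemma EFin_Rintegral (F : measurableTypeR R -> R) : bounded_measurable F ->
  (\int[E]_v F v)%:E = (\int[E]_v (F v)%:E)%E.
Proof.
move=> bF; rewrite /Rintegral fineK //; apply: integrable_fin_num => //.
exact: bounded_measurable_integrable.
Qed.

Lemma Rintegral_exponential_cst (c : R) : \int[E]_v c = c.
Proof.
transitivity (c * fine (E setT)); first exact: Rintegral_cst.
by rewrite HE.1 mulr1.
Qed.

(** The added constant drops out because the weights s and 1 - s sum to 1 and [E] has mass 1. *)
Lemma resolvent_identity (F : R -> R) s : 0 < s <= 1 -> bounded_measurable F ->
  \int[E]_v F (`|v| / s) = s * \int[E]_v F `|v| +
    (1 - s) * \int[E]_t \int[E]_v F (`|t| + `|v| / s).
Proof.
move=> s01 /bounded_measurable_shift[K [G [bG G0 ->]]].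
have b1 := bounded_measurable_normdiv s bG.
have b2 := bounded_measurable_norm bG.
have b3 := bounded_measurable_exponential_arg s bG.
have b4 := bounded_measurable_int2 E E b3.
have bK := bounded_measurable_cst (measurableTypeR R) K.
have i F' := @bounded_measurable_integrable _ _ _ E F' _ measurableT.
have H := resolvent_identity_ge0 s01 (proj1 bG) G0.
have {}H : \int[E]_v G (`|v| / s) = s * \int[E]_v G `|v| +
    (1 - s) * \int[E]_t \int[E]_v G (`|t| + `|v| / s).
  apply: EFin_inj; rewrite EFinD !EFinM !EFin_Rintegral // H.
  congr (_ + _ * _)%E; apply: eq_integral => t _.
  rewrite EFin_Rintegral //; exact: (bounded_measurable_slice1 b3 t).
have -> : \int[E]_t \int[E]_v (G (`|t| + `|v| / s) - K) =
    \int[E]_t (\int[E]_v G (`|t| + `|v| / s) - K).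
  apply: eq_Rintegral => t _; rewrite RintegralB ?Rintegral_exponential_cst //.
    by apply: i; exact: (bounded_measurable_slice1 b3 t).
  exact: i.
rewrite !RintegralB ?Rintegral_exponential_cst ?H //; try exact: i.
ring.
Qed.

End resolvent_identity.

(** * Integration by parts against the exponential law *)

Section exponential_by_parts.
Context (R : realType).
Notation lambda := (@lebesgue_measure R).
Context (E : {finite_measure set (measurableTypeR R) -> \bar R}) (HE : exponential_law E).

(** Writing e^(- s t) as the integral of s e^(- s r) over r >= t turns the integration by parts into
    an exchange of order on the triangle. *)
Lemma exponential_by_parts_ge0 (G : R -> R) s : 0 < s -> measurable_fun setT G ->
  (forall t, 0 <= G t) ->
  (\int[E]_v (G (`|v| / s)%R)%:E = s%:E * \int[lambda]_(r in `[0%R, +oo[)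
    ((s * expR (- s * r))%:E * \int[lambda]_(t in `[0%R, r]) (G t)%:E))%E.
Proof.
move=> s0 mG G0; have s0' r : 0 <= s * expR (- s * r) by rewrite mulr_ge0 ?expR_ge0 // ltW.
have ms : measurable_fun setT (fun r : R => s * expR (- s * r)).
  by apply: measurable_funM => //; exact: measurable_expRM.
rewrite -(tonelli_triangle mG ms G0 s0') (exponential_scale HE) //.
rewrite -ge0_integralZl_EFin //; last 3 first.
- by move=> t _; rewrite integral_expRM_tail // -EFinM lee_fin mulr_ge0 ?expR_ge0.
- apply: measurable_funTS; under eq_fun do rewrite integral_expRM_tail // -EFinM.
  by apply/measurable_EFinP; apply: measurable_funM => //; exact: measurable_expRM.
- exact: ltW.
apply: eq_integral => t _; rewrite integral_expRM_tail // -!EFinM; congr EFin; ring.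
Qed.

Lemma bounded_measurable_integrable_itv (F : R -> R) (a b : R) : bounded_measurable F ->
  lambda.-integrable `[a, b] (EFin \o F).
Proof.
move=> [mF [K FK]]; apply: (bounded_rintegrable _ (K := K)) => //.
  by rewrite /= lebesgue_measure_itv; case: ifP => _ //; rewrite -EFinB ltry.
exact: measurable_funTS.
Qed.

Lemma EFin_primitive (F : R -> R) (r : R) : bounded_measurable F ->
  (\int[lambda]_(t in `[0, r]) F t)%:E = (\int[lambda]_(t in `[0%R, r]) (F t)%:E)%E.
Proof.
move=> bF; rewrite /Rintegral fineK //; apply: integrable_fin_num => //.
exact: bounded_measurable_integrable_itv.
Qed.

(** Integrability travels with the identity, since the real-valued integral of a non-integrable
    function is a mere default or truncated value. *)
Let parts (F : R -> R) s := lambda.-integrable `[0%R, +oo[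
    (EFin \o (fun r : R => s * expR (- s * r) * \int[lambda]_(t in `[0, r]) F t)) /\
  \int[E]_v F (`|v| / s) = s * \int[lambda]_(r in `[0, +oo[)
    (s * expR (- s * r) * \int[lambda]_(t in `[0, r]) F t).

Let parts_ge0 (G : R -> R) s : 0 < s -> bounded_measurable G -> (forall t, 0 <= G t) -> parts G s.
Proof.
move=> s0 bG G0; have mG := proj1 bG.
have e (r : R) : ((s * expR (- s * r))%:E * \int[lambda]_(t in `[0%R, r]) (G t)%:E)%E =
    (s * expR (- s * r) * \int[lambda]_(t in `[0, r]) G t)%:E.
  by rewrite [RHS]EFinM EFin_primitive.
have ge0 (r : R) : 0 <= s * expR (- s * r) * \int[lambda]_(t in `[0, r]) G t.
  by rewrite mulr_ge0 ?Rintegral_ge0 // mulr_ge0 ?expR_ge0 // ltW.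
have H := exponential_by_parts_ge0 s0 mG G0.
have Efin : (\int[E]_v (G (`|v| / s))%:E)%E \is a fin_num.
  apply: integrable_fin_num => //; apply: bounded_measurable_integrable => //.
  exact: bounded_measurable_normdiv.
have H' : (\int[lambda]_(r in `[0%R, +oo[) ((s * expR (- s * r))%:E *
    \int[lambda]_(t in `[0%R, r]) (G t)%:E))%E = (s^-1 * \int[E]_v G (`|v| / s))%:E.
  by rewrite EFinM fineK // H muleA -EFinM mulVf ?gt_eqF // mul1e.
split.
  apply/integrableP; split.
    rewrite (_ : EFin \o _ = (fun r : R => (s * expR (- s * r))%:E *
      \int[lambda]_(t in `[0%R, r]) (G t)%:E)%E); last by apply/funext => r; rewrite e.
    apply: measurable_funTS; apply: emeasurable_funM.
      apply/measurable_EFinP; apply: measurable_funM => //; exact: measurable_expRM.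
    exact: measurable_primitive.
  under eq_integral => r _ do rewrite /= ger0_norm // -e.
  by rewrite H' ltry.
rewrite [X in _ = s * X]/Rintegral; under eq_integral => r _ do rewrite -e.
by rewrite H' /= mulrA mulfV ?gt_eqF // mul1r.
Qed.

Lemma exponential_by_parts (F : R -> R) s : 0 < s -> bounded_measurable F ->
  lambda.-integrable `[0%R, +oo[
    (EFin \o (fun r : R => s * expR (- s * r) * \int[lambda]_(t in `[0, r]) F t)) /\
  \int[E]_v F (`|v| / s) = s * \int[lambda]_(r in `[0, +oo[)
    (s * expR (- s * r) * \int[lambda]_(t in `[0, r]) F t).
Proof.
move=> s0 /bounded_measurable_shift[K [G [bG G0 ->]]].
have [i1 e1] := parts_ge0 s0 (bounded_measurable_cst _ 1) (fun _ => ler01).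
have [iG eG] := parts_ge0 s0 bG G0.
have e (r : R) : s * expR (- s * r) * \int[lambda]_(t in `[0, r]) (G t - K) =
    s * expR (- s * r) * \int[lambda]_(t in `[0, r]) G t -
    K * (s * expR (- s * r) * \int[lambda]_(t in `[0, r]) 1).
  rewrite RintegralB //; last 2 first.
  - exact: bounded_measurable_integrable_itv.
  - by apply: bounded_measurable_integrable_itv; exact: bounded_measurable_cst.
  rewrite mulrBr mulrCA; congr (_ - _ * _).
  by rewrite !Rintegral_cst // mul1r.
have iK : lambda.-integrable `[0%R, +oo[ (EFin \o (fun r : R =>
    K * (s * expR (- s * r) * \int[lambda]_(t in `[0, r]) 1))) by exact: rintegrableZ.
split.
  have mD : measurable (`[0%R, +oo[%classic : set (measurableTypeR R)) by [].
  have := rintegrableB mD iG iK; by apply: eq_integrable => // r _; rewrite /= e.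
have -> : \int[lambda]_(r in `[0, +oo[) (s * expR (- s * r) * \int[lambda]_(t in `[0, r]) (G t - K))
    = \int[lambda]_(r in `[0, +oo[) (s * expR (- s * r) * \int[lambda]_(t in `[0, r]) G t -
      K * (s * expR (- s * r) * \int[lambda]_(t in `[0, r]) 1)).
  by apply: eq_Rintegral => r _; exact: e.
rewrite !RintegralB ?RintegralZl //; last 2 first.
- by apply: bounded_measurable_integrable => //; exact: bounded_measurable_normdiv.
- by apply: bounded_measurable_integrable => //; exact: bounded_measurable_cst.
rewrite eG mulrBr mulrCA -e1 !(Rintegral_exponential_cst HE) mulr1 //.
Qed.



End exponential_by_parts.

(** * The Laplace transform of the regularized Stieltjes function *)

Section transfer.
Context (R : realType) d1 d2 (T1 : measurableType d1) (T : measurableType d2).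
Context (nu : {finite_measure set T1 -> \bar R}) (m : {measure set T -> \bar R}).
Context (D : set T) (p : T1 -> T) (k : T -> R).
Hypotheses (mD : measurable D) (mp : measurable_fun setT p) (mk : measurable_fun D k)
  (k0 : forall t, D t -> 0 <= k t).
Hypothesis nuE : forall G : T -> R, measurable_fun setT G -> (forall t, 0 <= G t) ->
  (\int[nu]_v (G (p v))%:E = \int[m]_(u in D) (k u * G u)%:E)%E.

Let transfer_ge0 (G : T -> R) : bounded_measurable G -> (forall t, 0 <= G t) ->
  m.-integrable D (EFin \o (fun u => k u * G u)) /\
  \int[nu]_v G (p v) = \int[m]_(u in D) (k u * G u).
Proof.
move=> bG G0; have mG := proj1 bG; have H := nuE mG G0.
split; last by rewrite /Rintegral H.
apply/integrableP; split.
  by apply/measurable_EFinP; apply: measurable_funM => //; exact: measurable_funTS.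
under eq_integral => u /set_mem Du do rewrite /= ger0_norm ?mulr_ge0 ?k0 //.
rewrite -H ltey_eq integrable_fin_num //; apply: bounded_measurable_integrable => //.
exact: bounded_measurable_comp.
Qed.

(** Carries a density formula from nonnegative to bounded functions; it serves both for the
    exponential density and for the weights put on mu. *)
Lemma Rintegral_transfer (F : T -> R) : bounded_measurable F ->
  m.-integrable D (EFin \o (fun u => k u * F u)) /\
  \int[nu]_v F (p v) = \int[m]_(u in D) (k u * F u).
Proof.
move=> /bounded_measurable_shift[K [G [bG G0 ->]]].
have [iG eG] := transfer_ge0 bG G0.
have [i1 e1] := transfer_ge0 (bounded_measurable_cst _ 1) (fun _ => ler01).
have iK : m.-integrable D (EFin \o (fun u => K * (k u * 1))) by exact: rintegrableZ.
have e u : k u * (G u - K) = k u * G u - K * (k u * 1) by ring.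
split.
  by have := rintegrableB mD iG iK; apply: eq_integrable => // u _; rewrite /= e.
have -> : \int[m]_(u in D) (k u * (G u - K)) = \int[m]_(u in D) (k u * G u - K * (k u * 1)).
  by apply: eq_Rintegral => u _; exact: e.
rewrite !RintegralB //; last 2 first.
- by apply: bounded_measurable_integrable => //; exact: bounded_measurable_comp.
- by apply: bounded_measurable_integrable => //; exact: bounded_measurable_cst.
rewrite eG RintegralZl // -e1; congr (_ - _).
rewrite -RintegralZl //; first by apply: eq_Rintegral => u _; rewrite mulr1.
by apply: bounded_measurable_integrable => //; exact: bounded_measurable_cst.
Qed.

End transfer.

(** * Complex exponentials in real form *)

Section exponential_oscillation.
Context (R : realType).
Notation lambda := (@lebesgue_measure R).
Context (E : {finite_measure set (measurableTypeR R) -> \bar R}) (HE : exponential_law E).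

Lemma Rintegral_exponential_scale (F : R -> R) s : 0 < s -> bounded_measurable F ->
  lambda.-integrable `[0%R, +oo[ (EFin \o (fun u : R => s * expR (- s * u) * F u)) /\
  \int[E]_v F (`|v| / s) = \int[lambda]_(u in `[0, +oo[) (s * expR (- s * u) * F u).
Proof.
move=> s0 bF.
apply: (@Rintegral_transfer _ _ _ (measurableTypeR R) (measurableTypeR R) E lambda `[0%R, +oo[
  (fun v => `|v| / s) (fun u => s * expR (- s * u)) _ _ _ _ _ F bF) => //.
- exact: measurable_funM.
- by apply: measurable_funTS; apply: measurable_funM => //; exact: measurable_expRM.
- by move=> u _; rewrite mulr_ge0 ?expR_ge0 // ltW.
- by move=> G mG G0; exact: exponential_scale.
Qed.

Context (a b : R) (a0 : 0 <= a).

(** The real part of e^(- z t) for z = a + i b; [damped_sin] is the opposite of its imaginary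
    part. *)
Definition damped_cos (t : R) : R := expR (- a * t) * cos (b * t).
Definition damped_sin (t : R) : R := expR (- a * t) * sin (b * t).

Lemma damped_cosD t u : damped_cos (t + u) =
  damped_cos t * damped_cos u - damped_sin t * damped_sin u.
Proof. rewrite /damped_cos /damped_sin !mulrDr expRD cosD; ring. Qed.

Lemma damped_sinD t u : damped_sin (t + u) =
  damped_sin t * damped_cos u + damped_cos t * damped_sin u.
Proof. rewrite /damped_cos /damped_sin !mulrDr expRD sinD; ring. Qed.

Lemma is_derive_damped_cos (t : R) :
  is_derive t (1 : R) damped_cos (- a * damped_cos t - b * damped_sin t).
Proof.
have dc : is_derive t (1 : R) (fun u : R => cos (b * u)) (- b * sin (b * t)).
  have := @is_derive1_comp R cos (fun u => b * u) t _ _ (is_derive_cos (b * t))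
    (@is_deriveZ _ _ _ id b t 1 1 (is_derive_id t 1)).
  by rewrite /GRing.scale /= mulr1 mulrC mulrN mulNr.
have := is_deriveM (is_derive_expRM (- a) t) dc.
rewrite /GRing.scale /=; congr is_derive; rewrite /damped_cos /damped_sin; ring.
Qed.

Lemma is_derive_damped_sin (t : R) :
  is_derive t (1 : R) damped_sin (- a * damped_sin t + b * damped_cos t).
Proof.
have dc : is_derive t (1 : R) (fun u : R => sin (b * u)) (b * cos (b * t)).
  have := @is_derive1_comp R sin (fun u => b * u) t _ _ (is_derive_sin (b * t))
    (@is_deriveZ _ _ _ id b t 1 1 (is_derive_id t 1)).
  by rewrite /GRing.scale /= mulr1 mulrC.
have := is_deriveM (is_derive_expRM (- a) t) dc.
rewrite /GRing.scale /=; congr is_derive; rewrite /damped_cos /damped_sin; ring.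
Qed.

Lemma continuous_is_derive (F f : R -> R) : (forall t : R, is_derive t (1 : R) F (f t)) ->
  continuous F.
Proof.
move=> dF t; apply: differentiable_continuous; apply/derivable1_diffP.
by case: (dF t).
Qed.

Lemma continuous_damped_cos : continuous damped_cos.
Proof. exact: continuous_is_derive is_derive_damped_cos. Qed.

Lemma continuous_damped_sin : continuous damped_sin.
Proof. exact: continuous_is_derive is_derive_damped_sin. Qed.

Lemma damped_le1 (c t : R) : `|c| <= 1 -> `|expR (- a * `|t|) * c| <= 1.
Proof.
move=> c1; rewrite normrM ger0_norm ?expR_ge0 // mulr_ile1 ?expR_ge0 //.
by rewrite -expR0 ler_expR mulNr oppr_le0 mulr_ge0.
Qed.

Lemma bounded_damped_cos : bounded_measurable (fun t : R => damped_cos `|t|).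
Proof.
split; last by exists 1 => t; apply: damped_le1; rewrite ler_norml cos_geN1 cos_le1.
by apply: measurableT_comp => //; apply: continuous_measurable_fun; exact: continuous_damped_cos.
Qed.

Lemma bounded_damped_sin : bounded_measurable (fun t : R => damped_sin `|t|).
Proof.
split; last by exists 1 => t; apply: damped_le1; rewrite ler_norml sin_geN1 sin_le1.
by apply: measurableT_comp => //; apply: continuous_measurable_fun; exact: continuous_damped_sin.
Qed.

(** The rule for the Laplace transform of a derivative: the primitive of f that enters
    [exponential_by_parts] is F - F 0. *)
Lemma exponential_is_derive (F f : R -> R) s : 0 < s ->
  (forall t : R, is_derive t (1 : R) F (f t)) -> continuous f ->
  bounded_measurable (fun t : R => F `|t|) -> bounded_measurable (fun t : R => f `|t|) ->
  \int[E]_v f (`|v| / s) = s * (\int[E]_v F (`|v| / s) - F 0).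
Proof.
move=> s0 dF cf bF bf.
have abs v : `| `|v| / s | = `|v| / s by rewrite ger0_norm // divr_ge0 // ltW.
have [_ H] := exponential_by_parts HE s0 bf.
have bF0 : bounded_measurable (fun t : R => F `|t| - F 0).
  by apply: bounded_measurableB => //; exact: bounded_measurable_cst.
have [_ H'] := Rintegral_exponential_scale s0 bF0.
transitivity (s * \int[lambda]_(u in `[0, +oo[) (s * expR (- s * u) * (F `|u| - F 0))).
  transitivity (\int[E]_v f `| `|v| / s |); first by apply: eq_Rintegral => v _; rewrite abs.
  rewrite H; congr (_ * _); apply: eq_Rintegral => r /set_mem /=; rewrite in_itv /= andbT => r0.
  congr (_ * _); rewrite ger0_norm //.
  transitivity (\int[lambda]_(t in `[0, r]) f t).
    by apply: eq_Rintegral => t /set_mem /=; rewrite in_itv /= => /andP[t0 _]; rewrite ger0_norm.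
  by rewrite /Rintegral (integral_is_derive r0 cf dF).
rewrite -H'; congr (_ * _).
rewrite RintegralB //; last 2 first.
- by apply: bounded_measurable_integrable => //; exact: (bounded_measurable_normdiv s bF).
- by apply: bounded_measurable_integrable => //; exact: bounded_measurable_cst.
rewrite (Rintegral_exponential_cst HE); congr (_ - _).
by apply: eq_Rintegral => v _; rewrite abs.
Qed.

(** Each derivative of the damped pair is a combination of the pair, so the rule for derivatives
    gives a linear system: the real form of (s + z) E[e^(- z v / s)] = s. *)
Lemma exponential_damped s : 0 < s ->
  (s + a) * \int[E]_v damped_cos (`|v| / s) + b * \int[E]_v damped_sin (`|v| / s) = s /\
  b * \int[E]_v damped_cos (`|v| / s) = (s + a) * \int[E]_v damped_sin (`|v| / s).
Proof.
move=> s0; have bc := bounded_damped_cos; have bs := bounded_damped_sin.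
have ic : E.-integrable setT (EFin \o (fun v => damped_cos (`|v| / s))).
  have := bounded_measurable_integrable E measurableT (bounded_measurable_normdiv s bc).
  by apply: eq_integrable => // v _ /=; rewrite (ger0_norm (_ : 0 <= `|v| / s)) // divr_ge0 // ltW.
have iss : E.-integrable setT (EFin \o (fun v => damped_sin (`|v| / s))).
  have := bounded_measurable_integrable E measurableT (bounded_measurable_normdiv s bs).
  by apply: eq_integrable => // v _ /=; rewrite (ger0_norm (_ : 0 <= `|v| / s)) // divr_ge0 // ltW.
have c1 : damped_cos 0 = 1 by rewrite /damped_cos !mulr0 expR0 cos0 mulr1.
have s1 : damped_sin 0 = 0 by rewrite /damped_sin !mulr0 sin0 mulr0.
have cc := continuous_damped_cos; have cs := continuous_damped_sin.
have Hc := @exponential_is_derive _ _ s s0 is_derive_damped_cos _ bc _.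
have Hs := @exponential_is_derive _ _ s s0 is_derive_damped_sin _ bs _.
rewrite c1 RintegralB ?RintegralZl // in Hc; try exact: rintegrableZ.
rewrite s1 subr0 RintegralD ?RintegralZl // in Hs; try exact: rintegrableZ.
split.
  suff : - a * \int[E]_x damped_cos (`|x| / s) - b * \int[E]_x damped_sin (`|x| / s) =
    s * (\int[E]_v damped_cos (`|v| / s) - 1) by lra.
  apply: Hc.
    by move=> t; apply: cvgB; apply: cvgM; try exact: cvg_cst; [exact: cc|exact: cs].
  by apply: bounded_measurableB; exact: bounded_measurableZ.
suff : - a * \int[E]_x damped_sin (`|x| / s) + b * \int[E]_x damped_cos (`|x| / s) =
    s * \int[E]_v damped_sin (`|v| / s) by lra.
apply: Hs.
  by move=> t; apply: cvgD; apply: cvgM; try exact: cvg_cst; [exact: cs|exact: cc].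
by apply: bounded_measurableD; exact: bounded_measurableZ.
Qed.


End exponential_oscillation.

Lemma measurable_inv (R : realType) : measurable_fun [set: R] (@GRing.inv R).
Proof.
have m0 : measurable (~` [set (0 : R)]) by apply: measurableC.
rewrite -(setUv [set (0 : R)]); apply/measurable_funU => //; split.
  exact: measurable_fun_set1.
apply: open_continuous_measurable_fun.
  by apply: closed_openC; exact: closed_eq.
by move=> x /set_mem /eqP x0; exact: inv_continuous.
Qed.

Section image_halfline.
Context (R : realType) d1 d2 (T1 : measurableType d1) (T2 : measurableType d2).
Context (m1 : {finite_measure set T1 -> \bar R}) (m2 : {finite_measure set T2 -> \bar R}).
Context (nu : {finite_measure set (measurableTypeR R) -> \bar R}).
Context (p : T1 * T2 -> R) (p0 : forall x, 0 <= p x).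
Hypothesis nuE : forall f : measurableTypeR R -> R, bounded_measurable f ->
  \int[nu]_z f z = \int[m1]_x \int[m2]_y f (p (x, y)).

(** As p >= 0, the image measure is carried by the half-line. Boundedness is asked of f there only,
    because the damped functions may blow up at negative times. *)
Lemma Rintegral_image_halfline (f : R -> R) : bounded_measurable (fun t : R => f `|t|) ->
  \int[nu]_(t in `[0, +oo[) f t = \int[m1]_x \int[m2]_y f (p (x, y)).
Proof.
move=> bf; rewrite Rintegral_mkcond.
have e : f \_ `[0, +oo[ = (fun t => f `|t|) \_ `[0, +oo[.
  apply/funext => t; rewrite !patchE; case: ifP => // /set_mem /=.
  by rewrite in_itv /= andbT => t0; rewrite ger0_norm.
have bf' : bounded_measurable (T := measurableTypeR R) ((fun t => f `|t|) \_ `[0, +oo[).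
  exact: bounded_measurable_patch.
rewrite e (nuE bf'); apply: eq_Rintegral => x _; apply: eq_Rintegral => y _.
by rewrite patchE mem_set /= ?in_itv /= ?andbT // ger0_norm.
Qed.

End image_halfline.

Section exponential_images.
Context (R : realType).
Context (E pi : {finite_measure set (measurableTypeR R) -> \bar R}).

Lemma measurable_max1 : measurable_fun [set: R] (fun s : R => Num.max 1 s).
Proof. exact: measurable_maxr. Qed.

(** Supplies the positive part of a measure representing e g. The rate max 1 s in place of s results
    from the resolvent identity. *)
Lemma exists_exponential_max :
  exists rp : {finite_measure set (measurableTypeR R) -> \bar R},
  forall f : R -> R, bounded_measurable (fun t : R => f `|t|) ->
  bounded_measurable (fun s : measurableTypeR R => \int[E]_v f (`|v| / Num.max 1 s)) /\
  \int[rp]_(t in `[0, +oo[) f t = \int[pi]_s \int[E]_v f (`|v| / Num.max 1 s).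
Proof.
pose p (x : measurableTypeR R * measurableTypeR R) : measurableTypeR R := `|x.2| / Num.max 1 x.1.
have mp : measurable_fun setT p.
  apply: measurable_funM; first exact: measurableT_comp.
  apply: (measurableT_comp (@measurable_inv R)).
  exact: (measurableT_comp measurable_max1).
have p0 x : 0 <= p x by rewrite divr_ge0 // le_max ler01.
have [rp rpE] := exists_finite_image pi E mp.
exists rp => f bf; split; last exact: (Rintegral_image_halfline p0 rpE bf).
have b1 : bounded_measurable (fun x => f (p x)).
  have := bounded_measurable_comp mp bf; congr bounded_measurable.
  by apply/funext => x; rewrite ger0_norm.
exact: (bounded_measurable_int2 pi E b1).
Qed.

(** Supplies the negative part: the law of the sum of an exponential time of rate 1 and one of rate
    s, averaged over s. *)
Lemma exists_exponential_sum :
  exists rn : {finite_measure set (measurableTypeR R) -> \bar R},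
  forall f : R -> R, bounded_measurable (fun t : R => f `|t|) ->
  bounded_measurable (fun s : measurableTypeR R =>
    \int[E]_t \int[E]_v f (`|t| + `|v| / `|s|)) /\
  \int[rn]_(t in `[0, +oo[) f t = \int[pi]_s \int[E]_t \int[E]_v f (`|t| + `|v| / `|s|).
Proof.
have [K KE] := exists_finite_image pi E (@measurable_id _ (measurableTypeR R * measurableTypeR R)%type setT).
pose q (x : (measurableTypeR R * measurableTypeR R) * measurableTypeR R) : measurableTypeR R :=
  `|x.1.2| + `|x.2| / `|x.1.1|.
have mq : measurable_fun setT q.
  apply: measurable_funD.
    by apply: measurableT_comp => //; apply: measurableT_comp.
  apply: measurable_funM; first exact: measurableT_comp.
  apply: (measurableT_comp (@measurable_inv R)); apply: measurableT_comp => //.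
  exact: measurableT_comp.
have q0 x : 0 <= q x by rewrite addr_ge0 // divr_ge0.
have [rn rnE] := exists_finite_image K E mq.
exists rn => f bf.
have b2 : bounded_measurable (fun x => f (q x)).
  have := bounded_measurable_comp mq bf; congr bounded_measurable.
  by apply/funext => x; rewrite ger0_norm.
have b3 := bounded_measurable_int2 K E b2.
split; first exact: (bounded_measurable_int2 pi E b3).
by rewrite (Rintegral_image_halfline q0 rnE bf) (KE _ b3).
Qed.

End exponential_images.

(** * Finite measures representing the regularized function *)

Section stieltjes_regularized.
Context (R : realType) (mu : {measure set (measurableTypeR R) -> \bar R}).
Hypothesis muS : stieltjes_measure mu.
Context (E : {finite_measure set (measurableTypeR R) -> \bar R}) (HE : exponential_law E).

(** The bound C / (1 + s) is what makes the Stieltjes condition yield finite mass. Fubini is later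
    applied to such measures and never to mu itself. *)
Lemma exists_weighted (w : R -> R) (C : R) : measurable_fun [set: R] w ->
  (forall s, 0 < s -> 0 <= w s <= C / (1 + s)) ->
  exists nu : {finite_measure set (measurableTypeR R) -> \bar R},
  forall G : R -> R, measurable_fun setT G -> (forall t, 0 <= G t) ->
    (\int[nu]_s (G s)%:E = \int[mu]_(s in `]0%R, +oo[) (w s * G s)%:E)%E.
Proof.
move=> mw wC; pose k : measurableTypeR R -> R := w \_ `]0, +oo[.
have mk : measurable_fun setT k.
  exact: ((measurable_restrictT w (measurable_itv _)).1 (measurable_funTS mw)).
have k0 t : 0 <= k t.
  rewrite /k patchE; case: ifP => // /set_mem /=; rewrite in_itv /= andbT => t0.
  by case/andP: (wC _ t0).
have C0 : 0 <= C.
  have /andP[w0 w1] := wC _ (@ltr01 R).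
  by move: (le_trans w0 w1); rewrite pmulr_lge0 // invr_gt0 addr_gt0.
have mC : measurable_fun (`]0%R, +oo[ : set (measurableTypeR R)) (fun s : R => C / (1 + s)).
  apply: measurable_funTS; apply: measurable_funM => //.
  by apply: (measurableT_comp (@measurable_inv R)); exact: measurable_funD.
have mC' : measurable_fun (`]0%R, +oo[ : set (measurableTypeR R)) (fun s : R => (1 + s)^-1).
  apply: measurable_funTS.
  by apply: (measurableT_comp (@measurable_inv R)); exact: measurable_funD.
have [M [MB MG]] := exists_density mu mk k0.
have kE (t : R) (c : R) : (c%:E * (k t)%:E)%E = ((fun s : R => (w s * c)%:E) \_ `]0%R, +oo[) t.
  by rewrite /k !patchE; case: ifP => _; rewrite -EFinM mulrC ?mul0r.
have Moo : (M setT < +oo)%E.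
  rewrite MB; apply: (@le_lt_trans _ _ (\int[mu]_(s in `]0%R, +oo[) (C / (1 + s))%:E)%E).
    under eq_integral => t _ do rewrite -[(k t)%:E]mul1e kE.
    rewrite -integral_mkcond; under eq_integral do rewrite mulr1.
    apply: ge0_le_integral => //.
    - by move=> s; rewrite /= in_itv /= andbT => /wC /andP[].
    - by apply/measurable_EFinP; exact: measurable_funTS.
    - exact/measurable_EFinP.
    - by move=> s; rewrite /= in_itv /= andbT => /wC /andP[].
  under eq_integral do rewrite EFinM.
  rewrite ge0_integralZl_EFin //; last 2 first.
  - by move=> s; rewrite /= in_itv /= andbT => s0; rewrite lee_fin invr_ge0 ltW // addr_gt0.
  - exact/measurable_EFinP.
  by rewrite lte_mul_pinfty ?lee_fin.
have [nu nuM] := exists_finite_measure Moo.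
exists nu => G mG G0; rewrite [RHS]integral_mkcond.
transitivity (\int[M]_s (G s)%:E)%E; first by apply: eq_measure_integral => B _ _; exact: nuM.
rewrite MG //; first by apply: eq_integral => t _; exact: kE.
  exact/measurable_EFinP.
Qed.

(* For f t = phi (T t x), this is phi (s e(A) (s + A)^-1 x) with
   e(z) = z / (z + 1). *)
Definition resolvent_defect (f : R -> R) (s : R) : R :=
  \int[E]_v f (`|v| / s) - \int[E]_t \int[E]_v f (`|t| + `|v| / s).

(** The constant 2 comes from 1 + s <= 2 max(1, s). *)
Lemma inv_max_bounds (s : R) : 0 < s -> 0 <= (Num.max 1 s)^-1 <= 2 / (1 + s).
Proof.
move=> s0; have m0 : 0 < Num.max 1 s by rewrite lt_max ltr01.
rewrite invr_ge0 ltW //= ler_pdivlMr ?addr_gt0 // mulrC ler_pdivrMr //.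
have : 1 <= Num.max 1 s by rewrite le_max lexx.
have : s <= Num.max 1 s by rewrite le_max lexx orbT.
lra.
Qed.

(** For s > 1 both sides coincide. For s <= 1 write P, Q, D for the averages of f at v / s, at v and
    at t + v / s: the resolvent identity P = s Q + (1 - s) D gives Q - D = (P - D) / s. *)
Lemma resolvent_defect_max (f : R -> R) s : 0 < s -> bounded_measurable (fun t : R => f `|t|) ->
  (Num.max 1 s)^-1 * (\int[E]_v f (`|v| / Num.max 1 s) -
    \int[E]_t \int[E]_v f (`|t| + `|v| / `|s|)) = s^-1 * resolvent_defect f s.
Proof.
move=> s0 bf; rewrite /resolvent_defect (gtr0_norm s0).
have [s1|s1] := leP s 1; last by [].
have := resolvent_identity HE (s := s) _ bf; rewrite s0 s1 => /(_ isT) H.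
have e1 : \int[E]_v f `| `|v| / s | = \int[E]_v f (`|v| / s).
  by apply: eq_Rintegral => v _; rewrite ger0_norm // divr_ge0 // ltW.
have e2 : \int[E]_v f `| `|v| | = \int[E]_v f `|v| by apply: eq_Rintegral => v _; rewrite normr_id.
have e3 : \int[E]_t \int[E]_v f `| `|t| + `|v| / s | = \int[E]_t \int[E]_v f (`|t| + `|v| / s).
  apply: eq_Rintegral => t _; apply: eq_Rintegral => v _.
  by rewrite ger0_norm // addr_ge0 // divr_ge0 // ltW.
rewrite e1 e2 e3 in H; rewrite H.
have -> : \int[E]_v f (`|v| / 1) = \int[E]_v f `|v| by apply: eq_Rintegral => v _; rewrite divr1.
by field; rewrite gt_eqF.
Qed.

Lemma weighted_transfer (pi : {finite_measure set (measurableTypeR R) -> \bar R})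
    (F : R -> R) : measurable_fun [set: R] (fun s : R => (Num.max 1 s)^-1) ->
  (forall G : R -> R, measurable_fun setT G -> (forall t, 0 <= G t) ->
    (\int[pi]_s (G s)%:E = \int[mu]_(s in `]0%R, +oo[) ((Num.max 1 s)^-1 * G s)%:E)%E) ->
  bounded_measurable F ->
  mu.-integrable `]0%R, +oo[ (EFin \o (fun s : R => (Num.max 1 s)^-1 * F s)) /\
  \int[pi]_s F s = \int[mu]_(s in `]0, +oo[) ((Num.max 1 s)^-1 * F s).
Proof.
move=> minv piE bF.
apply: (@Rintegral_transfer _ _ _ (measurableTypeR R) (measurableTypeR R) pi mu `]0%R, +oo[
  id (fun s => (Num.max 1 s)^-1) _ _ _ _ _ F bF).
- exact: measurable_itv.
- exact: measurable_id.
- exact: measurable_funTS.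
- by move=> s; rewrite /= in_itv /= andbT => /inv_max_bounds /andP[].
- by move=> G mG G0; exact: piE.
Qed.

(* The resolvent identity replaces the density s^-1, in general not mu-integrable near 0, by
   1 / max 1 s (lemma resolvent_defect_max), whence finite measures. *)
Lemma exists_regularized : exists rp rn : {finite_measure set (measurableTypeR R) -> \bar R},
  forall f : R -> R, bounded_measurable (fun t : R => f `|t|) ->
  mu.-integrable `]0%R, +oo[ (EFin \o (fun s : R => s^-1 * resolvent_defect f s)) /\
  \int[rp]_(t in `[0, +oo[) f t - \int[rn]_(t in `[0, +oo[) f t =
    \int[mu]_(s in `]0, +oo[) (s^-1 * resolvent_defect f s).
Proof.
have minv : measurable_fun [set: R] (fun s : R => (Num.max 1 s)^-1).
  by apply: (measurableT_comp (@measurable_inv R)); exact: measurable_max1.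
have [pi piE] := exists_weighted minv inv_max_bounds.
have [rp rpE] := exists_exponential_max E pi.
have [rn rnE] := exists_exponential_sum E pi.
exists rp, rn => f bf.
have [b5 e5] := rpE f bf.
have [b4 e4] := rnE f bf.
have b6 := bounded_measurableB b5 b4.
rewrite e5 e4 -(RintegralB measurableT (bounded_measurable_integrable pi measurableT b5)
  (bounded_measurable_integrable pi measurableT b4)).
move=> {rpE rnE e5 e4}.
have [i6 ->] := weighted_transfer minv piE b6.
have D s : s \in `]0, +oo[%classic -> 0 < s by move/set_mem; rewrite /= in_itv /= andbT.
split; last by apply: eq_Rintegral => s /D s0; rewrite resolvent_defect_max.
apply: eq_integrable i6; first exact: measurable_itv.
by move=> s /D s0; rewrite /= resolvent_defect_max.
Qed.

End stieltjes_regularized.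

(** * Identification of the Laplace transform *)

Section laplace_regularized.
Context (R : realType) (mu : {measure set (measurableTypeR R) -> \bar R}).
Hypothesis muS : stieltjes_measure mu.
Context (E : {finite_measure set (measurableTypeR R) -> \bar R}) (HE : exponential_law E).

Definition regularizer : cmeasure R := CMeasure (dirac (0 : measurableTypeR R)) E mzero mzero.

Lemma exponential_damped_values a b s : 0 <= a -> 0 < s ->
  \int[E]_v damped_cos a b (`|v| / s) = s * ((s + a) / ((s + a) ^+ 2 + b ^+ 2)) /\
  \int[E]_v damped_sin a b (`|v| / s) = s * (b / ((s + a) ^+ 2 + b ^+ 2)).
Proof.
move=> a0 s0; have [] := exponential_damped HE b a0 s0.
move: (Rintegral _ _ _) (Rintegral _ _ _) => S C H1 H2.
have n0 : (s + a) ^+ 2 + b ^+ 2 != 0.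
  by rewrite gt_eqF // ltr_wpDr ?sqr_ge0 // exprn_gt0 // ltr_wpDr.
split; apply: (mulIf n0); rewrite -!mulrA mulVf // mulr1.
  have -> : C * ((s + a) ^+ 2 + b ^+ 2) =
    (s + a) * ((s + a) * C + b * S) - b * ((s + a) * S - b * C) by ring.
  by rewrite H1 H2 subrr mulr0 subr0 mulrC.
have -> : S * ((s + a) ^+ 2 + b ^+ 2) =
  b * ((s + a) * C + b * S) - (s + a) * (b * C - (s + a) * S) by ring.
by rewrite H1 H2 subrr mulr0 subr0 mulrC.
Qed.

Lemma stieltjes_kernelE (z : R[i]) (s : R) : 0 < complex.Re z -> 0 < s ->
  (z + s%:C%C)^-1 =
  Complex (s^-1 * \int[E]_v damped_cos (complex.Re z) (complex.Im z) (`|v| / s))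
    (- (s^-1 * \int[E]_v damped_sin (complex.Re z) (complex.Im z) (`|v| / s))).
Proof.
case: z => a b /= a0 s0; have [-> ->] := exponential_damped_values b (ltW a0) s0.
rewrite !mulKf ?gt_eqF //.
(* With the real part in the form s + a, both sides agree by the definition of the inverse in
   [R[i]]. *)
have -> : (Complex a b + s%:C%C)^-1 = (Complex (s + a) b)^-1.
  by congr (_^-1); congr Complex; rewrite ?addr0 // addrC.
by [].
Qed.

Lemma cexp_damped (z : R[i]) (s : R) : cexp (- s%:C%C * z) =
  Complex (damped_cos (complex.Re z) (complex.Im z) s)
    (- damped_sin (complex.Re z) (complex.Im z) s).
Proof.
case: z => a b; rewrite /cexp /damped_cos /damped_sin /=.
rewrite !oppr0 !mul0r subr0 addr0.
apply/eqP; rewrite eq_complex /= !mul0r subr0 addr0.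
have -> : - s * a = - a * s by ring.
have -> : - s * b = - (b * s) by ring.
by rewrite cosN sinN mulrN !eqxx.
Qed.

Lemma integrable_inv1D : mu.-integrable `]0, +oo[ (EFin \o (fun s : R => (1 + s)^-1)).
Proof.
apply/integrableP; split.
  apply/measurable_EFinP; apply: measurable_funTS.
  by apply: (measurableT_comp (@measurable_inv R)); exact: measurable_funD.
apply: le_lt_trans muS; rewrite le_eqVlt; apply/orP; left; apply/eqP.
apply: eq_integral => s /set_mem /=; rewrite in_itv /= andbT => s0.
by rewrite gtr0_norm // invr_gt0 addr_gt0.
Qed.

Lemma inv_le_inv1D (a s : R) : 0 < a -> 0 < s -> (s + a)^-1 <= (1 + a^-1) * (1 + s)^-1.
Proof.
move=> a0 s0; rewrite ler_pdivlMr ?addr_gt0 // mulrC ler_pdivrMr ?addr_gt0 //.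
have -> : (1 + a^-1) * (s + a) = s + a + a^-1 * s + 1 by field; rewrite gt_eqF.
have : 0 < a^-1 * s by rewrite mulr_gt0 ?invr_gt0.
lra.
Qed.

(** The real and imaginary parts of 1 / (z + s) are at most 1 / (s + a) in absolute value; for the
    imaginary part this is |b| (s + a) <= (s + a)^2 + b^2. *)
Lemma integrable_stieltjes_kernel a b : 0 < a ->
  mu.-integrable `]0, +oo[ (EFin \o (fun s : R => (s + a) / ((s + a) ^+ 2 + b ^+ 2))) /\
  mu.-integrable `]0, +oo[ (EFin \o (fun s : R => b / ((s + a) ^+ 2 + b ^+ 2))).
Proof.
move=> a0.
have iK : mu.-integrable `]0, +oo[ (EFin \o (fun s : R => (1 + a^-1) * (1 + s)^-1)).
  by apply: rintegrableZ => //; exact: integrable_inv1D.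
have msa : measurable_fun [set: R] (fun s : R => s + a) by exact: measurable_funD.
have mn : measurable_fun [set: R] (fun s : R => ((s + a) ^+ 2 + b ^+ 2)^-1).
  apply: (measurableT_comp (@measurable_inv R)); apply: measurable_funD => //.
  exact: measurable_funX.
have n0 s : 0 < s -> 0 < (s + a) ^+ 2 + b ^+ 2.
  by move=> s0; rewrite ltr_wpDr ?sqr_ge0 // exprn_gt0 // addr_gt0.
have K0 s : 0 < s -> 0 <= (1 + a^-1) * (1 + s)^-1.
  by move=> s0; rewrite mulr_ge0 ?addr_ge0 ?invr_ge0 ?addr_ge0 // ltW.
have bound c s : 0 < s -> c * (s + a) <= (s + a) ^+ 2 + b ^+ 2 ->
    c / ((s + a) ^+ 2 + b ^+ 2) <= (1 + a^-1) * (1 + s)^-1.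
  move=> s0 cs; apply: le_trans (inv_le_inv1D a0 s0).
  by rewrite ler_pdivrMr ?n0 // mulrC ler_pdivlMr ?addr_gt0.
split.
  apply: (le_integrable _ _ _ iK) => //.
    apply/measurable_EFinP; apply: measurable_funTS; exact: measurable_funM.
  move=> s; rewrite /= in_itv /= andbT => s0.
  rewrite lee_fin (ger0_norm (K0 _ s0)) ger0_norm; last first.
    by apply: divr_ge0; [exact: addr_ge0 (ltW s0) (ltW a0)|exact: ltW (n0 _ s0)].
  by apply: bound => //; have := sqr_ge0 b; lra.
apply: (le_integrable _ _ _ iK) => //.
  apply/measurable_EFinP; apply: measurable_funTS; exact: measurable_funM.
move=> s; rewrite /= in_itv /= andbT => s0.
rewrite lee_fin (ger0_norm (K0 _ s0)) normrM (gtr0_norm (x := _^-1)) ?invr_gt0 ?n0 //.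
apply: bound => //; rewrite -(real_normK (num_real b)).
by have := sqr_ge0 (s + a - `|b|); have := sqr_ge0 (s + a); have := sqr_ge0 `|b|; nra.
Qed.

Lemma Rintegral_mzero (D : set (measurableTypeR R)) (f : R -> R) :
  \int[(mzero : {finite_measure set (measurableTypeR R) -> \bar R})]_(t in D) f t = 0.
Proof. by rewrite /Rintegral integral_measure_zero. Qed.

Lemma Rintegral_dirac0 (f : R -> R) : measurable_fun setT f ->
  \int[dirac (0 : measurableTypeR R)]_(t in `[0, +oo[) f t = f 0.
Proof.
move=> mf; rewrite /Rintegral integral_dirac //; last first.
  by apply/measurable_EFinP; exact: measurable_funTS.
by rewrite diracE mem_set ?mul1e //= in_itv /= lexx.
Qed.

Lemma Rintegral_exponential_halfline (f : R -> R) : bounded_measurable (fun t : R => f `|t|) ->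
  \int[E]_(t in `[0, +oo[) f t = \int[E]_v f (`|v| / 1).
Proof.
move=> bf.
have transfer (F : R -> R) : bounded_measurable F ->
    \int[E]_v F v = \int[lebesgue_measure]_(v in `[0, +oo[) (expR (-1 * v) * F v).
  move=> bF; apply: (proj2 (@Rintegral_transfer _ _ _ (measurableTypeR R) (measurableTypeR R) E
    lebesgue_measure `[0%R, +oo[ id (fun v => expR (-1 * v)) _ _ _ _ _ F bF)) => //.
  - by apply: measurable_funTS; exact: measurable_expRM.
  - move=> G mG G0; rewrite HE.2 //; last first.
    + exact/measurable_EFinP.
    by apply: eq_integral => v _; rewrite mulN1r EFinM.
have -> : \int[E]_v f (`|v| / 1) = \int[E]_v f `|v| by apply: eq_Rintegral => v _; rewrite divr1.
rewrite (transfer _ bf) Rintegral_mkcond.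
have e : f \_ `[0, +oo[ = (fun t => f `|t|) \_ `[0, +oo[.
  apply/funext => t; rewrite !patchE; case: ifP => // /set_mem /=.
  by rewrite in_itv /= andbT => t0; rewrite ger0_norm.
have bf' : bounded_measurable (T := measurableTypeR R) ((fun t => f `|t|) \_ `[0, +oo[).
  exact: bounded_measurable_patch.
by rewrite e (transfer _ bf'); apply: eq_Rintegral => v Dv; rewrite patchE Dv.
Qed.


Lemma integrable_halfline (m : {finite_measure set (measurableTypeR R) -> \bar R}) (f : R -> R) :
  bounded_measurable (fun t : R => f `|t|) -> m.-integrable `[0%R, +oo[ (EFin \o f).
Proof.
move=> bf; have := bounded_measurable_integrable m (measurable_itv `[0%R, +oo[) bf.
apply: eq_integrable => [|t /set_mem /=]; first exact: measurable_itv.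
by rewrite in_itv /= andbT => t0; rewrite ger0_norm.
Qed.

Lemma laplace_real (m1 m2 : {finite_measure set (measurableTypeR R) -> \bar R}) (z : R[i]) :
  0 <= complex.Re z ->
  let c := damped_cos (complex.Re z) (complex.Im z) in
  let s := damped_sin (complex.Re z) (complex.Im z) in
  laplace (CMeasure m1 m2 mzero mzero) z =
  Complex (\int[m1]_(t in `[0, +oo[) c t - \int[m2]_(t in `[0, +oo[) c t)
    (- (\int[m1]_(t in `[0, +oo[) s t - \int[m2]_(t in `[0, +oo[) s t)).
Proof.
move=> a0 c s; rewrite /laplace /=.
have I (m : {finite_measure set (measurableTypeR R) -> \bar R}) :
    cintegral m `[0, +oo[ (fun s => cexp (- (s : R)%:C%C * z)) =
    Complex (\int[m]_(t in `[0, +oo[) c t) (- \int[m]_(t in `[0, +oo[) s t).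
  rewrite /cintegral; congr Complex.
    by apply: eq_Rintegral => t _; rewrite cexp_damped.
  rewrite -mulN1r -RintegralZl //; last by apply: integrable_halfline; exact: bounded_damped_sin.
  by apply: eq_Rintegral => t _; rewrite cexp_damped mulN1r.
rewrite !I !Rintegral_mzero.
by apply/eqP; rewrite eq_complex /=; apply/andP; split; apply/eqP; ring.
Qed.

Lemma integrable_damped a b s : 0 <= a -> 0 < s ->
  E.-integrable setT (EFin \o (fun v => damped_cos a b (`|v| / s))) /\
  E.-integrable setT (EFin \o (fun v => damped_sin a b (`|v| / s))).
Proof.
move=> a0 s0; have bc := bounded_damped_cos b a0; have bs := bounded_damped_sin b a0.
split.
  have := bounded_measurable_integrable E measurableT (bounded_measurable_normdiv s bc).
  by apply: eq_integrable => // v _ /=; rewrite (ger0_norm (_ : 0 <= `|v| / s)) // divr_ge0 // ltW.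
have := bounded_measurable_integrable E measurableT (bounded_measurable_normdiv s bs).
by apply: eq_integrable => // v _ /=; rewrite (ger0_norm (_ : 0 <= `|v| / s)) // divr_ge0 // ltW.
Qed.

(** With L(s) = E[e^(- z v / s)] = C s - i S s, multiplicativity of the exponential factors the
    defect of e^(- z t) as (1 - L(1)) L(s); the two equalities are its real part and the opposite of
    its imaginary part. *)
Lemma resolvent_defect_damped a b s : 0 <= a -> 0 < s ->
  let C := fun c => \int[E]_v damped_cos a b (`|v| / c) in
  let S := fun c => \int[E]_v damped_sin a b (`|v| / c) in
  resolvent_defect E (damped_cos a b) s = (1 - C 1) * C s + S 1 * S s /\
  resolvent_defect E (damped_sin a b) s = (1 - C 1) * S s - S 1 * C s.
Proof.
move=> a0 s0 C S; have [ic iss] := integrable_damped b a0 s0.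
have [ic1 is1] := integrable_damped b a0 ltr01.
have E1 (f : R -> R) : \int[E]_t f `|t| = \int[E]_t f (`|t| / 1).
  by apply: eq_Rintegral => t _; rewrite divr1.
rewrite /resolvent_defect; split.
  have -> : \int[E]_t \int[E]_v damped_cos a b (`|t| + `|v| / s) =
      \int[E]_t (damped_cos a b (`|t| / 1) * C s - damped_sin a b (`|t| / 1) * S s).
    apply: eq_Rintegral => t _; rewrite divr1.
    under eq_Rintegral do rewrite damped_cosD.
    by rewrite RintegralB ?RintegralZl //; exact: rintegrableZ.
  rewrite RintegralB ?RintegralZr //; try exact: rintegrableZr.
  by rewrite -/(C s) -/(C 1) -/(S 1); ring.
have -> : \int[E]_t \int[E]_v damped_sin a b (`|t| + `|v| / s) =
    \int[E]_t (damped_sin a b (`|t| / 1) * C s + damped_cos a b (`|t| / 1) * S s).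
  apply: eq_Rintegral => t _; rewrite divr1.
  under eq_Rintegral do rewrite damped_sinD.
  by rewrite RintegralD ?RintegralZl //; exact: rintegrableZ.
rewrite RintegralD ?RintegralZr //; try exact: rintegrableZr.
by rewrite -/(S s) -/(C 1) -/(S 1); ring.
Qed.

(** The factor 1 - L(1) of the defect is the transform of the regularizer and leaves the
    mu-integral; what stays inside, L(s) / s, is 1 / (z + s). *)
Lemma laplace_regularized (rp rn : {finite_measure set (measurableTypeR R) -> \bar R}) z :
  (forall f : R -> R, bounded_measurable (fun t : R => f `|t|) ->
  \int[rp]_(t in `[0, +oo[) f t - \int[rn]_(t in `[0, +oo[) f t =
    \int[mu]_(s in `]0, +oo[) (s^-1 * resolvent_defect E f s)) ->
  0 < complex.Re z ->
  laplace (CMeasure rp rn mzero mzero) z = laplace regularizer z * stieltjesC mu z.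
Proof.
move=> H a0; set a := complex.Re z; set b := complex.Im z.
have bc := bounded_damped_cos b (ltW a0); have bs := bounded_damped_sin b (ltW a0).
rewrite !laplace_real ?(ltW a0) // -/a -/b !H //.
rewrite !Rintegral_exponential_halfline //.
rewrite !Rintegral_dirac0; last 2 first.
- by apply: continuous_measurable_fun; exact: continuous_damped_sin.
- by apply: continuous_measurable_fun; exact: continuous_damped_cos.
pose C c := \int[E]_v damped_cos a b (`|v| / c).
pose S c := \int[E]_v damped_sin a b (`|v| / c).
have pos (s : R) : s \in `]0, +oo[%classic -> 0 < s by move/set_mem; rewrite /= in_itv /= andbT.
have [i1 i2] := integrable_stieltjes_kernel b a0.
have iC : mu.-integrable `]0, +oo[ (EFin \o (fun s : R => s^-1 * C s)).
  apply: eq_integrable i1 => // s /pos s0; rewrite /= /C.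
  by have [-> _] := exponential_damped_values b (ltW a0) s0; rewrite mulKf ?gt_eqF.
have iS : mu.-integrable `]0, +oo[ (EFin \o (fun s : R => s^-1 * S s)).
  apply: eq_integrable i2 => // s /pos s0; rewrite /= /S.
  by have [_ ->] := exponential_damped_values b (ltW a0) s0; rewrite mulKf ?gt_eqF.
have -> : stieltjesC mu z = Complex (\int[mu]_(s in `]0, +oo[) (s^-1 * C s))
    (- \int[mu]_(s in `]0, +oo[) (s^-1 * S s)).
  rewrite /stieltjesC /cintegral; congr Complex.
    by apply: eq_Rintegral => s /pos s0; rewrite stieltjes_kernelE.
  rewrite -mulN1r -RintegralZl //; apply: eq_Rintegral => s /pos s0.
  by rewrite stieltjes_kernelE // mulN1r.
have -> : \int[mu]_(s in `]0, +oo[) (s^-1 * resolvent_defect E (damped_cos a b) s) =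
    (1 - C 1) * \int[mu]_(s in `]0, +oo[) (s^-1 * C s) +
    S 1 * \int[mu]_(s in `]0, +oo[) (s^-1 * S s).
  rewrite -!RintegralZl // -RintegralD //; try exact: rintegrableZ.
  apply: eq_Rintegral => s /pos s0.
  by have [-> _] := resolvent_defect_damped b (ltW a0) s0; rewrite -/(C 1) -/(C s) -/(S 1) -/(S s); ring.
have -> : \int[mu]_(s in `]0, +oo[) (s^-1 * resolvent_defect E (damped_sin a b) s) =
    (1 - C 1) * \int[mu]_(s in `]0, +oo[) (s^-1 * S s) -
    S 1 * \int[mu]_(s in `]0, +oo[) (s^-1 * C s).
  rewrite -!RintegralZl // -RintegralB //; try exact: rintegrableZ.
  apply: eq_Rintegral => s /pos s0.
  by have [_ ->] := resolvent_defect_damped b (ltW a0) s0; rewrite -/(C 1) -/(C s) -/(S 1) -/(S s); ring.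
rewrite -/(C 1) -/(S 1) /damped_cos /damped_sin !mulr0 expR0 cos0 sin0.
by apply/eqP; rewrite eq_complex /=; apply/andP; split; apply/eqP; ring.
Qed.

End laplace_regularized.

(** * Bounded semigroups *)

Section exponential_shift.
Context (R : realType).
Notation lambda := (@lebesgue_measure R).
Context (E : {finite_measure set (measurableTypeR R) -> \bar R}) (HE : exponential_law E).

(** The variable v / s + h has density e^(s h) s e^(- s u) on [h, +oo[; the inequality only adds the
    missing interval [0, h[. *)
Lemma exponential_shift_le (G : R -> R) s h : 0 < s -> 0 <= h -> bounded_measurable G ->
  (forall t, 0 <= G t) ->
  \int[E]_v G (`|v| / s + h) <= expR (s * h) * \int[E]_v G (`|v| / s).
Proof.
move=> s0 h0 bG G0; have mG := proj1 bG.
have mh : measurable_fun [set: R] (fun u : R => u + h) by exact: measurable_funD.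
have bGh := bounded_measurable_comp mh bG.
rewrite -lee_fin EFinM !EFin_Rintegral; last 2 first.
- exact: bounded_measurable_normdiv.
- exact: (bounded_measurable_normdiv s bGh).
rewrite (exponential_scale HE s0 (proj1 bGh)) //.
rewrite (exponential_scale HE s0 mG) //.
pose b u := expR (s * h) * (s * expR (- s * u) * G u).
have b0 u : 0 <= b u by rewrite !mulr_ge0 ?expR_ge0 // ltW.
have mb : measurable_fun setT b.
  apply: measurable_funM => //; apply: measurable_funM => //.
  by apply: measurable_funM => //; exact: measurable_expRM.
have -> : (\int[lambda]_(u in `[0%R, +oo[) (s * expR (- s * u) * G (u + h))%:E =
    \int[lambda]_(u in `[0%R, +oo[) (b (h + u)%R)%:E)%E.
  apply: eq_integral => u _; congr EFin; rewrite /b addrC !mulrA; congr (_ * _).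
  have -> : expR (- s * u) = expR (s * h) * expR (- s * (h + u)).
    by rewrite -expRD; congr expR; ring.
  by ring.
rewrite ge0_integral_shift // -ge0_integralZl_EFin ?expR_ge0 //; last 2 first.
- by move=> u _; rewrite lee_fin !mulr_ge0 ?expR_ge0 // ltW.
- apply/measurable_EFinP; apply: measurable_funTS; apply: measurable_funM => //.
  by apply: measurable_funM => //; exact: measurable_expRM.
apply: ge0_subset_integral => //.
- by apply/measurable_EFinP; exact: measurable_funTS.
- by move=> u _; rewrite lee_fin.
- by move=> u; rewrite /= !in_itv /= !andbT; exact: le_trans.
Qed.

End exponential_shift.

Section semigroup.
Context (R : realType) (X : completeNormedModType R[i]).
Context (T : R -> {linear X -> X}) (M : R).
Notation lambda := (@lebesgue_measure R).
Hypothesis T0 : forall x, T 0 x = x.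
Hypothesis TD : forall s t x, 0 <= s -> 0 <= t -> T (s + t) x = T s (T t x).
Hypothesis Tcont : forall x, T t x @[t --> 0^'+] --> x.
Hypothesis M0 : 0 <= M.
Hypothesis TM : forall t x, 0 <= t -> rnorm (T t x) <= M * rnorm x.

Lemma semigroup_diff (x : X) (s t : R) : 0 <= s -> 0 <= t ->
  rnorm (T t x - T s x) <= M * rnorm (T `|t - s| x - x).
Proof.
wlog st : s t / s <= t => [H s0 t0|s0 t0].
  have [st|/ltW ts] := leP s t; first exact: H.
  by rewrite rnormB distrC; exact: H.
have ts : 0 <= t - s by rewrite subr_ge0.
by rewrite (ger0_norm ts) -{1}(subrKC s t) TD // -linearB TM.
Qed.

(** [semigroup_diff] reduces continuity everywhere to the limit at 0+. That limit says nothing at 0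
    itself, hence the separate case of equal moduli; M + 1 avoids a division by zero. *)
Lemma orbit_continuous (x : X) : continuous (fun t : R => T `|t| x).
Proof.
move=> t; apply/cvg_rnormP/cvgrPdist_lt => e e0.
have M1 : 0 < M + 1 by rewrite ltr_wpDl.
have /cvg_rnormP/cvgrPdist_lt/(_ _ (divr_gt0 e0 M1)) := @Tcont x.
move=> [d /= d0 H]; exists d => //= s /= ts.
rewrite sub0r normrN ger0_norm ?rnorm_ge0 //.
apply: (le_lt_trans (semigroup_diff x (normr_ge0 s) (normr_ge0 t))).
have [->|ne] := eqVneq `| `|t| - `|s| | 0.
  by rewrite T0 subrr rnorm0 mulr0.
have h : 0 < `| `|t| - `|s| | by rewrite lt_def ne normr_ge0.
have : rnorm (T `| `|t| - `|s| | x - x) < e / (M + 1).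
  have := H `| `|t| - `|s| |; rewrite /= !sub0r !normrN normr_id rnormB.
  rewrite (ger0_norm (rnorm_ge0 _)); apply => //.
  by apply: le_lt_trans ts; exact: ler_dist_dist.
rewrite ltr_pdivlMr // => H1; apply: le_lt_trans H1.
by rewrite mulrC ler_wpM2l ?rnorm_ge0 // lerDl.
Qed.

(* The absolute value extends the orbit to a continuous function on the line. *)
Definition pairing (phi : X -> R) (x : X) (t : R) : R := phi (T `|t| x).

Section pairing.
Context (phi : X -> R) (C : R) (C0 : 0 <= C) (phil : rlinear phi) (phib : rbounded C phi).

Lemma pairing_le x t : `|pairing phi x t| <= C * (M * rnorm x).
Proof. by rewrite (le_trans (phib _)) // ler_wpM2l // TM. Qed.

Lemma continuous_pairing x : continuous (pairing phi x).
Proof. by move=> t; exact: (rbounded_cvg phil phib (@orbit_continuous x t)). Qed.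

Lemma bounded_measurable_pairing x : bounded_measurable (pairing phi x).
Proof.
split; last by exists (C * (M * rnorm x)) => t; exact: pairing_le.
by apply: continuous_measurable_fun; exact: continuous_pairing.
Qed.

Lemma pairing_norm x t : pairing phi x `|t| = pairing phi x t.
Proof. by rewrite /pairing normr_id. Qed.

Lemma bounded_measurable_pairing_norm x : bounded_measurable (fun t : R => pairing phi x `|t|).
Proof.
have := bounded_measurable_pairing x; congr bounded_measurable.
by apply/funext => t; rewrite pairing_norm.
Qed.

Lemma bochner_pairing (m : {measure set (measurableTypeR R) -> \bar R})
    (D : set (measurableTypeR R)) x : measurable D -> (m D < +oo)%E ->
  D `<=` [set t | 0 <= t] ->
  phi (bochner m D (fun t => T t x)) = \int[m]_(t in D) pairing phi x t.
Proof.
move=> mD Doo D0; apply: (bochner_rlinear mD Doo D0 (@orbit_continuous x) (K := M * rnorm x) _ _ C0) => //.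
  by move=> t _; exact: TM.
by move=> t /set_mem /D0 t0; rewrite ger0_norm.
Qed.

Lemma bochner_halfline_pairing (m : {finite_measure set (measurableTypeR R) -> \bar R}) x :
  phi (bochner m `[0, +oo[ (fun t => T t x)) = \int[m]_(t in `[0, +oo[) pairing phi x t.
Proof.
apply: bochner_pairing => //; first by rewrite ltey_eq fin_num_measure.
by move=> t /=; rewrite in_itv /= andbT.
Qed.

Lemma bochner_itv_pairing (r : R) x :
  phi (bochner lambda `[0, r] (fun t => T t x)) = \int[lambda]_(t in `[0, r]) pairing phi x t.
Proof.
apply: bochner_pairing => //.
  by rewrite /= lebesgue_measure_itv; case: ifP => _ //; rewrite -EFinB ltry.
by move=> t /=; rewrite in_itv /= => /andP[].
Qed.

End pairing.

Lemma rbounded_comp phi C u : 0 <= C -> rbounded C phi -> 0 <= u -> rbounded (C * M) (phi \o T u).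
Proof. by move=> C0 phib u0 v /=; rewrite (le_trans (phib _)) // -mulrA ler_wpM2l // TM. Qed.

Lemma rlinear_comp phi u : rlinear phi -> rlinear (phi \o T u).
Proof.
move=> phil; split=> [v w|r v] /=; first by rewrite linearD (rlinearD phil).
by rewrite linearZ /= (rlinearZ phil).
Qed.

Lemma pairing_comp phi u x t : 0 <= u -> pairing (phi \o T u) x t = pairing phi x (u + `|t|).
Proof. by move=> u0; rewrite /pairing /= -TD // (ger0_norm (addr_ge0 u0 (normr_ge0 t))). Qed.

Lemma pairing_T phi u x t : 0 <= u -> pairing phi (T u x) t = pairing phi x (`|t| + u).
Proof. by move=> u0; rewrite /pairing /= -TD // (ger0_norm (addr_ge0 (normr_ge0 t) u0)). Qed.

Lemma hp_bounded_pairing phi C (m1 m2 : {finite_measure set (measurableTypeR R) -> \bar R}) x :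
  0 <= C -> rlinear phi -> rbounded C phi ->
  phi (hp_bounded T (CMeasure m1 m2 mzero mzero) x) =
  \int[m1]_(t in `[0, +oo[) pairing phi x t - \int[m2]_(t in `[0, +oo[) pairing phi x t.
Proof.
move=> C0 phil phib; rewrite /hp_bounded /=.
have z : bochner (mzero : {finite_measure set (measurableTypeR R) -> \bar R}) `[0, +oo[ (fun s => T s x) = 0.
  apply: rfunctional_separates => psi psil psib.
  by rewrite (bochner_halfline_pairing ler01 psil psib) Rintegral_mzero rlinear0.
by rewrite z subrr scaler0 addr0 rlinearB // !(bochner_halfline_pairing C0 phil phib).
Qed.

(** * Injectivity of the regularizer *)

Section injectivity.
Context (E : {finite_measure set (measurableTypeR R) -> \bar R}) (HE : exponential_law E).

Lemma regularizer_pairing phi C x : 0 <= C -> rlinear phi -> rbounded C phi ->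
  phi (hp_bounded T (regularizer E) x) = phi x - \int[E]_v pairing phi x v.
Proof.
move=> C0 phil phib; have bx := bounded_measurable_pairing C0 phil phib x.
rewrite (hp_bounded_pairing _ _ _ C0 phil phib) Rintegral_dirac0; last by case: bx.
rewrite (Rintegral_exponential_halfline HE); last exact: (bounded_measurable_pairing_norm C0 phil phib).
rewrite {1}/pairing normr0 T0; congr (_ - _).
by apply: eq_Rintegral => v _; rewrite divr1 pairing_norm.
Qed.

(** The hypothesis says that w = (1 + A)^-1 w. Applied to phi o T u after Fubini, it turns the
    resolvent identity into P = s phi(w) + (1 - s) P for P the average at v / s. *)
Lemma resolvent_fixed (w : X) :
  (forall phi C, 0 <= C -> rlinear phi -> rbounded C phi -> phi w = \int[E]_v pairing phi w v) ->
  forall phi s, rlinear phi -> rbounded 1 phi -> 0 < s <= 1 ->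
  \int[E]_v pairing phi w (`|v| / s) = phi w.
Proof.
move=> wE phi s phil phib s01; have s0 : 0 < s by case/andP: s01.
have bw := bounded_measurable_pairing ler01 phil phib w.
have b3 := bounded_measurable_exponential_arg s bw.
have := resolvent_identity HE s01 bw.
have -> : \int[E]_v pairing phi w `|v| = phi w.
  rewrite [RHS](wE _ _ ler01 phil phib); apply: eq_Rintegral => v _.
  by rewrite pairing_norm.
rewrite (RFubini E E b3).
have -> : \int[E]_v \int[E]_t pairing phi w (`|t| + `|v| / s) = \int[E]_v pairing phi w (`|v| / s).
  apply: eq_Rintegral => v _; have u0 : 0 <= `|v| / s by rewrite divr_ge0 // ltW.
  have C0 : 0 <= 1 * M by rewrite mul1r.
  transitivity (phi (T (`|v| / s) w)); last by rewrite /pairing [in RHS](ger0_norm u0).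
  rewrite [RHS](wE _ _ C0 (rlinear_comp _ phil) (rbounded_comp ler01 phib u0)).
  by apply: eq_Rintegral => t _; rewrite pairing_comp // addrC.
move: (Rintegral _ _ _) => I HI; apply: (@mulfI _ s); [by rewrite gt_eqF|lra].
Qed.

Lemma pairing_integrable phi C x (p : R -> R) : 0 <= C -> rlinear phi -> rbounded C phi ->
  measurable_fun setT p ->
  E.-integrable setT (EFin \o (fun v => pairing phi x (p v))).
Proof.
move=> C0 phil phib mp; apply: bounded_measurable_integrable => //.
exact: (bounded_measurable_comp mp (bounded_measurable_pairing C0 phil phib x)).
Qed.

Lemma pairingB phi x y t : rlinear phi ->
  pairing phi (x - y) t = pairing phi x t - pairing phi y t.
Proof. by move=> phil; rewrite /pairing linearB (rlinearB phil). Qed.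

Lemma Rintegral_pairing_le phi C x (p : R -> R) : 0 <= C -> rlinear phi -> rbounded C phi ->
  measurable_fun setT p ->
  \int[E]_v pairing phi x (p v) <= C * (M * rnorm x).
Proof.
move=> C0 phil phib mp; rewrite -[leRHS](Rintegral_exponential_cst HE).
apply: le_Rintegral => //; first exact: (pairing_integrable _ C0 phil phib mp).
  by apply: bounded_measurable_integrable => //; exact: bounded_measurable_cst.
by move=> v _; apply: le_trans (pairing_le C0 phib x (p v)); exact: ler_norm.
Qed.

Lemma measurable_normdiv s h : measurable_fun [set: measurableTypeR R] (fun v : R => `|v| / s + h).
Proof. by apply: measurable_funD => //; exact: measurable_funM. Qed.

(** The shift inequality concerns nonnegative functions, so it is applied to K - pairing with K a
    bound of the pairing; the average of that difference is at most 2 K. *)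
Lemma exponential_pairing_diff phi u s h : 0 < s -> 0 <= h -> rlinear phi -> rbounded 1 phi ->
  \int[E]_v pairing phi u (`|v| / s) - \int[E]_v pairing phi u (`|v| / s + h) <=
  (expR (s * h) - 1) * (2 * (M * rnorm u)).
Proof.
move=> s0 h0 phil phib; set K := M * rnorm u.
have ms : measurable_fun [set: R] (fun v : R => `|v| / s) by exact: measurable_funM.
have mh := measurable_normdiv s h.
have iK : E.-integrable setT (EFin \o (fun _ => K)).
  by apply: bounded_measurable_integrable => //; exact: bounded_measurable_cst.
have bG : bounded_measurable (fun t : R => K - pairing phi u t).
  apply: bounded_measurableB; first exact: bounded_measurable_cst.
  exact: (bounded_measurable_pairing ler01 phil phib).
have pK t : `|pairing phi u t| <= K.
  by have := pairing_le ler01 phib u t; rewrite mul1r.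
have G0 t : 0 <= K - pairing phi u t.
  by rewrite subr_ge0; apply: le_trans (pK t); exact: ler_norm.
have := exponential_shift_le HE s0 h0 bG G0.
have i1 := pairing_integrable u ler01 phil phib ms.
have i2 := pairing_integrable u ler01 phil phib mh.
rewrite !RintegralB // !(Rintegral_exponential_cst HE).
have : - K <= \int[E]_v pairing phi u (`|v| / s).
  rewrite -[leLHS](Rintegral_exponential_cst HE); apply: le_Rintegral => //.
    by apply: bounded_measurable_integrable => //; exact: bounded_measurable_cst.
  by move=> v _; have := pK (`|v| / s); rewrite ler_norml => /andP[].
have e1 : 0 <= expR (s * h) - 1 by rewrite subr_ge0 -expR0 ler_expR mulr_ge0 // ltW.
move: (\int[E]_v pairing phi u (`|v| / s)) => I1.
move: (\int[E]_v pairing phi u (`|v| / s + h)) => I2 H1 H2.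
have : (expR (s * h) - 1) * (K - I1) <= (expR (s * h) - 1) * (2 * K).
  by rewrite ler_wpM2l //; lra.
move: H2; move: (expR (s * h)) => e; lra.
Qed.

Lemma exists_small_scale (h K e : R) : 0 < e -> exists2 s, 0 < s <= 1 & (expR (s * h) - 1) * K <= e.
Proof.
move=> e0.
have : (expR (h * s) - 1) * K @[s --> (0 : R)] --> (expR (h * 0) - 1) * K.
  apply: cvgM; last exact: cvg_cst.
  by apply: cvgB; [exact: continuous_expRM|exact: cvg_cst].
rewrite mulr0 expR0 subrr mul0r => /cvgrPdist_lt/(_ _ e0)[d /= d0 H].
set m := Num.min (d / 2) 1.
have m0 : 0 < m by rewrite lt_min divr_gt0 // ltr01.
exists m; first by rewrite m0 ge_min lexx orbT.
have Hm : `|0 - m| < d.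
  rewrite sub0r normrN gtr0_norm //; apply: (@le_lt_trans _ _ (d / 2)).
    by rewrite ge_min lexx.
  by rewrite ltr_pdivrMr // ltr_pMr // ltr1n.
have := H m Hm; rewrite /= sub0r normrN [m * h]mulrC => /ltW; apply: le_trans.
exact: ler_norm.
Qed.

(** A vector A u close to w is replaced by v = - (T h u - u) / h, so that the average of v is a
    difference of two averages of u, one shifted by h. The constant adds 2 M e, from |w - v| <= 2 e,
    and e, from the choice of s. *)
Lemma resolvent_fixed_eq0 (A : set (X * X)) (w : X) :
  opp_op A = generator T -> closure (ran A) = setT ->
  (forall phi C, 0 <= C -> rlinear phi -> rbounded C phi -> phi w = \int[E]_v pairing phi w v) ->
  w = 0.
Proof.
move=> AT ranA wE.
suff H e : 0 < e -> rnorm w <= (M + M + 1) * e.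
  apply: rnorm_eq0; apply/eqP; rewrite eq_le rnorm_ge0 andbT leNgt; apply/negP => w0.
  have M1 : 0 < M + M + 1 by rewrite ltr_wpDl // addr_ge0.
  have e1 : 0 < rnorm w / 2 / (M + M + 1) by rewrite !divr_gt0.
  have := H _ e1; rewrite [leRHS]mulrC divfK ?gt_eqF //.
  by rewrite leNgt ltr_pdivrMr // ltr_pMr // ltr1n.
move=> e0.
have e0' : (0 : R[i]) < e%:C%C by rewrite ltcR.
have : closure (ran A) w by rewrite ranA.
move=> /(_ _ (nbhsx_ballx w _ e0'))[z [[u Auz] wz]].
have {}wz : rnorm (w - z) < e by rewrite -ltcR rnormC; move: wz; rewrite -ball_normE.
have : generator T (u, - z) by rewrite -AT /opp_op /= opprK.
rewrite /generator /= => /cvg_rnormP/cvgrPdist_lt/(_ _ e0)[d /= d0 Hd].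
pose h := d / 2; have h0 : 0 < h by rewrite divr_gt0.
have hz : rnorm (- z - (h^-1)%:C%C *: (T h u - u)) < e.
  have := Hd h; rewrite /= !sub0r !normrN (ger0_norm (rnorm_ge0 _)); apply => //.
  by rewrite gtr0_norm // ltr_pdivrMr // ltr_pMr // ltr1n.
pose v := (- h^-1)%:C%C *: (T h u - u).
have wv : rnorm (w - v) <= e + e.
  have -> : w - v = (w - z) - (- z - (h^-1)%:C%C *: (T h u - u)).
    by rewrite /v rmorphN scaleNr opprK opprB opprK addrA addrAC subrK.
  by rewrite (le_trans (rnormD _ _)) // rnormN lerD // ltW.
(* The scale s is chosen after u and h: the division by h is harmless because e^(s h) - 1 tends to 0
   with s for fixed h. *)
have [s /andP[s0 s1] se] := exists_small_scale h (2 * (M * rnorm u) / h) e0.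
have [phi [phil phib phiw]] := norming_functional w.
have ms : measurable_fun [set: R] (fun v : R => `|v| / s) by exact: measurable_funM.
rewrite -phiw -(resolvent_fixed wE phil phib (s := s)) ?s0 //.
have -> : \int[E]_t pairing phi w (`|t| / s) =
    \int[E]_t pairing phi (w - v) (`|t| / s) + \int[E]_t pairing phi v (`|t| / s).
  rewrite -RintegralD //; try exact: (pairing_integrable _ ler01 phil phib ms).
  by apply: eq_Rintegral => t _; rewrite pairingB // subrK.
have -> : \int[E]_t pairing phi v (`|t| / s) = h^-1 *
    (\int[E]_t pairing phi u (`|t| / s) - \int[E]_t pairing phi u (`|t| / s + h)).
  have mh := measurable_normdiv s h.
  have i1 := pairing_integrable u ler01 phil phib ms.
  have i2 := pairing_integrable u ler01 phil phib mh.
  rewrite -RintegralB // -RintegralZl //; last exact: rintegrableB.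
  apply: eq_Rintegral => t _; have t0 : 0 <= `|t| / s by rewrite divr_ge0 // ltW.
  rewrite /v {1}/pairing linearZ /= (rlinearZ phil) linearB (rlinearB phil).
  rewrite -/(pairing phi (T h u) _) -/(pairing phi u _) pairing_T ?(ltW h0) // (ger0_norm t0).
  by rewrite mulNr -mulrN opprB.
have b1 := Rintegral_pairing_le (w - v) ler01 phil phib ms.
have b2 := exponential_pairing_diff u s0 (ltW h0) phil phib.
have b3 : M * rnorm (w - v) <= M * (e + e) by rewrite ler_wpM2l.
have b4 := ler_wpM2l (ltW (_ : 0 < h^-1)) b2.
have hi : 0 < h^-1 by rewrite invr_gt0.
have {b4} := b4 hi; move: se b1 b3; rewrite mul1r.
have -> : h^-1 * ((expR (s * h) - 1) * (2 * (M * rnorm u))) =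
  (expR (s * h) - 1) * (2 * (M * rnorm u) / h) by ring.
lra.
Qed.

Lemma Rintegral_pairingB phi C x y : 0 <= C -> rlinear phi -> rbounded C phi ->
  \int[E]_v pairing phi (x - y) v = \int[E]_v pairing phi x v - \int[E]_v pairing phi y v.
Proof.
move=> C0 phil phib.
have ix := pairing_integrable x C0 phil phib (@measurable_id _ _ setT).
have iy := pairing_integrable y C0 phil phib (@measurable_id _ _ setT).
by rewrite -RintegralB //; apply: eq_Rintegral => v _; rewrite pairingB.
Qed.

Lemma regularizer_injective (A : set (X * X)) :
  opp_op A = generator T -> closure (ran A) = setT -> injective (hp_bounded T (regularizer E)).
Proof.
move=> AT ranA x y xy; apply/eqP; rewrite -subr_eq0; apply/eqP.
apply: (resolvent_fixed_eq0 AT ranA) => phi C C0 phil phib.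
have := regularizer_pairing x C0 phil phib; rewrite xy (regularizer_pairing y C0 phil phib).
rewrite (Rintegral_pairingB x y C0 phil phib) (rlinearB phil) => {xy}.
move: (\int[E]_v pairing phi x v) (\int[E]_v pairing phi y v) => a b; lra.
Qed.

End injectivity.

End semigroup.

(** * Integrability of the resolvent near zero *)

Section stieltjes_derivative.
Context (R : realType) (mu : {measure set (measurableTypeR R) -> \bar R}).
Hypothesis muS : stieltjes_measure mu.

Lemma measurable_shift_inv (x : R) : measurable_fun [set: R] (fun s : R => (x + s)^-1).
Proof. by apply: (measurableT_comp (@measurable_inv R)); exact: measurable_funD. Qed.

Lemma integrable_shift_inv (x : R) : 0 < x ->
  mu.-integrable `]0, +oo[ (EFin \o (fun s : R => (x + s)^-1)).
Proof.
move=> x0.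
have iK : mu.-integrable `]0, +oo[ (EFin \o (fun s : R => (1 + x^-1) * (1 + s)^-1)).
  by apply: rintegrableZ => //; exact: integrable_inv1D.
apply: (le_integrable _ _ _ iK) => //.
  by apply/measurable_EFinP; apply: measurable_funTS; exact: measurable_shift_inv.
move=> s; rewrite /= in_itv /= andbT => s0.
rewrite lee_fin ger0_norm ?invr_ge0 ?addr_ge0 ?(ltW s0) ?(ltW x0) //.
rewrite addrC; apply: le_trans (inv_le_inv1D x0 s0) _; exact: ler_norm.
Qed.

Lemma integrable_shift_inv2 (x : R) : 0 < x ->
  mu.-integrable `]0, +oo[ (EFin \o (fun s : R => (x + s) ^- 2)).
Proof.
move=> x0.
have iK : mu.-integrable `]0, +oo[ (EFin \o (fun s : R => x^-1 * (x + s)^-1)).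
  by apply: rintegrableZ => //; exact: integrable_shift_inv.
apply: (le_integrable _ _ _ iK) => //.
  apply/measurable_EFinP; apply: measurable_funTS.
  under eq_fun do rewrite -exprVn.
  by apply: measurable_funX; exact: measurable_shift_inv.
move=> s; rewrite /= in_itv /= andbT => s0; have xs := addr_gt0 x0 s0.
rewrite lee_fin !ger0_norm ?mulr_ge0 ?invr_ge0 ?exprn_ge0 ?(ltW xs) ?(ltW x0) //.
rewrite -exprVn expr2 ler_wpM2r ?invr_ge0 ?(ltW xs) //.
by rewrite lef_pV2 // lerDl ltW.
Qed.

(** Differentiation under the integral on ]x / 2, x + 1[, where (y + s)^-2 is dominated by its value
    at y = x / 2. *)
Lemma derive1_stieltjes (x : R) : 0 < x ->
  derive1 (stieltjes mu) x = - \int[mu]_(s in `]0, +oo[) ((x + s) ^- 2).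
Proof.
move=> x0; have x20 : 0 < x / 2 by rewrite divr_gt0.
pose f (y s : R) : R := (y + s)^-1.
have df (y s : R) : 0 < y -> 0 < s -> derivable (f ^~ s) y 1 /\ partial1of2 f y s = - (y + s) ^- 2.
  move=> y0 s0; have n0 : y + s != 0 by rewrite gt_eqF // addr_gt0.
  have d1 : is_derive y (1 : R) (fun u : R => u + s) 1.
    by have := @is_deriveD _ _ _ id (cst s) y 1 1 0 (is_derive_id _ _) (is_derive_cst _ _ _);
      rewrite addr0.
  have [d11 d12] := d1.
  split; first exact: derivableV.
  by rewrite partial1of2E deriveV // d12 /GRing.scale /= mulr1.
pose K (s : R) := `|(x / 2 + s) ^- 2|.
rewrite /stieltjes (@differentiation_under_integral R _ (measurableTypeR R) mu f `]0, +oo[ _ x (x / 2) (x + 1) _ _ _ K) //.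
- rewrite -mulN1r -RintegralZl //; last exact: integrable_shift_inv2.
  apply: eq_Rintegral => s /set_mem; rewrite /= in_itv /= andbT => s0.
  by have [_ ->] := df x s x0 s0; rewrite mulN1r.
- by rewrite /= in_itv /= ltrDl ltr01 andbT ltr_pdivrMr // ltr_pMr // ltr1n.
- move=> y; rewrite /= in_itv /= => /andP[xy _]; apply: integrable_shift_inv.
  exact: lt_trans xy.
- move=> y s; rewrite /= !in_itv /= andbT => /andP[xy _] s0.
  by have [] := df y s (lt_trans x20 xy) s0.
- by move=> s; exact: normr_ge0.
- exact: (integrable_norm (integrable_shift_inv2 x20)).
- move=> y s; rewrite /= !in_itv /= andbT => /andP[xy _] s0.
  have y0 := lt_trans x20 xy.
  have [_ ->] := df y s y0 s0.
  rewrite normrN /K !ger0_norm ?invr_ge0 ?exprn_ge0 ?addr_ge0 ?(ltW s0) ?(ltW y0) ?(ltW x20) //.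
  rewrite lef_pV2 ?posrE ?exprn_gt0 ?addr_gt0 // lerXn2r ?nnegrE ?addr_ge0 ?(ltW s0) ?(ltW y0) ?(ltW x20) //.
  by rewrite lerD2r ltW.
Qed.

End stieltjes_derivative.

(** Immediate from the integral as a supremum over simple functions. It allows comparison with the
    integrand of the hypothesis on x without first proving that one measurable. *)
Lemma ge0_le_integral_nonmeasurable d (T : measurableType d) (R : realType)
    (m : {measure set T -> \bar R}) (D : set T) (f g : T -> \bar R) :
  (forall x, D x -> 0 <= f x)%E -> (forall x, D x -> f x <= g x)%E ->
  (\int[m]_(x in D) f x <= \int[m]_(x in D) g x)%E.
Proof.
move=> f0 fg; rewrite integral_mkcond [leRHS]integral_mkcond.
have f0' x : (0 <= (f \_ D) x)%E by rewrite patchE; case: ifP => // /set_mem; exact: f0.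
have fg' x : ((f \_ D) x <= (g \_ D) x)%E.
  by rewrite !patchE; case: ifP => // /set_mem; exact: fg.
rewrite !ge0_integralTE //; last by move=> x; exact: le_trans (fg' x).
apply: le_ereal_sup => _ [h hf <-]; exists h => // x.
exact: le_trans (hf x) (fg' x).
Qed.

(** * Integrated orbits and the norm of the resolvent *)

Section orbit_integral.
Context (R : realType) (X : completeNormedModType R[i]).
Context (T : R -> {linear X -> X}) (M : R).
Notation lambda := (@lebesgue_measure R).
Hypothesis T0 : forall x, T 0 x = x.
Hypothesis TD : forall s t x, 0 <= s -> 0 <= t -> T (s + t) x = T s (T t x).
Hypothesis Tcont : forall x, T t x @[t --> 0^'+] --> x.
Hypothesis M0 : 0 <= M.
Hypothesis TM : forall t x, 0 <= t -> rnorm (T t x) <= M * rnorm x.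
Context (x : X).

(** The unnormalized Cesàro mean r C_r(A) x. *)
Definition orbit_integral (r : R) : X := bochner lambda `[0, r] (fun t => T t x).

Let bochner_itv := bochner_itv_pairing T0 TD Tcont M0 TM.

Lemma pairing_itv_integrable phi (a b : R) : rlinear phi -> rbounded 1 phi ->
  lambda.-integrable `[a, b] (EFin \o (pairing T phi x : R -> R)).
Proof.
move=> phil phib; apply: bounded_measurable_integrable_itv.
exact: (bounded_measurable_pairing T0 TD Tcont M0 TM ler01 phil phib).
Qed.

Lemma orbit_integral_diff r r' : 0 <= r -> r <= r' ->
  rnorm (orbit_integral r' - orbit_integral r) <= M * rnorm x * (r' - r).
Proof.
move=> r0 rr'; have [phi [phil phib <-]] := norming_functional (orbit_integral r' - orbit_integral r).
rewrite (rlinearB phil) /orbit_integral !(bochner_itv ler01 phil phib).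
rewrite Rintegral_itvB; last 3 first.
- exact: pairing_itv_integrable.
- by rewrite bnd_simp.
- by rewrite bnd_simp.
have mI : measurable (`]r, r']%classic : set (measurableTypeR R)) by [].
have iF : lambda.-integrable `]r, r'] (EFin \o (pairing T phi x : R -> R)).
  apply: (integrableS _ mI _ (pairing_itv_integrable r r' phil phib)) => //.
  by move=> t; rewrite /= !in_itv /= => /andP[rt tr]; rewrite tr (ltW rt).
apply: (le_trans (ler_norm _)); apply: (le_trans (le_normr_Rintegral mI iF)).
have -> : M * rnorm x * (r' - r) = \int[lambda]_(t in `]r, r']) (M * rnorm x).
  rewrite Rintegral_cst //= lebesgue_measure_itv /= lte_fin.
  have [h|h] := ltP r r'; first by [].
  have -> : r' = r by apply/eqP; rewrite eq_le h rr'.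
  by rewrite subrr !mulr0.
apply: le_Rintegral => //; first exact: integrable_norm.
  apply: (bounded_rintegrable mI (K := `|M * rnorm x|)) => //.
  by rewrite /= lebesgue_measure_itv; case: ifP => _ //; rewrite -EFinB ltry.
by move=> t _; have := pairing_le TM ler01 phib x t; rewrite mul1r.
Qed.

Definition orbit_norm (r : R) : R := rnorm (orbit_integral `|r|).

Lemma orbit_norm_ge0 r : 0 <= orbit_norm r. Proof. exact: rnorm_ge0. Qed.

Lemma orbit_integral0 : orbit_integral 0 = 0.
Proof.
apply: rfunctional_separates => phi phil phib.
rewrite /orbit_integral (bochner_itv ler01 phil phib) rlinear0 //.
by rewrite set_itv1 Rintegral_set1.
Qed.

Lemma orbit_norm_le r : 0 <= r -> orbit_norm r <= M * rnorm x * r.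
Proof.
move=> r0; have := orbit_integral_diff (lexx 0) r0.
by rewrite orbit_integral0 !subr0 /orbit_norm ger0_norm.
Qed.

Lemma orbit_norm_lipschitz r r' : `|orbit_norm r - orbit_norm r'| <= M * rnorm x * `|r - r'|.
Proof.
have H u v : 0 <= u -> u <= v ->
    `|rnorm (orbit_integral u) - rnorm (orbit_integral v)| <= M * rnorm x * (v - u).
  move=> u0 uv; apply: le_trans (orbit_integral_diff u0 uv).
  by rewrite (rnormB (orbit_integral v)); exact: ler_dist_rnorm.
have K0 : 0 <= M * rnorm x by rewrite mulr_ge0 ?rnorm_ge0.
apply: (@le_trans _ _ (M * rnorm x * `| `|r| - `|r'| |)); last first.
  by rewrite ler_wpM2l // ler_dist_dist.
rewrite /orbit_norm; case/orP: (le_total `|r| `|r'|) => h.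
  rewrite [X in _ <= _ * X]distrC [X in _ <= _ * X]ger0_norm ?subr_ge0 //.
  exact: H (normr_ge0 r) h.
rewrite [X in _ <= _ * X]ger0_norm ?subr_ge0 // distrC.
exact: H (normr_ge0 r') h.
Qed.

Lemma continuous_orbit_norm : continuous orbit_norm.
Proof.
move=> r; have K1 : 0 < M * rnorm x + 1 by rewrite ltr_wpDl // mulr_ge0 ?rnorm_ge0.
apply/cvgrPdist_lt => e e0; exists (e / (M * rnorm x + 1)); first by rewrite /= divr_gt0.
move=> s /= rs; apply: (le_lt_trans (orbit_norm_lipschitz _ _)).
move: rs; rewrite ltr_pdivlMr // mulrC; apply: le_lt_trans.
by rewrite ler_wpM2r // lerDl.
Qed.

Lemma measurable_orbit_norm : measurable_fun [set: R] orbit_norm.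
Proof. by apply: continuous_measurable_fun; exact: continuous_orbit_norm. Qed.

Context (E : {finite_measure set (measurableTypeR R) -> \bar R}) (HE : exponential_law E).

(** An upper bound for the norm of (s + A)^-1 x, read off its representation through r C_r(A) x. *)
Definition resolvent_bound (s : R) : R :=
  \int[lambda]_(r in `[0, +oo[) (s * expR (- s * r) * orbit_norm r).

(** Domination by M |x| times the integrand of [exponential_by_parts] for the constant 1, whose
    primitive is r. *)
Lemma resolvent_bound_integrable s : 0 < s ->
  lambda.-integrable `[0%R, +oo[ (EFin \o (fun r : R => s * expR (- s * r) * orbit_norm r)).
Proof.
move=> s0.
have [i1 _] := exponential_by_parts HE s0 (bounded_measurable_cst _ 1).
have mD : measurable (`[0%R, +oo[%classic : set (measurableTypeR R)) by [].
apply: (le_integrable mD _ _ (rintegrableZ mD (M * rnorm x) i1)).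
  apply/measurable_EFinP; apply: measurable_funTS; apply: measurable_funM => //.
    by apply: measurable_funM => //; exact: measurable_expRM.
  exact: measurable_orbit_norm.
move=> r; rewrite /= in_itv /= andbT => r0.
have se : 0 <= s * expR (- s * r) by rewrite mulr_ge0 ?expR_ge0 // ltW.
rewrite lee_fin (ger0_norm (mulr_ge0 se (orbit_norm_ge0 r))).
apply: le_trans (ler_norm _); rewrite mulrCA ler_wpM2l //.
rewrite Rintegral_cst //= lebesgue_measure_itv /= lte_fin mul1r.
move: r0; rewrite le_eqVlt => /orP[/eqP <-|r0].
  by apply: (le_trans (orbit_norm_le (lexx 0))); rewrite ltxx.
by rewrite r0 oppr0 addr0; exact: (orbit_norm_le (ltW r0)).
Qed.

Lemma exponential_pairing_le phi s : 0 < s -> rlinear phi -> rbounded 1 phi ->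
  `|\int[E]_v pairing T phi x (`|v| / s)| <= s * resolvent_bound s.
Proof.
move=> s0 phil phib.
have bF := bounded_measurable_pairing T0 TD Tcont M0 TM ler01 phil phib x.
have [iF ->] := exponential_by_parts HE s0 bF.
have mD : measurable (`[0%R, +oo[%classic : set (measurableTypeR R)) by [].
rewrite normrM gtr0_norm // ler_wpM2l ?(ltW s0) //.
apply: (le_trans (le_normr_Rintegral mD iF)); apply: le_Rintegral => //.
- exact: integrable_norm.
- exact: resolvent_bound_integrable.
move=> r; rewrite /= in_itv /= andbT => r0.
have se : 0 <= s * expR (- s * r) by rewrite mulr_ge0 ?expR_ge0 // ltW.
rewrite normrM (ger0_norm se) ler_wpM2l // -(bochner_itv ler01 phil phib).
rewrite /orbit_norm (ger0_norm r0) -[leRHS]mul1r; exact: phib.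
Qed.

End orbit_integral.

(** Cube 1 + y <= 3 (1 + y / 3) <= 3 e^(y / 3). *)
Lemma expR_cubic (R : realType) (y : R) : 0 <= y -> (1 + y) ^+ 3 <= 27 * expR y.
Proof.
move=> y0; have h0 : 0 <= y / 3 by rewrite divr_ge0.
have h : 1 + y <= 3 * expR (y / 3).
  have := expR_ge1Dx (y / 3); set e := expR _; have : y = 3 * (y / 3) by field.
  by move: h0; set z := y / 3; lra.
have -> : 27 * expR y = (3 * expR (y / 3)) ^+ 3.
  by rewrite exprMn -expRM_natr divfK //; congr (_ * _); ring.
by rewrite lerXn2r ?nnegrE ?mulr_ge0 ?expR_ge0 ?addr_ge0.
Qed.

(** * From the hypothesis on Cesàro means to integrability near zero *)

Section resolvent_bound_integrable.
Context (R : realType) (X : completeNormedModType R[i]).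
Context (T : R -> {linear X -> X}) (M : R).
Notation lambda := (@lebesgue_measure R).
Hypothesis T0 : forall x, T 0 x = x.
Hypothesis TD : forall s t x, 0 <= s -> 0 <= t -> T (s + t) x = T s (T t x).
Hypothesis Tcont : forall x, T t x @[t --> 0^'+] --> x.
Hypothesis M0 : 0 <= M.
Hypothesis TM : forall t x, 0 <= t -> rnorm (T t x) <= M * rnorm x.
Context (x : X) (mu : {measure set (measurableTypeR R) -> \bar R}).
Context (E : {finite_measure set (measurableTypeR R) -> \bar R}) (HE : exponential_law E).
Hypothesis muS : stieltjes_measure mu.
Hypothesis hx : (\int[lambda]_(t in `[1%R, +oo[)
  (`|derive1 (stieltjes mu) t^-1| * rnorm (cesaro_mean T t x) / t ^+ 2)%:E < +oo)%E.
Notation B := (orbit_norm T x).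

Lemma rnorm_cesaro_mean t : 0 < t -> rnorm (cesaro_mean T t x) = t^-1 * B t.
Proof. by move=> t0; rewrite /cesaro_mean rnormZr /orbit_norm /orbit_integral !gtr0_norm ?invr_gt0. Qed.

(** With y = s r both sides contain the factor b / r, and what remains is y (1 + y)^2 <= (1 + y)^3
    <= 27 e^y. *)
Lemma laplace_kernel_le (s r b : R) : 0 < s -> 0 < r -> 0 <= b ->
  s * expR (- s * r) * b <= 27 * (r^-1 * b / r ^+ 2) * (r^-1 + s) ^- 2.
Proof.
move=> s0 r0 b0; pose y := s * r; have y0 : 0 <= y by rewrite mulr_ge0 // ltW.
have y1 : 0 < 1 + y by rewrite ltr_pwDl.
have r00 : r != 0 by rewrite gt_eqF.
have -> : 27 * (r^-1 * b / r ^+ 2) * (r^-1 + s) ^- 2 = (b / r) * (27 / (1 + y) ^+ 2).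
  have -> : r^-1 + s = (1 + y) / r by rewrite /y; field.
  by field; rewrite r00 gt_eqF.
have -> : s * expR (- s * r) * b = (b / r) * (y / expR y).
  by rewrite mulNr expRN /y; field; rewrite r00 gt_eqF // expR_gt0.
rewrite ler_wpM2l ?divr_ge0 ?(ltW r0) //.
rewrite ler_pdivrMr ?expR_gt0 // mulrAC ler_pdivlMr ?exprn_gt0 //.
apply: le_trans (expR_cubic y0); rewrite [leRHS]exprS ler_wpM2r ?exprn_ge0 ?(ltW y1) //.
by rewrite lerDr.
Qed.

(** For 0 < s <= 1 the weight 1 / max 1 s is 1, so pi acts as mu there; the kernel bound integrated
    against mu yields |g'(1 / r)| by [derive1_stieltjes]. *)
Lemma cutoff_integral_le (pi : {finite_measure set (measurableTypeR R) -> \bar R}) (r : R) :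
  (forall G : R -> R, measurable_fun setT G -> (forall t, 0 <= G t) ->
    (\int[pi]_s (G s)%:E = \int[mu]_(s in `]0%R, +oo[) ((Num.max 1 s)^-1 * G s)%:E)%E) ->
  1 <= r ->
  (\int[pi]_s (if (0 < s) && (s <= 1) then s * expR (- s * r) * B r else 0)%:E <=
   27%:E * (`|derive1 (stieltjes mu) r^-1| * rnorm (cesaro_mean T r x) / r ^+ 2)%:E)%E.
Proof.
move=> piE r1; have r0 : 0 < r := lt_le_trans ltr01 r1.
have ri0 : 0 < r^-1 by rewrite invr_gt0.
rewrite piE; last 2 first.
- apply: measurable_fun_ifT => //.
    by apply: measurable_and; [exact: measurable_fun_ltr|exact: measurable_fun_ler].
  apply: measurable_funM => //; apply: measurable_funM => //.
  under eq_fun do rewrite mulNr mulrC -mulNr.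
  exact: measurable_expRM.
- move=> s; case: ifP => // /andP[s0 _].
  by rewrite !mulr_ge0 ?expR_ge0 ?orbit_norm_ge0 // ltW.
rewrite derive1_stieltjes // normrN rnorm_cesaro_mean //.
have i2 := integrable_shift_inv2 muS ri0.
set c := 27 * (r^-1 * B r / r ^+ 2).
have c0 : 0 <= c by rewrite !mulr_ge0 ?invr_ge0 ?exprn_ge0 ?orbit_norm_ge0 // ltW.
apply: (@le_trans _ _ (\int[mu]_(s in `]0%R, +oo[) (c * (r^-1 + s) ^- 2)%:E)%E).
  apply: ge0_le_integral_nonmeasurable => s; rewrite /= in_itv /= andbT => s0.
    rewrite lee_fin mulr_ge0 ?invr_ge0 ?le_max ?ler01 //.
    case: ifP => // _; by rewrite !mulr_ge0 ?expR_ge0 ?orbit_norm_ge0 // ltW.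
  rewrite lee_fin; case: ifP => [/andP[_ s1]|_].
    have -> : Num.max 1 s = 1 by apply/max_idPl.
    by rewrite invr1 mul1r laplace_kernel_le ?orbit_norm_ge0.
  by rewrite mulr0 mulr_ge0 // invr_ge0 exprn_ge0 // addr_ge0 // ltW.
under eq_integral do rewrite EFinM.
rewrite ge0_integralZl_EFin //; last 2 first.
- by move=> s; rewrite /= in_itv /= andbT => s0; rewrite lee_fin invr_ge0 exprn_ge0 // addr_ge0 // ltW.
- exact: measurable_int i2.
have -> : (\int[mu]_(s in `]0%R, +oo[) ((r^-1 + s) ^- 2)%:E)%E =
    (\int[mu]_(s in `]0, +oo[) ((r^-1 + s) ^- 2))%:E.
  by rewrite /Rintegral fineK //; apply: integrable_fin_num.
rewrite -!EFinM lee_fin /c ger0_norm; first by rewrite le_eqVlt; apply/orP; left; apply/eqP; ring.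
apply: Rintegral_ge0 => s; rewrite /= in_itv /= andbT => s0.
by rewrite invr_ge0 exprn_ge0 // addr_ge0 // ltW.
Qed.

Definition cutoff_kernel (p : measurableTypeR R * measurableTypeR R) : R :=
  if ((0 < p.1) && (p.1 <= 1)) && (0 <= p.2) then p.1 * expR (- p.1 * p.2) * B p.2 else 0.

(** The cut at 1 is enough: approximants at levels eps <= 1 differ only through values s <= 1. *)
Definition cutoff_bound (s : R) : R :=
  if (0 < s) && (s <= 1) then resolvent_bound T x s else 0.

Lemma cutoff_kernel_ge0 p : 0 <= cutoff_kernel p.
Proof.
rewrite /cutoff_kernel; case: ifP => // /andP[/andP[p0 _] _].
by rewrite !mulr_ge0 ?expR_ge0 ?orbit_norm_ge0 // ltW.
Qed.

Lemma measurable_cutoff_kernel : measurable_fun setT cutoff_kernel.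
Proof.
apply: measurable_fun_ifT => //.
  apply: measurable_and; last exact: measurable_fun_ler.
  by apply: measurable_and; [exact: measurable_fun_ltr|exact: measurable_fun_ler].
apply: measurable_funM.
  apply: measurable_funM => //; apply: (measurableT_comp (@measurable_expR R)).
  by apply: measurable_funM => //; exact: measurableT_comp.
exact: (measurableT_comp (measurable_orbit_norm T0 TD Tcont M0 TM x)).
Qed.

Lemma EFin_cutoff_bound s :
  (cutoff_bound s)%:E = (\int[lambda]_r (cutoff_kernel (s, r))%:E)%E.
Proof.
rewrite /cutoff_bound /cutoff_kernel /=; case: ifP => [/andP[s0 s1]|_]; last first.
  by rewrite integral0_eq // => r _.
have iB := resolvent_bound_integrable T0 TD Tcont M0 TM x HE s0.
rewrite /resolvent_bound /Rintegral fineK; last exact: integrable_fin_num.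
rewrite integral_mkcond; apply: eq_integral => r _; rewrite patchE.
have [r0|r0] := leP 0 r.
  by rewrite mem_set //= in_itv /= r0.
by rewrite memNset //= in_itv /= andbT; apply/negP; rewrite -ltNge.
Qed.

Lemma cutoff_bound_ge0 s : 0 <= cutoff_bound s.
Proof.
rewrite -lee_fin EFin_cutoff_bound; apply: integral_ge0 => r _.
by rewrite lee_fin cutoff_kernel_ge0.
Qed.

Lemma measurable_cutoff_bound : measurable_fun [set: measurableTypeR R] cutoff_bound.
Proof.
apply/measurable_EFinP.
rewrite (_ : EFin \o cutoff_bound = fubini_F lambda (EFin \o cutoff_kernel)); last first.
  by apply/funext => s; exact: EFin_cutoff_bound.
apply: measurable_fun_fubini_tonelli_F; last by move=> p; rewrite lee_fin cutoff_kernel_ge0.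
by apply/measurable_EFinP; exact: measurable_cutoff_kernel.
Qed.

(** The hypothesis controls only r >= 1; for smaller r the linear growth of the integrated orbit
    keeps the kernel bounded. *)
Lemma cutoff_kernel_le s r : 0 <= r <= 1 -> cutoff_kernel (s, r) <= M * rnorm x.
Proof.
move=> /andP[r0 r1]; have K0 : 0 <= M * rnorm x by rewrite mulr_ge0 ?rnorm_ge0.
rewrite /cutoff_kernel /= r0 andbT; case: ifP => // /andP[s0 s1].
apply: (@le_trans _ _ (1 * (M * rnorm x * r))); last first.
  by rewrite mul1r ler_piMr.
rewrite ler_pM ?orbit_norm_ge0 ?mulr_ge0 ?expR_ge0 ?(ltW s0) //.
  rewrite mulr_ile1 ?expR_ge0 ?(ltW s0) //.
  by rewrite -expR0 ler_expR mulNr oppr_le0 mulr_ge0 // ltW.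
exact: (orbit_norm_le T0 TD Tcont M0 TM).
Qed.

(** Tonelli puts the integral over r outside. The part r <= 1 is finite because pi is, the part r >=
    1 by the hypothesis on x. *)
Lemma cutoff_bound_lty (pi : {finite_measure set (measurableTypeR R) -> \bar R}) :
  (forall G : R -> R, measurable_fun setT G -> (forall t, 0 <= G t) ->
    (\int[pi]_s (G s)%:E = \int[mu]_(s in `]0%R, +oo[) ((Num.max 1 s)^-1 * G s)%:E)%E) ->
  (\int[pi]_s (cutoff_bound s)%:E < +oo)%E.
Proof.
move=> piE.
have mk : measurable_fun setT (EFin \o cutoff_kernel).
  by apply/measurable_EFinP; exact: measurable_cutoff_kernel.
have k0 p : (0 <= (EFin \o cutoff_kernel) p)%E by rewrite lee_fin cutoff_kernel_ge0.
under eq_integral do rewrite EFin_cutoff_bound.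
rewrite (@fubini_tonelli _ _ _ _ _ pi lambda _ mk k0).
pose J (r : R) : \bar R := (\int[pi]_s (cutoff_kernel (s, r))%:E)%E.
have mJ : measurable_fun [set: measurableTypeR R] J.
  exact: (measurable_fun_fubini_tonelli_G (m1 := pi) _ mk k0).
have J0 r : (0 <= J r)%E by apply: integral_ge0 => s _; exact: (k0 (s, r)).
have m01 : measurable (`[0%R, 1%R]%classic : set (measurableTypeR R)) by [].
have m1y : measurable (`[1%R, +oo[%classic : set (measurableTypeR R)) by [].
apply: (@le_lt_trans _ _ (\int[lambda]_(r in `[0%R, 1%R]) J r +
    \int[lambda]_(r in `[1%R, +oo[) J r)%E).
  rewrite [X in (X + _)%E]integral_mkcond [X in (_ + X)%E]integral_mkcond.
  rewrite -ge0_integralD //; last 4 first.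
  - by move=> r _; rewrite patchE; case: ifP.
  - exact: ((measurable_restrictT J m01).1 (measurable_funTS mJ)).
  - by move=> r _; rewrite patchE; case: ifP.
  - exact: ((measurable_restrictT J m1y).1 (measurable_funTS mJ)).
  apply: ge0_le_integral_nonmeasurable => r _; first exact: J0.
  rewrite !patchE; have [r0|r0] := ltP r 0.
    rewrite -/(J r) /J integral0_eq; last first.
      by move=> s _; rewrite /cutoff_kernel /= [0 <= r]leNgt r0 andbF.
    by rewrite adde_ge0 //; case: ifP.
  have [r1|r1] := leP r 1.
    rewrite mem_set /= ?in_itv /= ?r0 //; rewrite leeDl //.
    by case: ifP.
  rewrite [X in (_ + X)%E]ifT ?inE /= ?in_itv /= ?(ltW r1) //.
  by rewrite leeDr //; case: ifP.
apply: lte_add_pinfty.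
  apply: (@le_lt_trans _ _ (\int[lambda]_(r in `[0%R, 1%R]) (cst ((M * rnorm x)%:E * pi setT)%E r))%E).
    apply: ge0_le_integral_nonmeasurable => r; first by [].
    rewrite /= in_itv /= => r01; rewrite /J -integral_cst //.
    apply: ge0_le_integral_nonmeasurable => s _; first exact: (k0 (s, r)).
    by rewrite lee_fin cutoff_kernel_le.
  rewrite integral_cst //= lebesgue_measure_itv /= lte_fin ltr01 -EFinB subr0 mule1.
  by rewrite ltey_eq fin_numM // fin_num_measure.
have K27 : (27 : R) != 0 by rewrite pnatr_eq0.
(* The constant is put as 1 / 27 on [J], whose measurability is known, and not as 27 on the
   integrand of [hx]. *)
have -> : (\int[lambda]_(r in `[1%R, +oo[) J r =
    27%:E * (27^-1%:E * \int[lambda]_(r in `[1%R, +oo[) J r))%E.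
  by rewrite muleA -EFinM mulfV // mul1e.
apply: lte_mul_pinfty => //; apply: le_lt_trans hx.
rewrite -ge0_integralZl_EFin //; last exact: measurable_funTS.
apply: ge0_le_integral_nonmeasurable => r; first by move=> _; rewrite mule_ge0 // lee_fin.
rewrite /= in_itv /= andbT => r1.
have H := cutoff_integral_le piE r1.
have JE : J r = (\int[pi]_s (if (0 < s) && (s <= 1) then s * expR (- s * r) * B r else 0)%:E)%E.
  by apply: eq_integral => s _; rewrite /cutoff_kernel /= (le_trans ler01 r1) andbT.
have K0 : (0 <= (27^-1 : R)%:E)%E by rewrite lee_fin invr_ge0.
rewrite JE; apply: le_trans (lee_wpmul2l K0 H) _.
by rewrite -!EFinM lee_fin mulKf.
Qed.

Lemma integrable_cutoff_bound : mu.-integrable `]0, +oo[ (EFin \o cutoff_bound).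
Proof.
have minv : measurable_fun [set: R] (fun s : R => (Num.max 1 s)^-1).
  by apply: (measurableT_comp (@measurable_inv R)); exact: measurable_max1.
have [pi piE] := exists_weighted muS minv (@inv_max_bounds R).
have := cutoff_bound_lty piE; rewrite piE; last 2 first.
- exact: measurable_cutoff_bound.
- exact: cutoff_bound_ge0.
move=> H; apply/integrableP; split.
  by apply/measurable_EFinP; apply: measurable_funTS; exact: measurable_cutoff_bound.
apply: le_lt_trans H; apply: ge0_le_integral_nonmeasurable => s; first by [].
move=> _; rewrite /= ger0_norm ?cutoff_bound_ge0 // lee_fin /cutoff_bound.
case: ifP => [/andP[_ s1]|_]; last by rewrite mulr0.
have -> : Num.max 1 s = 1 by apply/max_idPl.
by rewrite invr1 mul1r.
Qed.

End resolvent_bound_integrable.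

(** * The approximants *)

Section truncation.
Context (R : realType) (mu : {measure set (measurableTypeR R) -> \bar R}).
Hypothesis muS : stieltjes_measure mu.
Context (E : {finite_measure set (measurableTypeR R) -> \bar R}).

Definition truncated_inv (eps s : R) : R := if eps < s then s^-1 else 0.

Lemma measurable_truncated_inv eps : measurable_fun [set: R] (truncated_inv eps).
Proof.
apply: measurable_fun_ifT => //; first exact: measurable_fun_ltr.
exact: measurable_inv.
Qed.

Lemma truncated_inv_ge0 eps s : 0 < s -> 0 <= truncated_inv eps s.
Proof. by move=> s0; rewrite /truncated_inv; case: ifP => // _; rewrite invr_ge0 ltW. Qed.

Lemma truncated_inv_bounds eps s : 0 < eps -> 0 < s ->
  0 <= truncated_inv eps s <= (1 + eps^-1) / (1 + s).
Proof.
move=> e0 s0; rewrite truncated_inv_ge0 //= /truncated_inv.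
have s1 : 0 < 1 + s by rewrite addr_gt0.
case: ifP => es; last by rewrite divr_ge0 ?addr_ge0 ?invr_ge0 // ltW.
rewrite ler_pdivlMr // mulrDr mulr1 mulVf ?gt_eqF // addrC lerD2l lef_pV2 ?posrE //.
exact: ltW.
Qed.

Lemma exists_truncated_density eps : 0 < eps ->
  exists pi : {finite_measure set (measurableTypeR R) -> \bar R},
  forall F : R -> R, bounded_measurable (T := measurableTypeR R) F ->
  mu.-integrable `]0%R, +oo[ (EFin \o (fun s : R => truncated_inv eps s * F s)) /\
  \int[pi]_s F s = \int[mu]_(s in `]0, +oo[) (truncated_inv eps s * F s).
Proof.
move=> e0; have mw := measurable_truncated_inv eps.
have [pi piE] := exists_weighted muS mw (fun s => truncated_inv_bounds e0).
exists pi => F bF.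
apply: (@Rintegral_transfer _ _ _ (measurableTypeR R) (measurableTypeR R) pi mu `]0%R, +oo[
  id (truncated_inv eps) _ _ _ _ _ F bF).
- exact: measurable_itv.
- exact: measurable_id.
- exact: measurable_funTS.
- by move=> s; rewrite /= in_itv /= andbT => /truncated_inv_ge0.
- by move=> G mG G0; exact: piE.
Qed.

Lemma bounded_measurable_divabs (f : R -> R) : bounded_measurable f ->
  bounded_measurable (fun p : measurableTypeR R * measurableTypeR R => f (`|p.2| / `|p.1|)).
Proof.
apply: bounded_measurable_comp; apply: measurable_funM; first exact: measurableT_comp.
by apply: (measurableT_comp (@measurable_inv R)); exact: measurableT_comp.
Qed.

Lemma bounded_measurable_addabs (f : R -> R) : bounded_measurable f ->
  bounded_measurable (fun p : (measurableTypeR R * measurableTypeR R) * measurableTypeR R =>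
    f (`|p.1.2| + `|p.2| / `|p.1.1|)).
Proof.
apply: bounded_measurable_comp; apply: measurable_funD.
  by apply: measurableT_comp => //; exact: measurableT_comp.
apply: measurable_funM; first exact: measurableT_comp.
apply: (measurableT_comp (@measurable_inv R)); apply: measurableT_comp => //.
exact: measurableT_comp.
Qed.

(** [m] is the image under v / s of the product of [E] with the finite measure 1 / s mu(ds) on s >
    eps. The last identity is what the regularizer yields on the integral of an orbit against
    [m]. *)
Lemma exists_truncated eps : 0 < eps ->
  exists m : {finite_measure set (measurableTypeR R) -> \bar R},
  forall f : R -> R, bounded_measurable f ->
  [/\ mu.-integrable `]0%R, +oo[
        (EFin \o (fun s : R => truncated_inv eps s * \int[E]_v f (`|v| / s))),
      \int[m]_(t in `[0, +oo[) f t =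
        \int[mu]_(s in `]0, +oo[) (truncated_inv eps s * \int[E]_v f (`|v| / s))
    & \int[m]_(t in `[0, +oo[) f t - \int[E]_t \int[m]_(r in `[0, +oo[) f (`|t| + r) =
        \int[mu]_(s in `]0, +oo[) (truncated_inv eps s * resolvent_defect E f s)].
Proof.
move=> e0; have [pi piE] := exists_truncated_density e0.
pose p (x : measurableTypeR R * measurableTypeR R) : measurableTypeR R := `|x.2| / `|x.1|.
have mp : measurable_fun setT p.
  apply: measurable_funM; first exact: measurableT_comp.
  by apply: (measurableT_comp (@measurable_inv R)); exact: measurableT_comp.
have p0 x : 0 <= p x by rewrite divr_ge0.
have [m mE] := exists_finite_image pi E mp.
exists m => f bf.
have D (s : R) : s \in `]0, +oo[%classic -> 0 < s by move/set_mem; rewrite /= in_itv /= andbT.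
have b1 := bounded_measurable_int2 pi E (bounded_measurable_divabs bf).
have b3 := bounded_measurable_addabs bf.
(* [K] supplies a finite measure on the plane of the pairs (s, t), as first factor in the
   measurability part of Fubini. *)
have [K _] := exists_finite_image pi E (@measurable_id _ (measurableTypeR R * measurableTypeR R)%type setT).
have b2 := bounded_measurable_int2 K E b3.
have b4 := bounded_measurable_int2 pi E b2.
have [i1 e1] := piE _ b1.
have [i2 e2] := piE _ (bounded_measurableB b1 b4).
have m1 : \int[m]_(t in `[0, +oo[) f t = \int[pi]_s \int[E]_v f (`|v| / `|s|).
  exact: (Rintegral_image_halfline p0 mE (bounded_measurable_norm bf)).
split.
- apply: eq_integrable i1; first exact: measurable_itv.
  by move=> s /D s0; rewrite /= gtr0_norm.
- rewrite m1 e1; apply: eq_Rintegral => s /D s0.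
  by rewrite /= gtr0_norm.
have -> : \int[E]_t \int[m]_(r in `[0, +oo[) f (`|t| + r) =
    \int[E]_t \int[pi]_s \int[E]_v f (`|t| + `|v| / `|s|).
  apply: eq_Rintegral => t _.
  have bt : bounded_measurable (fun r : R => f (`|t| + r)).
    by apply: bounded_measurable_comp bf; exact: measurable_funD.
  exact: (Rintegral_image_halfline p0 mE (bounded_measurable_norm bt)).
rewrite m1 -(RFubini pi E b2).
rewrite -(RintegralB measurableT (bounded_measurable_integrable pi measurableT b1)
  (bounded_measurable_integrable pi measurableT b4)).
rewrite e2; apply: eq_Rintegral => s /D s0.
by rewrite /resolvent_defect /= gtr0_norm.
Qed.

End truncation.

Section truncated_integrals.
Context (R : realType) (mu : {measure set (measurableTypeR R) -> \bar R}).

Definition truncate (eps : R) (f : R -> R) (s : R) : R := if eps < s then f s else 0.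

Lemma truncated_invM eps f s : truncated_inv eps s * f s = truncate eps (fun s => s^-1 * f s) s.
Proof. by rewrite /truncated_inv /truncate; case: ifP => // _; rewrite mul0r. Qed.

Lemma truncate_le eps f s : `|truncate eps f s| <= `|f s|.
Proof. by rewrite /truncate; case: ifP => // _; rewrite normr0. Qed.

Lemma integrable_truncate eps (f : R -> R) :
  mu.-integrable `]0, +oo[ (EFin \o f) -> mu.-integrable `]0, +oo[ (EFin \o truncate eps f).
Proof.
move=> fi; have mD : measurable (`]0%R, +oo[%classic : set (measurableTypeR R)) by [].
apply: (le_integrable mD _ _ fi).
  apply/measurable_EFinP; have /measurable_EFinP mf := measurable_int _ fi.
  apply: measurable_fun_if => //; first exact: measurable_fun_ltr.
  apply: measurable_funS mf => //; exact: subIsetl.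
by move=> s _; rewrite /= lee_fin truncate_le.
Qed.

(** Dominated convergence: for fixed s > 0 the truncated values are eventually equal to f s. *)
Lemma Rintegral_truncate_cvg (f : R -> R) : mu.-integrable `]0, +oo[ (EFin \o f) ->
  \int[mu]_(s in `]0, +oo[) truncate (harmonic n) f s @[n --> \oo] -->
  \int[mu]_(s in `]0, +oo[) f s.
Proof.
move=> fi; have mD : measurable (`]0%R, +oo[%classic : set (measurableTypeR R)) by [].
have -> : \int[mu]_(s in `]0, +oo[) f s = fine (\int[mu]_(s in `]0%R, +oo[) (f s)%:E)%E by [].
apply: fine_cvg; rewrite fineK; last exact: integrable_fin_num.
apply: (@dominated_cvg _ _ _ mu `]0%R, +oo[%classic mD _ _ (fun s => `|f s|%:E)).
- by move=> n; exact: measurable_int (integrable_truncate _ fi).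
- move=> s; rewrite /= in_itv /= andbT => s0; apply: cvg_near_cst.
  have /cvgrPdist_lt/(_ _ s0) := @cvg_harmonic R.
  apply: filterS => n; rewrite sub0r normrN => ns.
  by rewrite /truncate (le_lt_trans (ler_norm _) ns).
- by [].
- exact: (integrable_norm fi).
- by move=> n s _; rewrite /= lee_fin truncate_le.
Qed.

End truncated_integrals.

(** * Approximants and their Cauchy estimate *)

Section approximation.
Context (R : realType) (X : completeNormedModType R[i]).
Context (T : R -> {linear X -> X}) (M : R).
Hypothesis T0 : forall x, T 0 x = x.
Hypothesis TD : forall s t x, 0 <= s -> 0 <= t -> T (s + t) x = T s (T t x).
Hypothesis Tcont : forall x, T t x @[t --> 0^'+] --> x.
Hypothesis M0 : 0 <= M.
Hypothesis TM : forall t x, 0 <= t -> rnorm (T t x) <= M * rnorm x.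
Context (x : X) (mu : {measure set (measurableTypeR R) -> \bar R}).
Context (E : {finite_measure set (measurableTypeR R) -> \bar R}) (HE : exponential_law E).
Hypothesis muS : stieltjes_measure mu.

(* [y] plays the role of [g(A) x] with [mu] restricted to the half-line of the [s > eps]. *)
Definition approximant (eps : R) (y : X) : Prop :=
  forall phi C, 0 <= C -> rlinear phi -> rbounded C phi ->
  [/\ mu.-integrable `]0%R, +oo[
        (EFin \o (fun s : R => truncated_inv eps s * \int[E]_v pairing T phi x (`|v| / s))),
      phi y = \int[mu]_(s in `]0, +oo[) (truncated_inv eps s * \int[E]_v pairing T phi x (`|v| / s))
    & phi (hp_bounded T (regularizer E) y) =
        \int[mu]_(s in `]0, +oo[) (truncated_inv eps s * resolvent_defect E (pairing T phi x) s)].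

Lemma exists_approximant eps : 0 < eps -> exists y, approximant eps y.
Proof.
move=> e0; have [m mE] := exists_truncated muS E e0.
exists (bochner m `[0, +oo[ (fun t => T t x)) => phi C C0 phil phib.
have bF := bounded_measurable_pairing T0 TD Tcont M0 TM C0 phil phib x.
have yE := bochner_halfline_pairing T0 TD Tcont M0 TM C0 phil phib m x.
have [i1 e1 e2] := mE _ bF.
split=> //; first by rewrite yE.
rewrite (regularizer_pairing T0 TD Tcont M0 TM HE _ C0 phil phib) yE -e2.
congr (_ - _); apply: eq_Rintegral => t _.
(* At time t the pairing of the approximant is phi o T |t| applied to a Bochner integral; this
   functional passes under the integral, and the semigroup law adds the times. *)
rewrite /pairing -[LHS]/((phi \o T `|t|) _).
rewrite (bochner_halfline_pairing T0 TD Tcont M0 TM (mulr_ge0 C0 M0) (rlinear_comp _ _ phil)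
  (rbounded_comp TM C0 phib (normr_ge0 t)) m x).
apply: eq_Rintegral => r /set_mem; rewrite /= in_itv /= andbT => r0.
by rewrite (pairing_comp TD _ _ _ (normr_ge0 t)) (ger0_norm r0).
Qed.

(** The integrands of y and y' cancel except where exactly one of eps < s and eps' < s holds. There
    s <= 1, so [cutoff_bound] dominates, and it occurs in the tail whose level is not below s. *)
Lemma approximant_diff_le eps eps' y y' phi : eps <= 1 -> eps' <= 1 ->
  approximant eps y -> approximant eps' y' ->
  mu.-integrable `]0, +oo[ (EFin \o cutoff_bound T x) -> rlinear phi -> rbounded 1 phi ->
  phi (y - y') <=
    (\int[mu]_(s in `]0, +oo[) cutoff_bound T x s -
     \int[mu]_(s in `]0, +oo[) truncate eps (cutoff_bound T x) s) +
    (\int[mu]_(s in `]0, +oo[) cutoff_bound T x s -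
     \int[mu]_(s in `]0, +oo[) truncate eps' (cutoff_bound T x) s).
Proof.
move=> e1 e1' ya ya' ic phil phib.
have mD : measurable (`]0%R, +oo[%classic : set (measurableTypeR R)) by [].
have [i yE _] := ya phi 1 ler01 phil phib.
have [i' y'E _] := ya' phi 1 ler01 phil phib.
have it := integrable_truncate eps ic.
have it' := integrable_truncate eps' ic.
have j := rintegrableB mD ic it.
have j' := rintegrableB mD ic it'.
rewrite (rlinearB phil) yE y'E -!RintegralB // -RintegralD //.
apply: le_Rintegral => //.
- exact: rintegrableB.
- exact: rintegrableD.
move=> s; rewrite /= in_itv /= andbT => s0.
have b0 := cutoff_bound_ge0 T0 TD Tcont M0 TM x HE s.
have H : s <= 1 -> `|s^-1 * \int[E]_v pairing T phi x (`|v| / s)| <= cutoff_bound T x s.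
  move=> s1; rewrite /cutoff_bound s0 s1 /= normrM gtr0_norm ?invr_gt0 //.
  rewrite ler_pdivrMl //.
  exact: (exponential_pairing_le T0 TD Tcont M0 TM x HE s0 phil phib).
rewrite !(truncated_invM _ (fun s : R => \int[E]_v pairing T phi x (`|v| / s))) /truncate.
move: H; set I := s^-1 * _; set B := cutoff_bound T x s => H.
case: ifP => es; case: ifP => es'.
- by rewrite !subrr addr0.
- have /H : s <= 1 by rewrite (le_trans _ e1') // leNgt es'.
  by rewrite !subr0 subrr add0r; apply: le_trans; exact: ler_norm.
- have /H : s <= 1 by rewrite (le_trans _ e1) // leNgt es.
  by rewrite sub0r !subr0 subrr addr0 -normrN; apply: le_trans; exact: ler_norm.
- by rewrite !subr0 addr_ge0.
Qed.

End approximation.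

(** * Passage to the limit *)

Section stieltjes_calculus.
Context (R : realType) (X : completeNormedModType R[i]).
Context (T : R -> {linear X -> X}) (M : R).
Notation lambda := (@lebesgue_measure R).
Hypothesis T0 : forall x, T 0 x = x.
Hypothesis TD : forall s t x, 0 <= s -> 0 <= t -> T (s + t) x = T s (T t x).
Hypothesis Tcont : forall x, T t x @[t --> 0^'+] --> x.
Hypothesis M0 : 0 <= M.
Hypothesis TM : forall t x, 0 <= t -> rnorm (T t x) <= M * rnorm x.
Context (x : X) (mu : {measure set (measurableTypeR R) -> \bar R}).
Context (E : {finite_measure set (measurableTypeR R) -> \bar R}) (HE : exponential_law E).

(** The constant adds the mass of delta_0 and M times the mass of [E]. A one-sided bound suffices
    since y and y' may be exchanged. *)
Lemma regularizer_diff_le phi y y' : rlinear phi -> rbounded 1 phi ->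
  phi (hp_bounded T (regularizer E) y) - phi (hp_bounded T (regularizer E) y') <=
  (1 + M) * rnorm (y - y').
Proof.
move=> phil phib.
rewrite [X in X - _](regularizer_pairing T0 TD Tcont M0 TM HE y ler01 phil phib).
rewrite [X in _ - X <= _](regularizer_pairing T0 TD Tcont M0 TM HE y' ler01 phil phib).
have H := Rintegral_pairing_le T0 TD Tcont M0 TM HE (y' - y) ler01 phil phib (@measurable_id _ _ setT).
have i z : E.-integrable setT (EFin \o (fun v => pairing T phi z v)).
  exact: (pairing_integrable T0 TD Tcont M0 TM _ z ler01 phil phib (@measurable_id _ _ setT)).
have e : \int[E]_v pairing T phi (y' - y) v = \int[E]_v pairing T phi y' v - \int[E]_v pairing T phi y v.
  rewrite -RintegralB //.
  by apply: eq_Rintegral => v _; exact: pairingB.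
move: H; rewrite /= e mul1r rnormB.
have : phi y - phi y' <= rnorm (y - y').
  by rewrite -(rlinearB phil) -[leRHS]mul1r; apply: le_trans (phib _); exact: ler_norm.
move: (Rintegral _ _ _) => a; move: (Rintegral _ _ _) => b; lra.
Qed.

Lemma regularizer_cvg phi (y_ : nat -> X) y : rlinear phi -> rbounded 1 phi ->
  y_ n @[n --> \oo] --> y ->
  phi (hp_bounded T (regularizer E) (y_ n)) @[n --> \oo] --> phi (hp_bounded T (regularizer E) y).
Proof.
move=> phil phib /cvg_rnormP yy.
have z : (1 + M) * rnorm (y - y_ n) @[n --> \oo] --> (0 : R).
  by rewrite -(mulr0 (1 + M)); apply: cvgM; [exact: cvg_cst|].
apply/cvgrPdist_le => e e0; move/cvgrPdist_le: z => /(_ _ e0); apply: filterS => n.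
rewrite sub0r normrN => /(le_trans (ler_norm _)) H; rewrite ler_norml.
have H1 := regularizer_diff_le y (y_ n) phil phib.
have H2 := regularizer_diff_le (y_ n) y phil phib.
rewrite rnormB in H2; rewrite (le_trans H1 H) andbT lerNl opprB; exact: le_trans H2 H.
Qed.

Hypothesis muS : stieltjes_measure mu.
Hypothesis hx : (\int[lambda]_(t in `[1%R, +oo[)
  (`|derive1 (stieltjes mu) t^-1| * rnorm (cesaro_mean T t x) / t ^+ 2)%:E < +oo)%E.

Lemma harmonic_le1 n : (harmonic n : R) <= 1.
Proof. by rewrite /harmonic /= invf_le1 // ler1n. Qed.

(** The Cauchy errors are the integrals of [cutoff_bound] over s <= 1 / (n + 1), which vanish in the
    limit. *)
Lemma exists_approximants_limit : exists (y_ : nat -> X) (y : X),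
  (forall n, approximant T x mu E (harmonic n) (y_ n)) /\ y_ n @[n --> \oo] --> y.
Proof.
have /choice[y_ ya] n : exists y, approximant T x mu E (harmonic n) y.
  by apply: (exists_approximant T0 TD Tcont M0 TM x HE muS); exact: harmonic_gt0.
have ic := integrable_cutoff_bound T0 TD Tcont M0 TM HE muS hx.
pose b (n : nat) := \int[mu]_(s in `]0, +oo[) cutoff_bound T x s -
  \int[mu]_(s in `]0, +oo[) truncate (harmonic n) (cutoff_bound T x) s.
have b0 : b n @[n --> \oo] --> (0 : R).
  rewrite -(subrr (\int[mu]_(s in `]0, +oo[) cutoff_bound T x s)).
  by apply: cvgB; [exact: cvg_cst|exact: Rintegral_truncate_cvg].
exists y_, (limn y_); split=> //.
apply: (rnorm_cauchy_cvg _ b0) => n m.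
have [phi [phil phib <-]] := norming_functional (y_ m - y_ n).
exact: (approximant_diff_le T0 TD Tcont M0 TM HE (harmonic_le1 m) (harmonic_le1 n)
  (ya m) (ya n) ic phil phib).
Qed.

(** Under phi both sides are the limit of the truncated integrals of s^-1 times the resolvent
    defect: the left by dominated convergence, the right by continuity of the regularizer. *)
Lemma hp_bounded_regularized (rp rn : {finite_measure set (measurableTypeR R) -> \bar R})
    (y_ : nat -> X) (y : X) :
  (forall f : R -> R, bounded_measurable (fun t : R => f `|t|) ->
    mu.-integrable `]0%R, +oo[ (EFin \o (fun s : R => s^-1 * resolvent_defect E f s)) /\
    \int[rp]_(t in `[0, +oo[) f t - \int[rn]_(t in `[0, +oo[) f t =
      \int[mu]_(s in `]0, +oo[) (s^-1 * resolvent_defect E f s)) ->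
  (forall n, approximant T x mu E (harmonic n) (y_ n)) -> y_ n @[n --> \oo] --> y ->
  hp_bounded T (CMeasure rp rn mzero mzero) x = hp_bounded T (regularizer E) y.
Proof.
move=> rE ya yy; apply: rfunctional_separates => phi phil phib.
rewrite [LHS](hp_bounded_pairing T0 TD Tcont M0 TM rp rn x ler01 phil phib).
have [i ->] := rE _ (bounded_measurable_pairing_norm T0 TD Tcont M0 TM ler01 phil phib x).
apply/esym; apply: (cvg_unique _ (regularizer_cvg phil phib yy)); first exact: Rhausdorff.
have := Rintegral_truncate_cvg i; apply: cvg_trans; apply: near_eq_cvg.
apply: nearW => n; have [_ _ ->] := ya n phi 1 ler01 phil phib.
by apply: eq_Rintegral => s _; rewrite truncated_invM.
Qed.

End stieltjes_calculus.

Theorem theorem3p4 (R : realType) (X : completeNormedModType R[i])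
    (T : R -> {linear X -> X}) (A : set (X * X))
    (mu : {measure set (measurableTypeR R) -> \bar R}) (x : X) :
  bounded_C0_semigroup T ->
  opp_op A = generator T ->
  closure (ran A) = setT ->
  stieltjes_measure mu ->
  stieltjes mu s @[s --> (0 : R)^'+] --> +oo ->
  (\int[@lebesgue_measure R]_(t in `[1%R, +oo[)
     (`|derive1 (stieltjes mu) t^-1| * rnorm (cesaro_mean T t x) / t ^+ 2)%:E < +oo)%E ->
  dom (hp_calculus T (stieltjesC mu)) x.
Proof.
move=> [T0 TD Tcont [M TM]] AT ranA muS _ hx.
(* The bound of the semigroup comes without a sign; |M| serves as the nonnegative one. *)
have {}TM t v : 0 <= t -> rnorm (T t v) <= `|M| * rnorm v.
  by move=> t0; apply: (le_trans (TM t v t0)); rewrite ler_wpM2r ?rnorm_ge0 ?ler_norm.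
have M0 := normr_ge0 M.
have [E HE] := exists_exponential R.
have [rp [rn rE]] := exists_regularized muS HE.
have [y_ [y [ya yy]]] := exists_approximants_limit T0 TD Tcont M0 TM HE muS hx.
exists y, (regularizer E), (CMeasure rp rn mzero mzero); split.
- move=> z z0; exact: (laplace_regularized muS HE (fun f bf => (rE f bf).2)).
- exact: (regularizer_injective T0 TD Tcont M0 TM HE AT ranA).
- exact: (hp_bounded_regularized T0 TD Tcont M0 TM HE rE ya yy).
Qed.
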